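(* Let $U\subset X$ be an open set and let $H\subset X$ be a set (not assumed $\mu$-measurable) with $I_H\subset U$. If $\mathrm{cap}_{\mathrm{BV}}(I_H,U)<\infty$, then a $1$-capacitary potential for $I_H$ in $U$ exists.
   Context: Setting. $(X,d,\mu)$ is a complete metric space with at least two points, equipped with a Borel regular outer measure $\mu$ that is doubling: there is $C_d\ge 1$ with $0<\mu(B(x,2r))\le C_d\,\mu(B(x,r))<\infty$ for every ball $B(x,r)$. A curve is a rectifiable continuous map from a compact interval into $X$, parametrized by arc-length. A nonnegative Borel function $g$ is an upper gradient of an extended real-valued function $u$ on $X$ if $|u(x)-u(y)|\le\int_\gamma g\,ds$ for every curve $\gamma$ with end points $x,y$ (the left side is interpreted as $\infty$ if $|u(x)|$ or $|u(y)|$ is infinite). $X$ supports a $(1,1)$-Poincaré inequality: there are $C_P\ge1$, $\lambda\ge1$ such that $\frac{1}{\mu(B(x,r))}\int_{B(x,r)}|u-u_{B(x,r)}|\,d\mu\le C_P r\,\frac{1}{\mu(B(x,\lambda r))}\int_{B(x,\lambda r)}g\,d\mu$ for all balls, all locally integrable $u$ and all upper gradients $g$ of $u$, where $u_{B}$ is the mean value of $u$ over $B$. Measure theoretic interior. For any $E\subset X$: $I_E=\{x\in X:\lim_{r\to0}\mu(B(x,r)\setminus E)/\mu(B(x,r))=0\}$. Total variation and perimeter. For $u\in L^1_{\mathrm{loc}}(X)$, $\|Du\|(X)=\inf\{\liminf_{i\to\infty}\int_X g_{u_i}\,d\mu:\ u_i\in\mathrm{Lip}_{\mathrm{loc}}(X),\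 u_i\to u\text{ in }L^1_{\mathrm{loc}}(X)\}$, each $g_{u_i}$ being an upper gradient of $u_i$. For $\mu$-measurable $E$, $P(E,X)=\|D\chi_E\|(X)$. Variational BV-capacity. For $U\subset X$ open and an arbitrary set $K\subset U$, $\mathrm{cap}_{\mathrm{BV}}(K,U)=\inf\|Du\|(X)$ over functions $u\in L^1_{\mathrm{loc}}(X)$ with $u\ge1$ in a neighborhood of $K$ and $u=0$ in $X\setminus U$. Capacitary potential. For $U\subset X$ open and $K\subset U$, a $\mu$-measurable set $D\subset U$ is a $1$-capacitary potential for $K$ in $U$ if $K\subset I_D$ and $P(D,X)=\mathrm{cap}_{\mathrm{BV}}(K,U)<\infty$. *)

(* Defs.v *)
From HB Require Import structures.
From mathcomp Require Import all_boot all_order all_algebra.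
From mathcomp Require Import all_classical all_reals all_analysis.
From mathcomp Require Import measurable_realfun.

Set Implicit Arguments.
Unset Strict Implicit.
Unset Printing Implicit Defensive.

Import Order.TTheory GRing.Theory Num.Theory.
Import numFieldNormedType.Exports.

Local Open Scope classical_set_scope.
Local Open Scope ring_scope.
Local Open Scope ereal_scope.

(* [Complete] includes a distinguished point, which [caratheodory_type] needs;
   it is only a witness that the space is nonempty. *)
#[short(type="completeMetricType")]
HB.structure Definition CompleteMetric (R : numDomainType) :=
  {T of Metric R T & Complete T}.

Section Curves.
Context (R : realType) (X : completeMetricType R).
Implicit Types (gamma : R -> X) (g u : X -> \bar R).

Definition borel_set (A : set X) : Prop := <<s @open X >> A.

Definition borel_fun (g : X -> \bar R) : Prop :=
  measurable_fun [set: g_sigma_algebraType (@open X)] g.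

Definition curve_length gamma (a b : R) : \bar R :=
  ereal_sup [set (\sum_(0 <= n < size s)
                    mdist (gamma (nth b (a :: s) n)) (gamma (nth b s n)))%:E
            | s in itv_partition a b].

(* Only the values of [gamma] on [0, L] matter.  The degenerate case L = 0 of a
   constant curve is included. *)
Definition curve (L : R) gamma : Prop :=
  [/\ (0 <= L)%R, {within `[0%R, L], continuous gamma} &
      forall t : R, t \in `[0%R, L] -> curve_length gamma 0 t = t%:E].

(* In \bar R both [+oo - +oo] and [-oo - -oo] are [-oo], so the left-hand side
   is [+oo] as soon as one of the two values is infinite. *)
Definition upper_gradient g u : Prop :=
  [/\ borel_fun g, forall x, 0 <= g x &
      forall (L : R) gamma, curve L gamma ->
        `|u (gamma 0%R) - u (gamma L)| <=
          \int[lebesgue_measure]_(s in `[0%R, L]) g (gamma s)].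

(* "Locally" means on some ball around each point, here and in [L1_loc] and
   [L1_loc_cvg]; a complete doubling space is proper, so this agrees with the
   versions on bounded or relatively compact sets. *)
Definition lip_loc (u : X -> R) : Prop :=
  forall x, exists r K : R, (0 < r)%R /\
    forall y z, ball x r y -> ball x r z ->
      (`|u y - u z| <= K * mdist y z)%R.

End Curves.

Section MetricMeasure.
Context (R : realType) (X : completeMetricType R).
Variable mu : {outer_measure set X -> \bar R}.
Implicit Types (A B D E H K U : set X) (u f : X -> \bar R).

Definition borel_regular : Prop :=
  (forall A, borel_set A -> mu.-cara.-measurable A) /\
  (forall A, exists B, [/\ borel_set B, A `<=` B & mu A = mu B]).

Definition doubling : Prop :=
  exists2 Cd : R, (1 <= Cd)%R &
    forall (x : X) (r : R), (0 < r)%R ->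
      [/\ 0 < mu (ball x (2 * r)%R),
          mu (ball x (2 * r)%R) <= Cd%:E * mu (ball x r) &
          mu (ball x r) < +oo].

(* [mu] restricted to its Caratheodory measurable sets *)
Definition cara_measure :
  {measure set (caratheodory_type mu) -> \bar R} := mu.

Local Notation m := cara_measure.

Definition mean f B : \bar R := (\int[m]_(x in B) f x) / mu B.

Definition L1_loc u : Prop :=
  measurable_fun [set: caratheodory_type mu] u
  /\ forall x, exists2 r : R, (0 < r)%R & m.-integrable (ball x r) u.

Definition poincare11 : Prop :=
  exists CP lambda : R, [/\ (1 <= CP)%R, (1 <= lambda)%R &
    forall (x : X) (r : R) u (g : X -> \bar R), (0 < r)%R ->
      L1_loc u -> upper_gradient g u ->
      mean (fun y => `|u y - mean u (ball x r)|) (ball x r) <=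
        (CP * r)%:E * mean g (ball x (lambda * r)%R)].

Definition L1_loc_cvg (u_ : nat -> X -> R) u : Prop :=
  forall x, exists2 r : R, (0 < r)%R &
    (\int[m]_(y in ball x r) `|(u_ i y)%:E - u y|) @[i --> \oo] --> 0.

(* [E] is arbitrary: [mu] is applied as an outer measure. *)
Definition meas_interior E : set X :=
  [set x | (mu (ball x r `\` E) / mu (ball x r)) @[r --> 0%R^'+] --> 0].

Definition variation_norm u : \bar R :=
  ereal_inf [set l | exists (u_ : nat -> X -> R) (g_ : nat -> X -> \bar R),
    [/\ forall i, lip_loc (u_ i),
        L1_loc_cvg u_ u,
        forall i, upper_gradient (g_ i) (EFin \o u_ i) &
        l = limn_einf (fun i => \int[m]_x g_ i x)]].

Definition perimeter E : \bar R := variation_norm (EFin \o \1_E).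

Definition cap_BV K U : \bar R :=
  ereal_inf [set variation_norm u | u in
    [set u | [/\ L1_loc u, set_nbhs K [set x | 1 <= u x] &
                 forall x, ~ U x -> u x = 0]]].

Definition capacitary_potential K U D : Prop :=
  [/\ mu.-cara.-measurable D, D `<=` U, K `<=` meas_interior D,
      perimeter D = cap_BV K U & cap_BV K U < +oo].

End MetricMeasure.

(* Main.v *)
(** The class of functions u : X -> [0, 1] with u = 1 on K = I_H and u = 0 off U
    is closed under max, min and pointwise limits, and the total variation V is
    submodular: V(min(u, v)) + V(max(u, v)) <= V(u) + V(v).  Hence limsup u_i
    minimizes V in this class as soon as V(u_i) is within 2^-i of the infimum,
    with no compactness argument.  Submodularity against the constant 1/2 shows
    that min(1, 2 u) is again a minimizer, so in the limit the indicator of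
    D = {u > 0} is one, which replaces the coarea formula.

    The infimum is at most the capacity, but D need not contain a neighbourhood
    of K.  Comparing D with D + eta (1 - D) for cutoff functions eta bounds the
    perimeter of D in a ball B(y, s) of U by the measure of B(y, 2s) \ D over s;
    with the Poincare inequality on small balls this shows that if the
    complement of D has small density in one ball, then the density stays small
    at all smaller scales and centres, so D has full measure in a smaller ball.
    By the Lebesgue density theorem every point of K is a density point of D,
    so D can be enlarged by a null set to contain a neighbourhood of K, and the
    capacity is at most the perimeter of D. *)

From HB Require Import structures.
Require Import Defs.
From mathcomp Require Import all_boot all_order all_algebra.
From mathcomp Require Import all_classical all_reals all_analysis.
From mathcomp Require Import measurable_realfun ring lra.

Set Implicit Arguments.
Unset Strict Implicit.
Unset Printing Implicit Defensive.

Import Order.TTheory GRing.Theory Num.Theory.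
Import numFieldNormedType.Exports.

Local Open Scope classical_set_scope.
Local Open Scope ring_scope.
Local Open Scope ereal_scope.

(** * Curves *)

Section CurveLength.
Context (R : realType) (X : completeMetricType R).
Implicit Types (gamma : R -> X) (a b c p q t L : R) (s : seq R).

(** The variation is a relaxation over locally Lipschitz functions and genuine upper gradients. For
    these, taking g on {u > v} and h on the complement need not give an upper gradient of max(u, v).
    Submodularity is therefore proved for smooth substitutes of max and min, whose gradients combine
    g and h with continuous weights. Such weights are almost constant along short curves, and short
    curves suffice because the upper gradient inequality adds up over subarcs; hence the initial
    work on arc length. The statement V(u) <= c is handled as a predicate [approximable], in which
    one tolerance e controls the energy, the L1 distance and, as 1/e, the radius of the ball on
    which the distance is measured. Lower bounds on V are negations of it, so V itself never enters
    the arithmetic. The density argument rests on a scale factor: minimality bounds the energy in a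
    ball of radius s by a constant over s times the measure of the complement of D, and the Poincare
    inequality on balls of radius s / 2^j multiplies it by s / 2^j. All other constants are
    independent of j, so a large j beats them. *)

Fixpoint polygonal_length gamma a s : R :=
  if s is x :: s' then (mdist (gamma a) (gamma x) + polygonal_length gamma x s')%R
  else 0%R.

Lemma polygonal_lengthE gamma a b s :
  (\sum_(0 <= n < size s)
     mdist (gamma (nth b (a :: s) n)) (gamma (nth b s n)))%R =
  polygonal_length gamma a s.
Proof.
elim: s a => [|x s IH] a /=; first by rewrite big_nil.
by rewrite big_nat_recl//= -IH.
Qed.

Lemma polygonal_length_cat gamma a s1 s2 :
  polygonal_length gamma a (s1 ++ s2) =
  (polygonal_length gamma a s1 + polygonal_length gamma (last a s1) s2)%R.
Proof.
by elim: s1 a => [|x s IH] a /=; rewrite ?add0r// IH addrA.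
Qed.

Lemma curve_length_ub gamma a b s : itv_partition a b s ->
  (polygonal_length gamma a s)%:E <= curve_length gamma a b.
Proof.
move=> sab; rewrite -(polygonal_lengthE gamma a b).
by apply: ereal_sup_ubound; exists s.
Qed.

Lemma curve_length_le gamma a b (l : \bar R) :
  (forall s, itv_partition a b s -> (polygonal_length gamma a s)%:E <= l) ->
  curve_length gamma a b <= l.
Proof.
move=> H; apply: ge_ereal_sup => _ [s sab <-].
by rewrite polygonal_lengthE; exact: H.
Qed.

(** Inserting the point c cannot shorten the polygon, by the triangle inequality. If c is already
    the left end, nothing is inserted, because partitions are strictly increasing. *)
Lemma itv_partition_split gamma a b c s : (a <= c <= b)%R ->
  itv_partition a b s -> exists s1 s2,
  [/\ itv_partition a c s1, itv_partition c b s2 &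
   (polygonal_length gamma a s <=
    polygonal_length gamma a s1 + polygonal_length gamma c s2)%R].
Proof.
elim: s a => [|x s IH] a /andP[ac cb].
  move=> /itv_partition_nil ab; exists [::], [::].
  have ca : c = a by apply/eqP; rewrite eq_le ac andbT ab.
  by rewrite ca -ab; split => //=; rewrite addr0.
move=> sab; have [] := sab => /= /andP[ax xs] sb.
have [cx|xc] := ltP c x.
  have s2 : itv_partition c b (x :: s) by split => //=; rewrite cx.
  have [ca|ca] := eqVneq c a.
    by rewrite ca; exists [::], (x :: s); split => //=; rewrite add0r.
  exists [:: c], (x :: s); split => //.
    by apply: itv_partition1; rewrite lt_neqAle eq_sym ca.
  rewrite /= addr0 addrA lerD2r; exact: metric_triangle.
have [|s1 [s2 [h1 h2 h3]]] := IH x _ (itv_partition_cons sab).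
  by rewrite xc.
exists (x :: s1), s2; split => //.
  by move: h1 => [p1 l1]; split => //=; rewrite ax.
by rewrite /= -addrA lerD2l.
Qed.

(** Length is additive over adjacent arcs: concatenating partitions gives one inequality and
    splitting a partition at p the other, both read against the known lengths p and q of the initial
    arcs. *)
Lemma curve_length_arc L gamma p q : curve L gamma -> (0 <= p)%R ->
  (p <= q)%R -> (q <= L)%R -> curve_length gamma p q = (q - p)%:E.
Proof.
move=> [L0 _ H] p0 pq qL.
have Hp : curve_length gamma 0 p = p%:E.
  by apply: H; rewrite in_itv/= p0 (le_trans pq).
have Hq : curve_length gamma 0 q = q%:E.
  by apply: H; rewrite in_itv/= (le_trans p0 pq).
apply/eqP; rewrite eq_le; apply/andP; split.
  apply: curve_length_le => s hs; rewrite lee_fin lerBrDr -lerBrDl.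
  rewrite -lee_fin -Hp; apply: curve_length_le => s0 hs0.
  rewrite lee_fin lerBrDl addrC -lee_fin -Hq.
  have := curve_length_ub gamma (itv_partition_cat hs0 hs).
  by rewrite polygonal_length_cat (eqP hs0.2) EFinD.
rewrite EFinB leeBlDr// -Hq; apply: curve_length_le => s hs.
have [|s1 [s2 [h1 h2 h3]]] := itv_partition_split gamma _ hs (c := p).
  by rewrite p0.
apply: (@le_trans _ _ (polygonal_length gamma 0 s1 +
   polygonal_length gamma p s2)%:E); first by rewrite lee_fin.
by rewrite EFinD addeC leeD ?curve_length_ub// -Hp curve_length_ub.
Qed.

Lemma polygonal_length_shift gamma p a s :
  polygonal_length (fun t => gamma (p + t)%R) a s =
  polygonal_length gamma (p + a)%R (map (fun t => p + t)%R s).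
Proof. by elim: s a => //= x s IH a; rewrite IH. Qed.

Lemma itv_partition_shift p a b s : itv_partition a b s ->
  itv_partition (p + a)%R (p + b)%R (map (fun t => p + t)%R s).
Proof.
move=> [h1 /eqP h2]; split; last by rewrite last_map h2.
by rewrite path_map; apply: sub_path h1 => x y /=; rewrite ltrD2l.
Qed.

Lemma curve_length_shift gamma p a b :
  curve_length (fun t => gamma (p + t)%R) a b =
  curve_length gamma (p + a)%R (p + b)%R.
Proof.
apply/eqP; rewrite eq_le; apply/andP; split.
  apply: curve_length_le => s hs; rewrite polygonal_length_shift.
  exact/curve_length_ub/itv_partition_shift.
apply: curve_length_le => s /(itv_partition_shift (- p)).
rewrite !addKr => hs.
rewrite (_ : polygonal_length _ _ _ = polygonal_length
   (fun t => gamma (p + t)%R) a (map (fun t => - p + t)%R s)).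
  exact: curve_length_ub.
rewrite polygonal_length_shift -map_comp (_ : map _ _ = s)//.
rewrite -[RHS]map_id; apply: eq_map => t /=; lra.
Qed.

Lemma curve_dist L gamma p q : curve L gamma -> (0 <= p)%R ->
  (p <= q)%R -> (q <= L)%R -> (mdist (gamma p) (gamma q) <= q - p)%R.
Proof.
move=> cg p0 pq qL; rewrite -lee_fin -(curve_length_arc cg)//.
have [->|pq'] := eqVneq p q.
  rewrite mdistxx; apply: (@curve_length_ub gamma q q [::]) => //.
have pq1 : (p < q)%R by rewrite lt_neqAle pq'.
by have := curve_length_ub gamma (itv_partition1 pq1); rewrite /= addr0.
Qed.

Lemma lipschitz1_within_continuous gamma (A : set R) :
  (forall s t : R, A s -> A t -> (s <= t)%R ->
    (mdist (gamma s) (gamma t) <= t - s)%R) ->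
  {within A, continuous gamma}.
Proof.
move=> H; apply/subspace_continuousP => x Ax.
apply/metricType_numDomainType.cvgrPdist_lt => e e0.
near=> y; have Ay : A y by near: y; apply: withinT.
have : (`|x - y| < e)%R.
  by near: y; apply: cvg_within; exact: (nbhsx_ballx x e e0).
apply: le_lt_trans; have [xy|yx] := leP x y.
  by rewrite (le_trans (H _ _ Ax Ay xy))// distrC ger0_norm ?subr_ge0.
rewrite metric_sym (le_trans (H _ _ Ay Ax (ltW yx)))// ger0_norm ?subr_ge0//.
exact: ltW.
Unshelve. all: by end_near. Qed.

Lemma curve_arc L gamma p q : curve L gamma -> (0 <= p)%R ->
  (p <= q)%R -> (q <= L)%R -> curve (q - p) (fun t => gamma (p + t)%R).
Proof.
move=> cg p0 pq qL; have [L0 Cg H] := cg; split; first by rewrite subr_ge0.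
- apply: lipschitz1_within_continuous => s t /=; rewrite !in_itv/= => /andP[s0 _].
  move=> /andP[_ tq] st; apply: le_trans (curve_dist cg _ _ _) _; lra.
- move=> t; rewrite in_itv/= => /andP[t0 tq].
  rewrite curve_length_shift addr0 (curve_length_arc cg)//.
  + by congr EFin; lra.
  + lra.
  + lra.
Qed.

End CurveLength.

(** * Integrals along subarcs and localization of upper gradients *)

Section IntegralAlongCurves.
Context (R : realType) (X : completeMetricType R).
Implicit Types (gamma : R -> X) (g u : X -> \bar R).
Local Notation leb := (@lebesgue_measure R).

Lemma measurable_curve L gamma g : curve L gamma -> borel_fun g ->
  measurable_fun `[0%R, L] (fun s => g (gamma s)).
Proof.
move=> [_ Cg _] mg.
apply: (measurable_comp (F := [set: g_sigma_algebraType (@open X)])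
  (g := gamma : R -> g_sigma_algebraType (@open X))) => //.
apply: (@measurability _ _ _ (g_sigma_algebraType (@open X)) _ _ (@open X)) => //.
move=> _ [U oU <-]; apply: open_measurable_subspace => //.
by move/continuousP : Cg; exact.
Qed.

(** Translation invariance by uniqueness: the push-forward gives half-open intervals their
    length. *)
Lemma lebesgue_measure_shift (p : R) (A : set R) : measurable A ->
  pushforward leb (fun t : measurableTypeR R => (p + t)%R : measurableTypeR R) A
  = leb A.
Proof.
have mp : measurable_fun setT
    (fun t : measurableTypeR R => (p + t)%R : measurableTypeR R).
  exact: measurable_funD.
have mp' := isMeasurableFun.Build _ _ _ _ _ mp.
pose phi : {mfun _ >-> _} :=
  HB.pack (fun t : measurableTypeR R => (p + t)%R : measurableTypeR R) mp'.
move=> mA; apply/esym.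
apply: (@lebesgue_measure_unique _ (pushforward leb phi)) => //= _ [[a b]] _ <-.
rewrite /pushforward /= (_ : _ @^-1` _ = `](a - p)%R, (b - p)%R]%classic).
  rewrite !lebesgue_measure_itv/= !lte_fin ltrD2r.
  by case: ifP => // _; congr EFin; ring.
by apply/seteqP; split => t /=; rewrite !in_itv/= => /andP[? ?]; apply/andP; split; lra.
Qed.

Lemma integral_shift (p a b : R) (f : R -> \bar R) :
  measurable_fun `[(p + a)%R, (p + b)%R] f ->
  (forall t, (p + a <= t <= p + b)%R -> 0 <= f t) ->
  \int[leb]_(t in `[a, b]) f (p + t)%R = \int[leb]_(t in `[(p + a)%R, (p + b)%R]) f t.
Proof.
move=> mf f0.
have -> : `[a, b]%classic =
  (fun t : measurableTypeR R => (p + t)%R : measurableTypeR R) @^-1`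
    `[(p + a)%R, (p + b)%R].
  by apply/seteqP; split => t /=; rewrite !in_itv/= !lerD2l.
have mp : measurable_fun setT
    (fun t : measurableTypeR R => (p + t)%R : measurableTypeR R).
  exact: measurable_funD.
rewrite -(ge0_integral_pushforward mp)//.
- by apply: eq_measure_integral => A mA _; exact: lebesgue_measure_shift.
- by move=> t; rewrite inE/= in_itv/=; exact: f0.
Qed.

Lemma integral_arc L gamma g p q : curve L gamma -> borel_fun g ->
  (forall x, 0 <= g x) -> (0 <= p)%R -> (p <= q)%R -> (q <= L)%R ->
  \int[leb]_(t in `[0%R, (q - p)%R]) g (gamma (p + t)%R) =
  \int[leb]_(t in `[p, q]) g (gamma t).
Proof.
move=> cg mg g0 p0 pq qL.
rewrite (@integral_shift p 0 (q - p) (fun t => g (gamma t)))//.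
  by rewrite addr0 subrKC.
rewrite addr0 subrKC.
apply: measurable_funS (measurable_curve cg mg) => //.
by apply: subset_itv; rewrite ?bnd_simp.
Qed.

Lemma integral_arc_cat L gamma g p q r : curve L gamma -> borel_fun g ->
  (forall x, 0 <= g x) -> (0 <= p)%R -> (p <= q)%R -> (q <= r)%R -> (r <= L)%R ->
  \int[leb]_(t in `[p, q]) g (gamma t) + \int[leb]_(t in `[q, r]) g (gamma t) =
  \int[leb]_(t in `[p, r]) g (gamma t).
Proof.
move=> cg mg g0 p0 pq qr rL.
have mf : measurable_fun `[p, r] (fun t => g (gamma t)).
  apply: measurable_funS (measurable_curve cg mg) => //.
  by apply: subset_itv; rewrite ?bnd_simp.
rewrite -[X in _ + X]integral_itv_obnd_cbnd; last first.
  by apply: measurable_funS mf => //; apply: subset_itv; rewrite ?bnd_simp.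
rewrite (@itv_bndbnd_setU _ _ (BLeft p) (BRight q) (BRight r)) ?bnd_simp//.
rewrite ge0_integral_setU//=.
  by rewrite -itv_bndbnd_setU ?bnd_simp.
apply/disj_set2P/seteqP; split => t //=; rewrite !in_itv/=.
by move=> [/andP[_ tq] /andP[qt _]]; move: tq; rewrite leNgt qt.
Qed.

(** Connectedness of [0, L] for a transitive relation: at the supremum c of the t with [Q 0 t], a
    point of this set just below c is joined to a point beyond c, unless c = L. *)
Lemma interval_chain (Q : R -> R -> Prop) (L : R) : (0 <= L)%R ->
  (forall p q r, (0 <= p)%R -> (p <= q)%R -> (q <= r)%R -> (r <= L)%R ->
     Q p q -> Q q r -> Q p r) ->
  (forall t, (0 <= t <= L)%R -> exists2 d : R, (0 < d)%R &
     forall p q, (0 <= p)%R -> (p <= q)%R -> (q <= L)%R ->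
       (`|t - p| < d)%R -> (`|t - q| < d)%R -> Q p q) ->
  Q 0%R L.
Proof.
move=> L0 Qcat Qloc.
pose S := [set t | (0 <= t <= L)%R /\ Q 0%R t].
have S0 : S 0%R.
  split; first by rewrite lexx.
  have [|d d0] := Qloc 0%R; first by rewrite lexx.
  by apply => //; rewrite subrr normr0.
have supS : has_sup S by split; [exists 0%R|exists L => t [/andP[]]].
pose c := sup S.
have c0 : (0 <= c)%R by apply: sup_upper_bound.
have cL : (c <= L)%R by apply: ge_sup; [exists 0%R|move=> t [/andP[]]].
have [|d d0 Hd] := Qloc c; first by rewrite c0.
have [t [/andP[t0 tL] Qt] ct] := sup_adherent d0 supS.
have tc : (t <= c)%R by apply: sup_upper_bound => //; split => //; rewrite t0.
pose r := Num.min L (c + d / 2)%R.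
have cr : (c <= r)%R by rewrite le_min cL/= lerDl divr_ge0// ltW.
have rL : (r <= L)%R by rewrite ge_min lexx.
have rd : (r <= c + d / 2)%R by rewrite ge_min lexx orbT.
have Qr : Q 0%R r.
  apply: (Qcat _ t) => //; first exact: le_trans cr.
  apply: Hd => //; first exact: le_trans cr.
  - rewrite ger0_norm ?subr_ge0//; rewrite -/c in ct; lra.
  - rewrite ler0_norm ?subr_le0//; lra.
have rc : (r <= c)%R.
  by apply: sup_upper_bound => //; split => //; rewrite rL andbT (le_trans c0).
have : (r < c + d / 2)%R by lra.
rewrite gt_min => /orP[Lr|]; last by rewrite ltxx.
have rE : r = L by apply/min_idPl; exact: ltW.
by move: Qr; rewrite rE.
Qed.

(** Increments are subadditive and integrals additive over adjacent subarcs, so curves inside small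
    balls are enough. There a continuous weight is constant up to a small error. *)
Lemma upper_gradient_local (g : X -> \bar R) (f : X -> R) :
  borel_fun g -> (forall x, 0 <= g x) ->
  (forall x, exists2 r : R, (0 < r)%R & forall L gamma, curve L gamma ->
     (forall t, (0 <= t <= L)%R -> ball x r (gamma t)) ->
     (`|f (gamma 0%R) - f (gamma L)|)%:E <=
     \int[leb]_(t in `[0%R, L]) g (gamma t)) ->
  upper_gradient g (EFin \o f).
Proof.
move=> mg g0 H; split => // L gamma cg.
have [L0 _ _] := cg.
pose Q p q := (`|f (gamma p) - f (gamma q)|)%:E <=
    \int[leb]_(t in `[p, q]) g (gamma t).
apply: (@interval_chain Q) => //.
- move=> p q r p0 pq qr rL Qpq Qqr; rewrite /Q.
  rewrite -(integral_arc_cat cg mg g0 p0 pq qr rL).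
  apply: le_trans (leeD Qpq Qqr); rewrite -EFinD lee_fin.
  by rewrite (le_trans _ (ler_normD _ _))// addrA subrK.
- move=> t /andP[t0 tL]; have [r r0 Hr] := H (gamma t).
  exists r => // p q p0 pq qL tp tq; rewrite /Q.
  have := Hr _ _ (curve_arc cg p0 pq qL).
  rewrite addr0 subrKC (integral_arc cg)//; apply => s /andP[s0 sq].
  rewrite ballEmdist/=.
  have [ts|st] := leP t (p + s)%R.
    rewrite (le_lt_trans (curve_dist cg t0 ts _))//; first lra.
    apply: le_lt_trans tq; rewrite distrC ger0_norm; lra.
  rewrite metric_sym (le_lt_trans (curve_dist cg _ (ltW st) tL))//; first lra.
  apply: le_lt_trans tp; rewrite ger0_norm; lra.
Qed.

End IntegralAlongCurves.

(** * Upper gradients *)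

Section UpperGradientCalculus.
Context (R : realType) (X : completeMetricType R).
Implicit Types (gamma : R -> X) (g h : X -> \bar R) (u v f w eta : X -> R).
Local Notation leb := (@lebesgue_measure R).
Local Notation Xb := (g_sigma_algebraType (@open X)).

Lemma lip_loc_continuous u : lip_loc u -> continuous u.
Proof.
move=> Lu x; have [r [K [r0 HK]]] := Lu x.
apply/cvgrPdist_lt => e e0.
have K0 : (0 < `|K| + 1)%R by rewrite ltr_wpDl.
have d0 : (0 < e / (`|K| + 1))%R by rewrite divr_gt0.
near=> y.
have xy : ball x r y by near: y; exact: nbhsx_ballx.
have := HK _ _ (ballxx x r0) xy; move=> /le_lt_trans; apply.
have : ball x (e / (`|K| + 1)) y by near: y; exact: nbhsx_ballx.
rewrite ballEmdist/= ltr_pdivlMr// mulrC; apply: le_lt_trans.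
rewrite ler_wpM2r ?mdist_ge0//; have := ler_norm K; lra.
Unshelve. all: by end_near. Qed.

Lemma lip_loc_le2 f u v : lip_loc u -> lip_loc v ->
  (forall x y, (`|f x - f y| <= `|u x - u y| + `|v x - v y|)%R) -> lip_loc f.
Proof.
move=> Lu Lv H x; have [r [K [r0 HK]]] := Lu x.
have [r' [K' [r'0 HK']]] := Lv x.
exists (Num.min r r'), (K + K')%R; split; first by rewrite lt_min r0.
move=> y z hy hz; apply: le_trans (H y z) _.
rewrite mulrDl; apply: lerD.
- apply: HK; [move: hy|move: hz]; apply: le_ball; by rewrite ge_min lexx.
- apply: HK'; [move: hy|move: hz]; apply: le_ball; by rewrite ge_min lexx orbT.
Qed.

Lemma lip_loc_cst (c : R) : lip_loc (fun _ : X => c).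
Proof.
by move=> x; exists 1%R, 0%R; split => // y z _ _; rewrite subrr normr0 mul0r.
Qed.

Lemma lip_loc_scale f u (a : R) : (0 <= a)%R -> lip_loc u ->
  (forall x y, (`|f x - f y| <= a * `|u x - u y|)%R) -> lip_loc f.
Proof.
move=> a0 Lu H x; have [r [K [r0 HK]]] := Lu x.
exists r, (a * K)%R; split=> // y z hy hz; apply: le_trans (H y z) _.
by rewrite -mulrA ler_wpM2l// HK.
Qed.

Lemma continuous_borel u : continuous u -> measurable_fun [set: Xb] (u : Xb -> R).
Proof.
move=> cu; apply: (measurability _ (RGenOpens.measurableE R)).
move=> _ [_ [a [b ->] <-]]; rewrite setTI; apply: sub_sigma_algebra.
by move/continuousP : cu; apply; exact: interval_open.
Qed.

Lemma upper_gradient_scale g u f (a : R) : (0 <= a)%R ->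
  (forall x y, (`|f x - f y| <= a * `|u x - u y|)%R) ->
  upper_gradient g (EFin \o u) ->
  upper_gradient (fun x => a%:E * g x) (EFin \o f).
Proof.
move=> a0 H [mg g0 Hg]; split.
- by apply: measurable_funeM.
- by move=> x; rewrite mule_ge0.
- move=> L gamma cg; rewrite ge0_integralZl//; last exact: measurable_curve cg mg.
  apply: le_trans (lee_wpmul2l _ (Hg _ _ cg)); last by rewrite lee_fin.
  by rewrite lee_fin.
Qed.

Lemma upper_gradient_contraction g u f :
  (forall x y, (`|f x - f y| <= `|u x - u y|)%R) ->
  upper_gradient g (EFin \o u) -> upper_gradient g (EFin \o f).
Proof.
move=> H ug; rewrite (_ : g = (fun x => 1%:E * g x)); last first.
  by apply/funext => x; rewrite mul1e.
by apply: upper_gradient_scale ug => // x y; rewrite mul1r.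
Qed.

Lemma upper_gradient_cst (c : R) : upper_gradient (cst 0) (EFin \o (fun _ : X => c)).
Proof.
split => //; first exact: measurable_cst.
by move=> L gamma cg; rewrite /= subrr normr0 integral_ge0.
Qed.

Lemma borel_funM f g : continuous f -> borel_fun g ->
  borel_fun (fun x => (f x)%:E * g x).
Proof.
move=> cf mg; apply: emeasurable_funM => //.
by apply/measurable_EFinP; exact: continuous_borel.
Qed.

Lemma le_integral_curve (L : R) gamma g f (c : R) : curve L gamma ->
  borel_fun g -> (forall x, 0 <= g x) -> continuous f -> (0 <= c)%R ->
  (forall t, (0 <= t <= L)%R -> (c <= f (gamma t))%R) ->
  c%:E * \int[leb]_(t in `[0%R, L]) g (gamma t) <=
  \int[leb]_(t in `[0%R, L]) ((f (gamma t))%:E * g (gamma t)).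
Proof.
move=> cg mg g0 cf c0 H.
have mgc := measurable_curve cg mg.
rewrite -ge0_integralZl//; apply: ge0_le_integral => //.
- by move=> t _; rewrite mule_ge0.
- exact: measurable_funeM.
- exact: (measurable_curve cg (borel_funM cf mg)).
- by move=> t /=; rewrite in_itv/= => /H ?; rewrite lee_wpmul2r.
Qed.

(** A smooth maximum (sigma = 1) or minimum (sigma = -1): |a - b| is replaced by sqrt((a - b)^2 +
    d^2). *)
Definition soft_extremum (sigma d a b : R) : R :=
  (a + b + sigma * Num.sqrt ((a - b) ^+ 2 + d ^+ 2))/2.

(** The partial derivative of [soft_extremum] in a; the one in b is 1 minus it. *)
Definition soft_weight (sigma d a b : R) : R :=
  (1 + sigma * ((a - b) / Num.sqrt ((a - b) ^+ 2 + d ^+ 2)))/2.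

Let sq (d t : R) := Num.sqrt (t ^+ 2 + d ^+ 2).

Let sq_gt0 d t : (0 < d)%R -> (0 < sq d t)%R.
Proof. by move=> d0; rewrite sqrtr_gt0 ltr_wpDl ?sqr_ge0// exprn_gt0. Qed.

Let sqK d t : (sq d t ^+ 2 = t ^+ 2 + d ^+ 2)%R.
Proof. by rewrite sqr_sqrtr// addr_ge0 ?sqr_ge0. Qed.

Let le_sq d t : (0 < d)%R -> (`|t| < sq d t)%R.
Proof.
move=> d0; rewrite -sqrtr_sqr ltr_sqrt ?ltrDl ?exprn_gt0//.
by rewrite ltr_wpDl ?sqr_ge0// exprn_gt0.
Qed.

(* The difference quotient of [sqrt (t ^ 2 + d ^ 2)] is the mediant of its
   derivatives at the two end points. *)
Let sq_mediant d t t' lo hi : (0 < d)%R ->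
  (lo <= t / sq d t <= hi)%R -> (lo <= t' / sq d t' <= hi)%R ->
  exists tau : R, [/\ (lo <= tau <= hi)%R, (`|tau| <= 1)%R &
    (sq d t - sq d t' = tau * (t - t'))%R].
Proof.
move=> d0 /andP[a1 a2] /andP[b1 b2].
have s0 := sq_gt0 t d0; have s0' := sq_gt0 t' d0.
move: a1 a2 b1 b2.
rewrite !ler_pdivlMr// !ler_pdivrMr// => a1 a2 b1 b2.
have S0 : (0 < sq d t + sq d t')%R by rewrite addr_gt0.
exists ((t + t') / (sq d t + sq d t'))%R; split.
- rewrite ler_pdivlMr// ler_pdivrMr//; apply/andP; split; lra.
- rewrite normrM normfV (gtr0_norm S0) ler_pdivrMr// mul1r.
  by rewrite (le_trans (ler_normD _ _))// lerD ?ltW ?le_sq.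
- apply: (mulIf (lt0r_neq0 S0)); rewrite -subr_sqr !sqK.
  by rewrite mulrAC divfK ?lt0r_neq0//; ring.
Qed.

Lemma soft_weight01 sigma d a b : (0 < d)%R -> (`|sigma| <= 1)%R ->
  (0 <= soft_weight sigma d a b <= 1)%R.
Proof.
move=> d0 s1; rewrite /soft_weight -/(sq d (a - b)).
have : (`|sigma * ((a - b) / sq d (a - b))| <= 1)%R.
  rewrite normrM mulr_ile1// normrM normfV (gtr0_norm (sq_gt0 _ d0)).
  by rewrite ler_pdivrMr ?sq_gt0// mul1r ltW// le_sq.
by rewrite ler_norml => /andP[? ?]; apply/andP; split; lra.
Qed.

Lemma soft_extremum_lip sigma d a b a' b' : (0 < d)%R -> (`|sigma| <= 1)%R ->
  (`|soft_extremum sigma d a b - soft_extremum sigma d a' b'| <=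
    `|a - a'| + `|b - b'|)%R.
Proof.
move=> d0 s1.
have B t : (-1 <= t / sq d t <= 1)%R.
  rewrite -ler_norml normrM normfV (gtr0_norm (sq_gt0 _ d0)).
  by rewrite ler_pdivrMr ?sq_gt0// mul1r ltW// le_sq.
have [tau [_ t1 E]] := sq_mediant d0 (B (a - b)%R) (B (a' - b')%R).
have : (`|sigma * tau| <= 1)%R by rewrite normrM mulr_ile1.
rewrite ler_norml => /andP[c1 c2].
have -> : (soft_extremum sigma d a b - soft_extremum sigma d a' b' =
  (1 + sigma * tau) / 2 * (a - a') + (1 - sigma * tau) / 2 * (b - b'))%R.
  move: E; rewrite /soft_extremum -/(sq d (a - b)) -/(sq d (a' - b')) => E.
  have -> : sq d (a - b) = (sq d (a' - b') + tau * (a - b - (a' - b')))%R by lra.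
  by field.
rewrite (le_trans (ler_normD _ _))// !(normrM (_ / 2)%R) lerD//.
  by rewrite ler_piMl// ger0_norm; lra.
by rewrite ler_piMl// ger0_norm; lra.
Qed.

Lemma continuous_soft_weight sigma d u v : (0 < d)%R -> continuous u ->
  continuous v -> continuous (fun x => soft_weight sigma d (u x) (v x)).
Proof.
move=> d0 cu cv x; rewrite /continuous_at /soft_weight.
have cuv : (u y - v y)%R @[y --> x] --> (u x - v x)%R by exact: (cvgB (cu x) (cv x)).
apply: cvgM; last exact: cvg_cst.
apply: cvgD; first exact: cvg_cst.
apply: cvgM; first exact: cvg_cst.
apply: cvgM => //; apply: cvgV; first by rewrite lt0r_neq0// sq_gt0.
apply: (@continuous_comp _ _ _ (fun y => (u y - v y) ^+ 2 + d ^+ 2)%R Num.sqrt).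
  by apply: cvgD; [rewrite !expr2; exact: cvgM|exact: cvg_cst].
exact: sqrt_continuous.
Qed.

(** The increment of the soft extremum combines those of u and v with weights (1 + sigma tau) / 2
    and (1 - sigma tau) / 2, where the mediant tau obeys the same bounds as q at the two ends. On a
    ball where q stays within e of its central value, these weights differ from the soft weights by
    at most e; the added e pays for this. *)
Lemma upper_gradient_soft sigma d e u v g h : (0 < d)%R -> (0 < e)%R ->
  (`|sigma| <= 1)%R -> continuous u -> continuous v ->
  upper_gradient g (EFin \o u) -> upper_gradient h (EFin \o v) ->
  upper_gradient (fun x => (soft_weight sigma d (u x) (v x) + e)%:E * g x +
     (1 - soft_weight sigma d (u x) (v x) + e)%:E * h x)
    (EFin \o (fun x => soft_extremum sigma d (u x) (v x))).
Proof.
move=> d0 e0 s1 cu cv [mg g0 Hg] [mh h0 Hh].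
set b := fun x => soft_weight sigma d (u x) (v x).
have cb : continuous b by exact: continuous_soft_weight.
have b01 x : (0 <= b x <= 1)%R by exact: soft_weight01.
have cb1 : continuous (fun x => b x + e)%R.
  by move=> x; apply: cvgD; [exact: cb|exact: cvg_cst].
have cb2 : continuous (fun x => 1 - b x + e)%R.
  move=> x; apply: cvgD; last exact: cvg_cst.
  by apply: cvgB; [exact: cvg_cst|exact: cb].
have mbg := borel_funM cb1 mg; have mbh := borel_funM cb2 mh.
have bg0 x : 0 <= (b x + e)%:E * g x.
  by rewrite mule_ge0// lee_fin; have := b01 x; lra.
have bh0 x : 0 <= (1 - b x + e)%:E * h x.
  by rewrite mule_ge0// lee_fin; have := b01 x; lra.
apply: upper_gradient_local.
- exact: emeasurable_funD.
- by move=> x; apply: adde_ge0; [exact: bg0|exact: bh0].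
move=> x.
pose q := fun x => ((u x - v x) / sq d (u x - v x))%R.
have bq y : b y = ((1 + sigma * q y) / 2)%R by [].
have cq : continuous q.
  have := @continuous_soft_weight 1 d u v d0 cu cv => c1 y.
  rewrite (_ : q = (fun y => soft_weight 1 d (u y) (v y) * 2 - 1)%R).
    by apply: cvgB; [apply: cvgM; [exact: c1|exact: cvg_cst]|exact: cvg_cst].
  by apply/funext => z; rewrite /soft_weight /q /sq; field; rewrite lt0r_neq0// sq_gt0.
have /cvgrPdist_lt/(_ _ e0) := cq x; rewrite -nbhs_ballE => -[r /= r0 Hr].
exists r => // L gamma cg Hin.
have [L0 _ _] := cg.
have qb t : (0 <= t <= L)%R -> (q x - e <= q (gamma t) <= q x + e)%R.
  move=> /Hin/Hr; rewrite ltr_distlC => /andP[? ?]; apply/andP; split; lra.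
have [||tau [/andP[t1 t2] tau1 E]] := sq_mediant d0 (qb 0%R _) (qb L _).
- by rewrite lexx.
- by rewrite lexx andbT.
have st1 : (`|sigma * tau| <= 1)%R by rewrite normrM mulr_ile1.
have := st1; rewrite ler_norml => /andP[c1 c2].
have stb t : (0 <= t <= L)%R -> (`|sigma * tau - sigma * q (gamma t)| <= 2 * e)%R.
  move=> /qb /andP[q1 q2]; rewrite -mulrBr normrM.
  apply: (@le_trans _ _ (1 * `|tau - q (gamma t)|)%R); first by rewrite ler_wpM2r.
  rewrite mul1r ler_norml; apply/andP; split; lra.
have -> : (soft_extremum sigma d (u (gamma 0%R)) (v (gamma 0%R)) -
   soft_extremum sigma d (u (gamma L)) (v (gamma L)) =
  (1 + sigma * tau) / 2 * (u (gamma 0%R) - u (gamma L)) +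
  (1 - sigma * tau) / 2 * (v (gamma 0%R) - v (gamma L)))%R.
  move: E; rewrite /soft_extremum; set S := Num.sqrt _; set S' := Num.sqrt _.
  rewrite /sq -/S -/S' => E; rewrite (_ : S = S' + tau * ((u (gamma 0%R) - v (gamma 0%R)) -
    (u (gamma L) - v (gamma L))))%R; last by rewrite -E; ring.
  by field.
rewrite ge0_integralD//; last 4 first.
- by move=> t _; exact: bg0.
- exact: (measurable_curve cg mbg).
- by move=> t _; exact: bh0.
- exact: (measurable_curve cg mbh).
apply: (@le_trans _ _ ((((1 + sigma * tau) / 2)%:E * `|(u (gamma 0%R) - u (gamma L))%:E|) +
  (((1 - sigma * tau) / 2)%:E * `|(v (gamma 0%R) - v (gamma L))%:E|))).
  rewrite /= -!EFinM -EFinD lee_fin (le_trans (ler_normD _ _))// !(normrM (_ / 2)%R).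
  by rewrite !(@ger0_norm _ (_ / 2)%R)//; lra.
apply: leeD.
- apply: (@le_trans _ _ (((1 + sigma * tau) / 2)%:E *
     \int[leb]_(t in `[0%R, L]) g (gamma t))).
    by apply: lee_wpmul2l; [rewrite lee_fin; lra|exact: Hg].
  apply: (le_integral_curve (f := fun x => b x + e)%R) => //; first by lra.
  move=> t /stb; rewrite bq ler_norml => /andP[? ?]; lra.
- apply: (@le_trans _ _ (((1 - sigma * tau) / 2)%:E *
     \int[leb]_(t in `[0%R, L]) h (gamma t))).
    by apply: lee_wpmul2l; [rewrite lee_fin; lra|exact: Hh].
  apply: (le_integral_curve (f := fun x => 1 - b x + e)%R) => //; first by lra.
  move=> t /stb; rewrite bq ler_norml => /andP[? ?]; lra.
Qed.

End UpperGradientCalculus.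

(** * Cutoff functions and the product rule *)

Section Leibniz.
Context (R : realType) (X : completeMetricType R).
Implicit Types (gamma : R -> X) (g h : X -> \bar R) (u v f w eta : X -> R).
Local Notation leb := (@lebesgue_measure R).
Local Notation Xb := (g_sigma_algebraType (@open X)).

Lemma mdist_lip (y x z : X) : (`|mdist y x - mdist y z| <= mdist x z)%R.
Proof.
have h1 := metric_triangle y x z; have h2 := metric_triangle y z x.
rewrite ler_norml; apply/andP; split; last first.
  by rewrite lerBlDr (metric_sym x z) addrC.
by rewrite lerBrDr addrC lerBlDr.
Qed.

Lemma open_ball (x : X) (r : R) : open (ball x r).
Proof.
rewrite openE => y; rewrite ballEmdist/= => xy.
rewrite /interior -nbhs_ballE; exists (r - mdist x y)%R; first by rewrite /= subr_gt0.
move=> z; rewrite ballEmdist/= => yz.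
by rewrite (le_lt_trans (metric_triangle _ y _))// addrC -ltrBrDr.
Qed.

Lemma borel_ball (x : X) (r : R) : borel_set (ball x r).
Proof. by apply: sub_sigma_algebra; exact: open_ball. Qed.

Definition clamp (t : R) : R := Num.max 0%R (Num.min 1%R t).

Lemma clamp01 t : (0 <= clamp t <= 1)%R.
Proof. by rewrite /clamp le_max lexx/= ge_max ler01/= ge_min lexx. Qed.

Lemma clamp_id t : (0 <= t <= 1)%R -> clamp t = t.
Proof. by move=> /andP[h0 h1]; rewrite /clamp min_r// max_r. Qed.

Lemma clamp_contraction (a b : R) :
  (`|clamp a - clamp b| <= `|a - b|)%R.
Proof.
have h1 := ler_norm (a - b)%R; have h2 := ler_norm (b - a)%R.
rewrite distrC in h2; have h3 := normr_ge0 (a - b)%R.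
move: `|a - b|%R h1 h2 h3 => n h1 h2 h3; rewrite ler_norml /clamp.
rewrite /Num.min; do 2! (case: ifPn; rewrite -?leNgt => ?).
all: rewrite /Num.max; do ?(case: ifPn; rewrite -?leNgt => ?).
all: by apply/andP; split; lra.
Qed.

(** For K > 0 the value is 1 up to distance s - 1/K from y, 0 from distance s on, and linear in the
    distance between. *)
Definition cutoff (y : X) (s K : R) (x : X) : R :=
  clamp (K * (s - mdist y x))%R.

Lemma cutoff1 y s K x : (1 <= K * (s - mdist y x))%R -> cutoff y s K x = 1%R.
Proof. by move=> h; rewrite /cutoff /clamp min_l// max_r. Qed.

Lemma cutoff0 y s K x : (0 <= K)%R -> (s <= mdist y x)%R -> cutoff y s K x = 0%R.
Proof.
move=> K0 h; rewrite /cutoff /clamp max_l// ge_min; apply/orP; right.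
by rewrite mulr_ge0_le0// subr_le0.
Qed.

Lemma cutoff_lip y s K x z : (0 <= K)%R ->
  (`|cutoff y s K x - cutoff y s K z| <= K * mdist x z)%R.
Proof.
move=> K0; rewrite (le_trans (clamp_contraction _ _))//.
rewrite -mulrBr normrM (ger0_norm K0) ler_wpM2l//.
have -> : (s - mdist y x - (s - mdist y z) = - (mdist y x - mdist y z))%R by ring.
by rewrite normrN mdist_lip.
Qed.

Lemma cutoff_lip_loc y s K : (0 <= K)%R -> lip_loc (cutoff y s K).
Proof.
by move=> K0 x; exists 1%R, K; split=> // a b _ _; exact: cutoff_lip.
Qed.

Definition blend eta w (x : X) : R := (eta x + (1 - eta x) * w x)%R.

(** The product rule for differences: evaluating one factor at x and the other at y leaves no
    second-order remainder. *)
Lemma blend_sub eta w x y :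
  (blend eta w x - blend eta w y =
  (1 - w x) * (eta x - eta y) + (1 - eta y) * (w x - w y))%R.
Proof. by rewrite /blend; ring. Qed.

Lemma blend_lip_loc eta w : lip_loc eta -> lip_loc w ->
  (forall x, (0 <= eta x <= 1)%R) -> (forall x, (0 <= w x <= 1)%R) ->
  lip_loc (blend eta w).
Proof.
move=> Le Lw e01 w01; apply: lip_loc_le2 Le Lw _ => x y.
rewrite blend_sub (le_trans (ler_normD _ _))// !normrM.
have := w01 x; have := e01 y => /andP[? ?] /andP[? ?].
by apply: lerD; rewrite ler_piMl// ger0_norm; lra.
Qed.

(** The slope of eta enters multiplied by 1 - w. Because of the gap rho < s, every point has a
    neighbourhood that either lies in the ball of radius s, where the indicator is 1, or on which
    eta vanishes; so the jump of the indicator does no harm. *)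
Lemma upper_gradient_blend (y0 : X) (rho s K e : R) eta w g :
  (0 <= K)%R -> (rho < s)%R -> (0 < e)%R ->
  (forall x z, (`|eta x - eta z| <= K * mdist x z)%R) ->
  (forall x, (0 <= eta x <= 1)%R) ->
  (forall x, (rho <= mdist y0 x)%R -> eta x = 0%R) ->
  continuous w -> (forall x, (0 <= w x <= 1)%R) ->
  upper_gradient g (EFin \o w) ->
  upper_gradient (fun x => (1 - eta x + e)%:E * g x +
     (K * (1 - w x + e))%:E * (\1_(ball y0 s) x)%:E)
    (EFin \o blend eta w).
Proof.
move=> K0 rs e0 Leta e01 eta0 cw w01 [mg g0 Hg].
have leta : lip_loc eta.
  by move=> x; exists 1%R, K; split=> // a b _ _; exact: Leta.
have ceta := lip_loc_continuous leta.
have c1 : continuous (fun x => 1 - eta x + e)%R.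
  move=> x; apply: cvgD; last exact: cvg_cst.
  by apply: cvgB; [exact: cvg_cst|exact: ceta].
have c2 : continuous (fun x => K * (1 - w x + e))%R.
  move=> x; apply: cvgM; first exact: cvg_cst.
  apply: cvgD; last exact: cvg_cst.
  by apply: cvgB; [exact: cvg_cst|exact: cw].
pose j x := (\1_(ball y0 s) x)%:E : \bar R.
have mj : borel_fun j.
  apply/measurable_EFinP; apply: (@measurable_indic _ Xb).
  exact: borel_ball.
have j0 x : 0 <= j x by rewrite lee_fin.
have m1 := borel_funM c1 mg; have m2 := borel_funM c2 mj.
have p1 x : 0 <= (1 - eta x + e)%:E * g x.
  by rewrite mule_ge0// lee_fin; have := e01 x; lra.
have p2 x : 0 <= (K * (1 - w x + e))%:E * j x.
  by rewrite mule_ge0// lee_fin mulr_ge0//; have := w01 x; lra.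
apply: upper_gradient_local.
- exact: emeasurable_funD.
- by move=> x; apply: adde_ge0; [exact: p1|exact: p2].
move=> x.
have e20 : (0 < e / 2)%R by rewrite divr_gt0.
have /cvgrPdist_lt/(_ _ e20) := ceta x; rewrite -nbhs_ballE => -[r1 /= r10 Hr1].
have /cvgrPdist_lt/(_ _ e20) := cw x; rewrite -nbhs_ballE => -[r2 /= r20 Hr2].
pose r3 : R := if (mdist y0 x < s)%R then (s - mdist y0 x)%R else (s - rho)%R.
have r30 : (0 < r3)%R by rewrite /r3; case: ifPn => ?; rewrite subr_gt0.
exists (Num.min r1 (Num.min r2 r3)); first by rewrite !lt_min r10 r20.
move=> L gamma cg Hin; have [L0 _ _] := cg.
have H1 t : (0 <= t <= L)%R -> (`|eta x - eta (gamma t)| < e / 2)%R.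
  move=> /Hin h; apply: Hr1; move: h; apply: le_ball; by rewrite ge_min lexx.
have H2 t : (0 <= t <= L)%R -> (`|w x - w (gamma t)| < e / 2)%R.
  move=> /Hin h; apply: Hr2; move: h; apply: le_ball.
  by rewrite !ge_min lexx orbT.
have H3 t : (0 <= t <= L)%R -> (mdist x (gamma t) < r3)%R.
  move=> /Hin h; suff : ball x r3 (gamma t) by rewrite ballEmdist.
  by move: h; apply: le_ball; rewrite !ge_min lexx !orbT.
have t0 : (0 <= (0 : R) <= L)%R by rewrite lexx.
have tL : (0 <= L <= L)%R by rewrite lexx andbT.
rewrite blend_sub.
rewrite ge0_integralD//; last 2 first.
- exact: (measurable_curve cg m1).
- exact: (measurable_curve cg m2).
rewrite addeC.
have /andP[w1 w2] := w01 (gamma 0%R); have /andP[h1 h2] := e01 (gamma L).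
apply: (@le_trans _ _ (((1 - w (gamma 0%R)) * `|eta (gamma 0%R) - eta (gamma L)|)%:E
  + (1 - eta (gamma L))%:E * `|(w (gamma 0%R) - w (gamma L))%:E|)).
  rewrite /= -!EFinM -EFinD lee_fin (le_trans (ler_normD _ _))// !normrM.
  by rewrite !(@ger0_norm _ (1 - _)%R)//; lra.
apply: leeD; last first.
  apply: (@le_trans _ _ ((1 - eta (gamma L))%:E *
     \int[leb]_(t in `[0%R, L]) g (gamma t))).
    by apply: lee_wpmul2l; [rewrite lee_fin; lra|exact: Hg].
  apply: (le_integral_curve (f := fun x => 1 - eta x + e)%R) => //; first lra.
  move=> t ht; have := H1 _ ht; have := H1 _ tL.
  by rewrite !ltr_norml => /andP[? ?] /andP[? ?]; lra.
have Ie : (`|eta (gamma 0%R) - eta (gamma L)| <= K * L)%R.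
  rewrite (le_trans (Leta _ _))// ler_wpM2l//.
  by rewrite (le_trans (curve_dist cg _ _ _))// subr0.
have [xs|xs] := ltP (mdist y0 x) s.
  have r3E : r3 = (s - mdist y0 x)%R by rewrite /r3 xs.
  have jg t : (0 <= t <= L)%R -> j (gamma t) = 1.
    move=> ht; rewrite /j indicE mem_set// ballEmdist/=.
    have := H3 _ ht; rewrite r3E => h.
    by rewrite (le_lt_trans (metric_triangle _ x _))// addrC -ltrBrDr.
  have -> : \int[leb]_(t in `[0%R, L]) ((K * (1 - w (gamma t) + e))%:E * j (gamma t))
    = \int[leb]_(t in `[0%R, L]) ((K * (1 - w (gamma t) + e))%:E * cst 1 (gamma t)).
    by apply: eq_integral => t; rewrite inE/= in_itv/= => /jg ->.
  have H : (K * (1 - w (gamma 0)))%:E * \int[leb]_(t in `[0%R, L]) cst 1 (gamma t) <=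
     \int[leb]_(t in `[0%R, L]) ((K * (1 - w (gamma t) + e))%:E * cst 1 (gamma t)).
    apply: (le_integral_curve (f := fun x => K * (1 - w x + e))%R) => //.
    - exact: measurable_cst.
    - by rewrite mulr_ge0//; lra.
    - move=> t ht; apply: ler_wpM2l => //; have := H2 _ ht; have := H2 _ t0.
      by rewrite !ltr_norml => /andP[? ?] /andP[? ?]; lra.
  apply: le_trans H; rewrite integral_cst//= lebesgue_measure_itv/= lte_fin.
  rewrite mul1e; case: ltP => L0'.
    rewrite -EFinB -EFinM lee_fin subr0.
    rewrite [leRHS](_ : _ = (1 - w (gamma 0)) * (K * L))%R; last by ring.
    by rewrite ler_wpM2l//; lra.
  have -> : L = 0%R by apply/eqP; rewrite eq_le L0 L0'.
  by rewrite subrr normr0 mulr0 mule0.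
have r3E : r3 = (s - rho)%R by rewrite /r3 ltNge xs.
have eg t : (0 <= t <= L)%R -> eta (gamma t) = 0%R.
  move=> /H3; rewrite r3E => h; apply: eta0.
  have := metric_triangle y0 (gamma t) x; rewrite (metric_sym (gamma t)); lra.
rewrite (eg _ t0) (eg _ tL) subrr normr0 mulr0; apply: integral_ge0 => t _.
exact: p2.
Qed.

End Leibniz.

(** * Doubling measures *)

Section Doubling.
Context (R : realType) (X : completeMetricType R).
Context (mu : {outer_measure set X -> \bar R}).
Hypothesis mu_borel : forall A : set X, borel_set A -> mu.-cara.-measurable A.
Local Notation m := (cara_measure mu).
Local Notation Xm := (caratheodory_type mu).

Lemma measurable_ball_cara (x : X) (r : R) : mu.-cara.-measurable (ball x r).
Proof. by apply: mu_borel; exact: borel_ball. Qed.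

Lemma borel_fun_cara (g : X -> \bar R) : borel_fun g ->
  measurable_fun [set: Xm] (g : Xm -> \bar R).
Proof.
move=> mg _ Y mY; rewrite setTI; apply: mu_borel.
by have := mg measurableT _ mY; rewrite setTI.
Qed.

Lemma continuous_cara (f : X -> R) : continuous f ->
  measurable_fun [set: Xm] (f : Xm -> R).
Proof.
move=> cf _ Y mY; rewrite setTI; apply: mu_borel.
by have := continuous_borel cf measurableT mY; rewrite setTI.
Qed.

Lemma sum_indic_size (s : seq X) (B : X -> set X) (x : X) :
  (\sum_(z <- s) \1_(B z) x = (size [seq z <- s | x \in B z])%:R :> R)%R.
Proof.
elim: s => [|z s IH]; first by rewrite big_nil.
rewrite big_cons IH /= indicE; case: ifPn => _ /=; last by rewrite add0r.
by rewrite -[RHS]natr1 addrC.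
Qed.

Lemma sum_integral_overlap (N : R) (s : seq X) (B : X -> set X) (W : set X)
    (g : X -> \bar R) :
  (forall z, mu.-cara.-measurable (B z)) -> mu.-cara.-measurable W ->
  measurable_fun [set: Xm] (g : Xm -> \bar R) -> (forall x, 0 <= g x) ->
  (0 <= N)%R -> (forall x, (\sum_(z <- s) \1_(B z) x <= N * \1_W x)%R) ->
  \sum_(z <- s) \int[m]_(x in B z) g x <= N%:E * \int[m]_(x in W) g x.
Proof.
move=> mB mW mg g0 N0 H.
have E (A : set X) : mu.-cara.-measurable A ->
    \int[m]_(x in A) g x = \int[m]_x (g x * (\1_A x)%:E).
  move=> mA; rewrite integral_mkcond; apply: eq_integral => x _.
  by rewrite /patch indicE; case: ifPn => _; rewrite ?mule1 ?mule0.
have mI (A : set X) : mu.-cara.-measurable A ->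
    measurable_fun [set: Xm] ((fun x : X => (\1_A x)%:E) : Xm -> \bar R).
  by move=> mA; apply/measurable_EFinP; exact: (@measurable_indic _ Xm).
rewrite (E W)// -ge0_integralZl//; last 2 first.
- by apply: emeasurable_funM => //; exact: mI.
- by move=> x _; rewrite mule_ge0// lee_fin.
under eq_bigr do rewrite E//.
rewrite -ge0_integral_sum//; last 2 first.
- by move=> z; apply: emeasurable_funM => //; exact: mI.
- by move=> z x _; rewrite mule_ge0// lee_fin.
apply: ge0_le_integral => //.
- by move=> x _; apply: sume_ge0 => z _; rewrite mule_ge0// lee_fin.
- apply: emeasurable_sum => z; apply: emeasurable_funM => //; exact: mI.
- by apply: measurable_funeM; apply: emeasurable_funM => //; exact: mI.
- move=> x _; rewrite -ge0_sume_distrr; last by move=> z _; rewrite lee_fin.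
  rewrite muleCA; apply: lee_wpmul2l => //.
  by rewrite sumEFin -EFinM lee_fin.
Qed.

Variable Cd : R.
Hypothesis Cd1 : (1 <= Cd)%R.
Hypothesis mu_dbl : forall (x : X) (r : R), (0 < r)%R ->
  [/\ 0 < mu (ball x (2 * r)%R),
      mu (ball x (2 * r)%R) <= Cd%:E * mu (ball x r) &
      mu (ball x r) < +oo].

Lemma mu_ball_gt0 (x : X) (r : R) : (0 < r)%R -> 0 < mu (ball x r).
Proof.
move=> r0; have r20 : (0 < r / 2)%R by rewrite divr_gt0.
by have [+ _ _] := mu_dbl x r20; rewrite mulrC divfK.
Qed.

Lemma mu_ball_lty (x : X) (r : R) : mu (ball x r) < +oo.
Proof.
have [r0|r0] := ltP 0%R r; first by have [_ _] := mu_dbl x r0.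
rewrite (_ : ball x r = set0) ?outer_measure0//.
apply/seteqP; split => // y; rewrite ballEmdist/= => h.
have := mdist_ge0 x y; lra.
Qed.

Lemma mu_ball_fin (x : X) (r : R) : mu (ball x r) \is a fin_num.
Proof. by rewrite ge0_fin_numE ?outer_measure_ge0// mu_ball_lty. Qed.

Lemma doubling_iter k (x : X) (r : R) : (0 < r)%R ->
  mu (ball x (2 ^+ k * r)%R) <= (Cd ^+ k)%:E * mu (ball x r).
Proof.
move=> r0; elim: k => [|k IH]; first by rewrite !expr0 mul1r mul1e.
rewrite !exprS -mulrA.
have kr0 : (0 < 2 ^+ k * r)%R by rewrite mulr_gt0// exprn_gt0.
have [_ h _] := mu_dbl x kr0; apply: le_trans h _.
by rewrite EFinM -muleA lee_wpmul2l// lee_fin (le_trans _ Cd1).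
Qed.

Lemma ball_subset_ball (x y : X) (r s : R) : (mdist x y + r <= s)%R ->
  ball y r `<=` ball x s.
Proof.
move=> h z; rewrite !ballEmdist/= => yz.
by rewrite (le_lt_trans (metric_triangle _ y _))// (lt_le_trans _ h)// ltrD2l.
Qed.

(** Packing by volume: the balls of radius d = r / 2^(k+1) about the points are disjoint and lie in
    the ball of radius 2r about x. That ball lies in each ball of radius 4r = 2^(k+3) d about a
    point, so each small ball has at least the fraction 1 / Cd^(k+3) of its measure. *)
Lemma separated_size k (x : X) (r : R) (s : seq X) : (0 < r)%R -> uniq s ->
  (forall z, z \in s -> ball x r z) ->
  (forall z z', z \in s -> z' \in s -> z != z' -> (r <= 2 ^+ k * mdist z z')%R) ->
  ((size s)%:R <= Cd ^+ (k + 3))%R.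
Proof.
move=> r0 us sx sep.
pose d := (r / 2 ^+ k.+1)%R.
have k0 : (0 < 2 ^+ k.+1 :> R)%R by rewrite exprn_gt0.
have d0 : (0 < d)%R by rewrite divr_gt0.
have dr : (d <= r / 2)%R.
  rewrite /d ler_pM2l// lef_pV2 ?posrE// exprS ler_peMr// exprn_ege1//; lra.
have big z : z \in s -> mu (ball x (2 * r)) <= (Cd ^+ (k + 3))%:E * mu (ball z d).
  move=> zs; apply: le_trans (doubling_iter (k + 3) z d0).
  apply: le_outer_measure.
  have -> : (2 ^+ (k + 3) * d = 4 * r)%R.
    rewrite /d (_ : k + 3 = k.+1 + 2)%N; last by rewrite addSnnS.
    by rewrite exprD mulrC -mulrA [(_^-1 * _)%R]mulrA mulVf ?lt0r_neq0//; lra.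
  apply: ball_subset_ball; have := sx _ zs; rewrite ballEmdist/= metric_sym; lra.
have := @sum_integral_overlap 1 s (fun z => ball z d) (ball x (2 * r))%R (cst 1)
  (fun z => measurable_ball_cara z d) (measurable_ball_cara _ _)
  (@measurable_cst _ _ _ _ _ _) (fun _ => lee01) ler01.
rewrite mul1e integral_cst; last exact: measurable_ball_cara.
rewrite mul1e (eq_bigr (fun z => mu (ball z d))); last first.
  by move=> z _; rewrite integral_cst ?mul1e//; exact: measurable_ball_cara.
have H y : (\sum_(z <- s) \1_(ball z d) y <= 1 * \1_(ball x (2 * r)) y :> R)%R.
  rewrite mul1r sum_indic_size.
  set f := [seq _ <- _ | _].
  have fP z : z \in f -> z \in s /\ ball z d y.
    by rewrite mem_filter => /andP[/set_mem].
  have uf : uniq f by exact: filter_uniq.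
  case: f fP uf => [_ _|z f fP uf]; first by rewrite indicE.
  have [zs zy] := fP z (mem_head _ _).
  rewrite indicE mem_set/=; last first.
    have : ball z d `<=` ball x (2 * r)%R; last exact.
    apply: ball_subset_ball; have := sx _ zs; rewrite ballEmdist/=; lra.
  case: f fP uf => // z' f fP /= /andP[+ _].
  rewrite inE negb_or => /andP[zz' _].
  have z'in : z' \in [:: z, z' & f] by rewrite !inE eqxx orbT.
  have [z's z'y] := fP _ z'in.
  have := sep _ _ zs z's zz'; move: zy z'y; rewrite !ballEmdist/= => h1 h2 h3.
  have : (mdist z z' < d + d)%R.
    by rewrite (le_lt_trans (metric_triangle _ y _))// (metric_sym y) ltrD.
  have -> : (d + d = r / 2 ^+ k)%R.
    by rewrite /d exprS invfM; field; rewrite lt0r_neq0// exprn_gt0.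
  by rewrite ltr_pdivlMr ?exprn_gt0// mulrC ltNge h3.
move=> /(_ H) h.
have [->|s0] := eqVneq s [::].
  by rewrite /= exprn_ge0// (le_trans _ Cd1).
have Wfin := mu_ball_fin x (2 * r)%R.
have Wgt0 : (0 < fine (mu (ball x (2 * r))))%R.
  by rewrite fine_gt0// mu_ball_gt0 ?mu_ball_lty// mulr_gt0.
have C0 : (0 <= Cd ^+ (k + 3))%R by rewrite exprn_ge0// (le_trans _ Cd1).
rewrite -(ler_pM2r Wgt0) -lee_fin !EFinM fineK//.
apply: (@le_trans _ _ (\sum_(z <- s) (Cd ^+ (k + 3))%:E * mu (ball z d))).
  rewrite -[X in X%:E * _](@mulr_natl R 1%R) mulr1.
  rewrite -sum1_size natr_sum -sumEFin ge0_sume_distrl; last by move=> *; rewrite lee_fin.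
  rewrite big_seq [leRHS]big_seq; apply: lee_sum => z zs.
  by rewrite mul1e big.
rewrite -ge0_sume_distrr; last by move=> *; exact: outer_measure_ge0.
apply: lee_wpmul2l; first by rewrite lee_fin.
exact: h.
Qed.

(** The packing bound limits the size of t-separated families in S; one of maximal size is a net. *)
Lemma finite_net (S : set X) (x : X) (r t : R) : (0 < r)%R -> (0 < t)%R ->
  S `<=` ball x r -> exists s : seq X,
  [/\ uniq s, (forall z, z \in s -> S z),
    (forall z z', z \in s -> z' \in s -> z != z' -> (t <= mdist z z')%R) &
    S `<=` [set y | exists2 z, z \in s & ball z t y]].
Proof.
move=> r0 t0 Sx.
have [k hk] : exists k, (r <= 2 ^+ k * t)%R.
  exists (Num.bound (r / t)); rewrite -ler_pdivrMr//.
  rewrite (le_trans (ltW (archi_boundP _)))//; first by rewrite divr_ge0// ltW.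
  by rewrite -natrX ler_nat ltnW// ltn_expl.
pose P := fun s : seq X => [/\ uniq s, (forall z, z \in s -> S z) &
  (forall z z', z \in s -> z' \in s -> z != z' -> (t <= mdist z z')%R)].
pose Q := fun n => `[< exists2 s, size s = n & P s >].
have Q0 : exists n, Q n by exists 0%N; apply/asboolP; exists [::].
have Qb n : Q n -> (n <= Num.bound (Cd ^+ (k + 3)))%N.
  move=> /asboolP[s <- [us sS sep]].
  have h := separated_size r0 us (fun z zs => Sx _ (sS _ zs)) (k := k).
  rewrite -(ler_nat R) (le_trans (h _))//.
    move=> z z' zs z's zz'; rewrite (le_trans hk)// ler_wpM2l ?exprn_ge0//.
    exact: sep.
  rewrite ltW// archi_boundP// exprn_ge0// (le_trans _ Cd1)//.
have [n /asboolP[s sn [us sS sep]] nmax] := ex_maxnP Q0 Qb.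
exists s; split => // y Sy; apply: contrapT => hy.
have ysep z : z \in s -> (t <= mdist z y)%R.
  by move=> zs; rewrite leNgt; apply/negP => h; apply: hy; exists z => //; rewrite ballEmdist.
have ys : y \notin s.
  by apply/negP => /ysep; rewrite mdistxx leNgt t0.
suff : Q n.+1 by move=> /nmax; rewrite ltnn.
apply/asboolP; exists (y :: s); first by rewrite /= sn.
split => /=.
- by rewrite ys.
- by move=> z; rewrite inE => /orP[/eqP->//|/sS].
- move=> z z'; rewrite !inE => /orP[/eqP->|zs] /orP[/eqP->|z's].
  + by rewrite eqxx.
  + by move=> _; rewrite metric_sym ysep.
  + by move=> _; rewrite ysep.
  + exact: sep.
Qed.

(** Total boundedness and completeness replace compactness: a ball without a finite cover has, in a
    net, a centre of a ball of half the radius without one. The centres obtained by repetition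
    converge to some l, and the ball of radius [rho l] about l contains a late ball of the
    sequence. *)
Lemma finite_cover (rho : X -> R) : (forall x, (0 < rho x)%R) ->
  forall (x : X) (r : R), exists s : seq X,
    ball x r `<=` \big[setU/set0]_(z <- s) ball z (rho z).
Proof.
move=> rho0.
pose P (A : set X) := exists s : seq X,
  A `<=` \big[setU/set0]_(z <- s) ball z (rho z).
have Pbig (s : seq X) (B : X -> set X) (A : set X) :
    (forall z, z \in s -> P (B z)) ->
    A `<=` [set y | exists2 z, z \in s & B z y] -> P A.
  elim: s A => [|z s IH] A HP HA.
    by exists [::] => y /HA[].
  have [s1 h1] := HP z (mem_head _ _).
  have [||s2 h2] := IH (A `\` B z).
  - by move=> z' z's; apply: HP; rewrite inE z's orbT.
  - move=> y [/HA[z'] + z'y nzy]; rewrite inE => /orP[/eqP zz'|z's].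
      by exfalso; apply: nzy; rewrite -zz'.
    by exists z'.
  exists (s1 ++ s2); rewrite big_cat => y Ay.
  by have [zy|nzy] := pselect (B z y); [left; exact: h1|right; apply: h2].
move=> x r; apply: contrapT => nP.
have r0 : (0 < r)%R.
  rewrite ltNge; apply/negP => r0; apply: nP; exists [::] => y.
  by rewrite ballEmdist/= => h; have := mdist_ge0 x y; lra.
(* Uncovered balls are packed with their proofs, so that dependent choice becomes iteration of one
   function. *)
pose T := {p : X * R | (0 < p.2)%R /\ ~ P (ball p.1 p.2)}.
pose Rel (p q : T) := ball (sval p).1 (sval p).2 (sval q).1 /\
  (sval q).2 = ((sval p).2 / 2)%R.
have step p : exists q, Rel p q.
  case: p => -[y t] /= [t0 nPt].
  have t20 : (0 < t / 2)%R by rewrite divr_gt0.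
  have [s [us sS _ cov]] := finite_net t0 t20 (@subset_refl _ (ball y t)).
  apply: contrapT => H; refine (nPt _); apply: Pbig cov => z zs.
  apply: contrapT => nz; apply: H.
  have e : (0 < (z, t / 2).2)%R /\ ~ P (ball (z, t / 2).1 (z, t / 2).2)%R by [].
  by exists (exist _ (z, t / 2)%R e); split => //=; exact: sS.
have [f fP] := choice step.
pose p0 : T := exist _ (x, r) (conj r0 nP).
pose z n := (sval (iter n f p0)).1; pose t n := (sval (iter n f p0)).2.
have tE n : t n = (r / 2 ^+ n)%R.
  elim: n => [|n IH]; first by rewrite expr0 divr1.
  have [_] := fP (iter n f p0); rewrite -/(t n) /t /= => ->.
  by rewrite -/(t n) IH exprS invfM; ring.
have zS n : ball (z n) (t n) (z n.+1) by have [] := fP (iter n f p0).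
have nPz n : ~ P (ball (z n) (t n)) by have [] := svalP (iter n f p0).
have t0 n : (0 < t n)%R by rewrite tE divr_gt0// exprn_gt0.
have zd n k : (mdist (z n) (z (n + k)%N) <= 2 * t n - 2 * t (n + k)%N)%R.
  elim: k => [|k IH]; first by rewrite addn0 mdistxx subrr.
  rewrite addnS (le_trans (metric_triangle _ (z (n + k)%N) _))//.
  have := zS (n + k)%N; rewrite ballEmdist/=.
  have -> : (t (n + k).+1 = t (n + k)%N / 2)%R.
    by rewrite !tE exprS invfM; ring.
  lra.
have t_cvg e : (0 < e)%R -> exists n, (2 * t n < e)%R.
  move=> e0; exists (Num.bound (e^-1 * (2 * r)))%R.
  rewrite tE mulrA ltr_pdivrMr ?exprn_gt0// -ltr_pdivrMl//.
  apply: (lt_le_trans (archi_boundP _)).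
    by rewrite mulr_ge0 ?invr_ge0 ?mulr_ge0// ltW.
  by rewrite -natrX ler_nat ltnW// ltn_expl.
have cz : cvg (z n @[n --> \oo]).
  apply/cauchy_cvgP/cauchy_ballP => e e0.
  have e20 : (0 < e / 2)%R by rewrite divr_gt0.
  have [N hN] := t_cvg _ e20.
  have zN k : (N <= k)%N -> ball (z N) (e / 2) (z k).
    move=> Nk; rewrite ballEmdist/= -(subnKC Nk).
    by rewrite (le_lt_trans (zd _ _))//; have := t0 (N + (k - N))%N; lra.
  exists (ball (z N) (e / 2)%R, ball (z N) (e / 2)%R) => /=.
    by split; exists N => // k /= /zN.
  by move=> [a b] /= [Na Nb]; apply: (@ball_splitr _ _ (z N)).
have /cvg_ex[l zl] := cz.
have rl0 : (0 < rho l / 2)%R by rewrite divr_gt0.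
have [N hN] := t_cvg _ rl0.
have [k [Nk hk]] : exists k, (N <= k)%N /\ (mdist l (z k) < rho l / 2)%R.
  have /metricType_numDomainType.cvgrPdist_lt/(_ _ rl0) [K _ HK] := zl.
  by exists (maxn N K); rewrite leq_maxl; split => //; apply: HK; exact: leq_maxr.
apply: (nPz k); exists [:: l]; rewrite big_seq1.
apply: ball_subset_ball.
have := zd N (k - N)%N; rewrite subnKC// => h.
have := mdist_ge0 (z N) (z k); lra.
Qed.

End Doubling.

(** * Total variation *)

Section Approximation.
Context (R : realType) (X : completeMetricType R).
Context (mu : {outer_measure set X -> \bar R}).
Hypothesis mu_borel : forall A : set X, borel_set A -> mu.-cara.-measurable A.
Variable Cd : R.
Hypothesis Cd1 : (1 <= Cd)%R.
Hypothesis mu_dbl : forall (x : X) (r : R), (0 < r)%R ->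
  [/\ 0 < mu (ball x (2 * r)%R),
      mu (ball x (2 * r)%R) <= Cd%:E * mu (ball x r) &
      mu (ball x r) < +oo].
Local Notation m := (cara_measure mu).
Local Notation Xm := (caratheodory_type mu).
Local Notation measurable_on u := (measurable_fun [set: Xm] (u : Xm -> R)).
Implicit Types (u v w f : X -> R) (g h : X -> \bar R).

Lemma ge0_integral_setU_le (A B : set X) (f : X -> \bar R) :
  mu.-cara.-measurable A -> mu.-cara.-measurable B ->
  measurable_fun [set: Xm] (f : Xm -> \bar R) -> (forall x, 0 <= f x) ->
  \int[m]_(x in A `|` B) f x <= \int[m]_(x in A) f x + \int[m]_(x in B) f x.
Proof.
move=> mA mB mf f0.
have mBA : mu.-cara.-measurable (B `\` A) by exact: measurableD.
have -> : A `|` B = A `|` (B `\` A).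
  apply/seteqP; split => x; last by move=> [|[]]; [left|right].
  by have [Ax|nAx] := pselect (A x); [left|move=> [|]//; right].
rewrite ge0_integral_setU//; last 2 first.
- exact: measurable_funTS.
- by apply/disj_set2P/seteqP; split => // x [? []].
apply: leeD => //; apply: ge0_subset_integral => //; exact: measurable_funTS.
Qed.

(** A finite cover by balls on which convergence holds carries it over to an arbitrary ball. *)
Lemma cvg_integral_ball (f : nat -> X -> \bar R) :
  (forall i, measurable_fun [set: Xm] (f i : Xm -> \bar R)) ->
  (forall i x, 0 <= f i x) ->
  (forall x, exists2 r : R, (0 < r)%R &
     \int[m]_(y in ball x r) f i y @[i --> \oo] --> 0) ->
  forall x r, \int[m]_(y in ball x r) f i y @[i --> \oo] --> 0.
Proof.
move=> mf f0 H x r.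
have {}H y : exists r0 : R, (0 < r0)%R /\
    \int[m]_(z in ball y r0) f i z @[i --> \oo] --> 0.
  by have [r0 ? ?] := H y; exists r0.
have [rho rhoP] := choice H.
have mB z t := @measurable_ball_cara _ _ mu mu_borel z t.
have [s hs] := finite_cover mu_borel Cd1 mu_dbl (fun y => (rhoP y).1) x r.
pose U := \big[setU/set0]_(z <- s) ball z (rho z).
have [mU cU] : mu.-cara.-measurable U /\
    \int[m]_(y in U) f i y @[i --> \oo] --> 0.
  rewrite /U; elim: {U hs} s => [|z s [mU cU]].
    rewrite big_nil; split => //; under eq_fun do rewrite integral_set0.
    exact: cvg_cst.
  rewrite big_cons; set U := \big[_/_]_(_ <- _) _ in mU cU *.
  split; first exact: measurableU.
  apply: (@squeeze_cvge _ _ _ _ (cst 0) _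
    (fun i => \int[m]_(y in ball z (rho z)) f i y + \int[m]_(y in U) f i y)).
  - apply: nearW => i; rewrite integral_ge0//=.
    exact: ge0_integral_setU_le.
  - exact: cvg_cst.
  - rewrite -[X in _ --> X](adde0 (0 : \bar R)).
    by apply: cvgeD => //; exact: (rhoP z).2.
apply: (@squeeze_cvge _ _ _ _ (cst 0) _ (fun i => \int[m]_(y in U) f i y)) => //.
- apply: nearW => i; rewrite integral_ge0//=.
  apply: ge0_subset_integral => //; exact: measurable_funTS.
- exact: cvg_cst.
Qed.

Definition L1dist (r : R) u v : \bar R :=
  \int[m]_(x in ball (point : X) r) (`|u x - v x|)%:E.

Let mB (x : X) (r : R) : mu.-cara.-measurable (ball x r).
Proof. exact: measurable_ball_cara. Qed.

Let measurable_dist u v (A : set X) : measurable_on u -> measurable_on v ->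
  measurable_fun (A : set Xm) ((fun x => (`|u x - v x|)%:E) : Xm -> \bar R).
Proof.
move=> mu_ mv; apply: measurable_funTS; apply/measurable_EFinP.
by apply: measurableT_comp => //; exact: measurable_funB.
Qed.

Let mu_lty (x : X) (r : R) : mu (ball x r) < +oo.
Proof. exact: (mu_ball_lty mu_dbl). Qed.

Lemma L1dist_ge0 r u v : 0 <= L1dist r u v.
Proof. by apply: integral_ge0 => x _; rewrite lee_fin. Qed.

Lemma L1dist_mono r s u v : measurable_on u -> measurable_on v -> (r <= s)%R ->
  L1dist r u v <= L1dist s u v.
Proof.
move=> mu_ mv rs; apply: ge0_subset_integral => //; first exact: measurable_dist.
exact: le_ball.
Qed.

Lemma L1dist_le (r c : R) f f' u u' v v' : (0 <= c)%R ->
  measurable_on f -> measurable_on f' ->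
  measurable_on u -> measurable_on u' -> measurable_on v -> measurable_on v' ->
  (forall x, (`|f x - f' x| <= `|u x - u' x| + `|v x - v' x| + c)%R) ->
  L1dist r f f' <= L1dist r u u' + L1dist r v v' + c%:E * mu (ball (point : X) r).
Proof.
move=> c0 mf mf' mu_ mu' mv mv' H.
rewrite -(@integral_cst _ _ _ m _ (mB point r)).
rewrite -ge0_integralD//; [|exact: measurable_dist..].
rewrite -ge0_integralD//; last 2 first.
- by move=> x _; rewrite adde_ge0.
- by apply: emeasurable_funD; exact: measurable_dist.
apply: ge0_le_integral => //; first exact: measurable_dist.
- apply: emeasurable_funD => //; apply: emeasurable_funD; exact: measurable_dist.
- by move=> x _; rewrite -!EFinD lee_fin.
Qed.

Lemma L1dist_contraction r f f' u u' :
  measurable_on f -> measurable_on f' -> measurable_on u -> measurable_on u' ->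
  (forall x, (`|f x - f' x| <= `|u x - u' x|)%R) ->
  L1dist r f f' <= L1dist r u u'.
Proof.
move=> mf mf' mu_ mu' H.
apply: ge0_le_integral => //; try exact: measurable_dist.
by move=> x _; rewrite lee_fin.
Qed.

Lemma L1dist_triangle r u v w : measurable_on u -> measurable_on v ->
  measurable_on w -> L1dist r u w <= L1dist r u v + L1dist r v w.
Proof.
move=> mu_ mv mw.
rewrite -ge0_integralD//; [|exact: measurable_dist..].
apply: ge0_le_integral => //; first exact: measurable_dist.
- apply: emeasurable_funD; exact: measurable_dist.
- by move=> x _; rewrite -EFinD lee_fin (le_trans _ (ler_normD _ _))// addrA subrK.
Qed.

Definition unit_valued u : Prop := forall x, (0 <= u x <= 1)%R.

Lemma L1dist_cvg (u_ : nat -> X -> R) u r :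
  (forall k, measurable_on (u_ k)) -> measurable_on u ->
  (forall k, unit_valued (u_ k)) ->
  (forall x, u_ k x @[k --> \oo] --> u x) ->
  L1dist r (u_ k) u @[k --> \oo] --> 0.
Proof.
move=> mu_ mu1 u01 cu.
have := @dominated_convergence _ Xm R m (ball point r) (mB point r)
  (fun k x => (u_ k x)%:E) (EFin \o u) (cst 1).
case => //.
- by move=> k; apply: measurable_funTS; exact/measurable_EFinP.
- by apply: measurable_funTS; exact/measurable_EFinP.
- by apply: aeW => x _; apply: cvg_EFin; [exact: nearW|exact: cu].
- apply/integrableP; split => //.
  rewrite (eq_integral (cst 1)); last by move=> x _; rewrite /= normr1.
  by rewrite integral_cst//= mul1e mu_lty.
- apply: aeW => x k _ /=; rewrite lee_fin; have := u01 k x => /andP[h1 h2].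
  by rewrite ger0_norm.
Qed.

(* [approximable u c] says that the total variation of [u] is at most [c]. *)
Definition approximable u (c : R) : Prop := forall e : R, (0 < e)%R ->
  exists w g, [/\ lip_loc w, upper_gradient g (EFin \o w),
    L1dist e^-1 w u <= e%:E & \int[m]_x g x <= (c + e)%:E].

Lemma lip_loc_measurable w : lip_loc w -> measurable_on w.
Proof. by move=> /lip_loc_continuous/(continuous_cara mu_borel). Qed.

Lemma upper_gradient_measurable g (u : X -> \bar R) : upper_gradient g u ->
  measurable_fun [set: Xm] (g : Xm -> \bar R).
Proof. by move=> [mg _ _]; exact: borel_fun_cara. Qed.

(** Truncation to [0, 1] fixes u and is a contraction, so it increases neither the distance to u nor
    the upper gradient. *)
Lemma approximable_unit u c : approximable u c -> unit_valued u ->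
  measurable_on u -> forall e : R, (0 < e)%R ->
  exists w g, [/\ lip_loc w, unit_valued w, upper_gradient g (EFin \o w),
    L1dist e^-1 w u <= e%:E & \int[m]_x g x <= (c + e)%:E].
Proof.
move=> uc u01 mu1 e e0; have [w [g [Lw Ug Dw Ig]]] := uc e e0.
have Lcw : lip_loc (@clamp R \o w).
  apply: (lip_loc_scale ler01 Lw) => x y.
  by rewrite mul1r; exact: clamp_contraction.
exists (@clamp R \o w), g; split => //.
- by move=> x; exact: clamp01.
- by apply: upper_gradient_contraction Ug => x y; exact: clamp_contraction.
- apply: le_trans Dw; apply: L1dist_contraction => //; try exact: lip_loc_measurable.
  by move=> x; rewrite -[in leLHS](clamp_id (u01 x)); exact: clamp_contraction.
Qed.

Lemma approximable_ge0 u c : approximable u c -> (0 <= c)%R.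
Proof.
move=> uc; apply/ler_addgt0Pr => e e0; have [w [g [_ [_ g0 _] _ Ig]]] := uc e e0.
by rewrite -lee_fin (le_trans _ Ig)//; apply: integral_ge0 => x _.
Qed.

Lemma approximable_closed u c : measurable_on u ->
  (forall e : R, (0 < e)%R -> approximable u (c + e)) -> approximable u c.
Proof.
move=> mu1 H e e0; have e20 : (0 < e / 2)%R by rewrite divr_gt0.
have [w [g [Lw Ug Dw Ig]]] := H _ e20 _ e20.
exists w, g; split => //.
- apply: (@le_trans _ _ (e / 2)%:E); last by rewrite lee_fin; lra.
  apply: le_trans Dw; apply: L1dist_mono => //; first exact: lip_loc_measurable.
  by rewrite lef_pV2 ?posrE//; lra.
- by rewrite (le_trans Ig)// -addrA -splitr.
Qed.

Lemma approximable_le u c c' : (c <= c')%R -> approximable u c ->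
  approximable u c'.
Proof.
move=> cc' uc e e0; have [w [g [Lw Ug Dw Ig]]] := uc e e0.
by exists w, g; split=> //; rewrite (le_trans Ig)// lee_fin lerD2r.
Qed.

(** [approximable] ties the radius to the tolerance; a tolerance below both e and 1 / (|r| + 1)
    frees them from each other. *)
Lemma approximable_ball u c : measurable_on u -> unit_valued u ->
  approximable u c -> forall r e : R, (0 < e)%R ->
  exists w g, [/\ lip_loc w, unit_valued w, upper_gradient g (EFin \o w),
    L1dist r w u <= e%:E & \int[m]_x g x <= (c + e)%:E].
Proof.
move=> mu1 u01 uc r e e0.
pose s := (Num.min e (`|r| + 1)^-1)%R.
have r0 : (0 < `|r| + 1)%R by rewrite ltr_wpDl.
have s0 : (0 < s)%R by rewrite lt_min e0 invr_gt0.
have se : (s <= e)%R by rewrite ge_min lexx.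
have rs : (r <= s^-1)%R.
  rewrite -[r]invrK; apply: (@le_trans _ _ (`|r| + 1)%R).
    by rewrite invrK; have := ler_norm r; lra.
  by rewrite -[leLHS]invrK lef_pV2 ?posrE ?invr_gt0// /s ge_min lexx orbT.
have [w [g [Lw w01 Ug Dw Ig]]] := approximable_unit uc u01 mu1 s0.
exists w, g; split => //.
- apply: (@le_trans _ _ s%:E); last by rewrite lee_fin.
  by apply: le_trans Dw; apply: L1dist_mono => //; exact: lip_loc_measurable.
- by rewrite (le_trans Ig)// lee_fin lerD2l.
Qed.

Lemma approximable_cst (c : R) : approximable (fun=> c) 0.
Proof.
move=> e e0; exists (fun=> c), (cst 0); split.
- exact: lip_loc_cst.
- exact: upper_gradient_cst.
- rewrite /L1dist (eq_integral (cst 0)); first by rewrite integral0 lee_fin ltW.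
  by move=> x _; rewrite subrr normr0.
- by rewrite integral0 add0r lee_fin ltW.
Qed.

Lemma approximable_affine u (a b c : R) : (0 < a)%R -> measurable_on u ->
  approximable u c -> approximable (fun x => a * u x + b)%R (a * c).
Proof.
move=> a0 mu1 uc e e0.
pose s := Num.min e (e / a)%R.
have s0 : (0 < s)%R by rewrite lt_min e0 divr_gt0.
have se : (s <= e)%R by rewrite ge_min lexx.
have sea : (a * s <= e)%R by rewrite mulrC -ler_pdivlMr// ge_min lexx orbT.
have [w [g [Lw Ug Dw Ig]]] := uc s s0.
have H x y : (`|(a * w x + b) - (a * w y + b)| <= a * `|w x - w y|)%R.
  by rewrite opprD addrACA subrr addr0 -mulrBr normrM gtr0_norm.
exists (fun x => a * w x + b)%R, (fun x => a%:E * g x); split.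
- exact: lip_loc_scale (ltW a0) Lw H.
- exact: upper_gradient_scale (ltW a0) H Ug.
- have -> : L1dist e^-1 (fun x => a * w x + b)%R (fun x => a * u x + b)%R =
    a%:E * L1dist e^-1 w u.
    rewrite /L1dist -ge0_integralZl//; last 2 first.
    + by apply: measurable_dist => //; exact: lip_loc_measurable.
    + by rewrite lee_fin ltW.
    apply: eq_integral => x _; rewrite -EFinM; congr EFin.
    by rewrite opprD addrACA subrr addr0 -mulrBr normrM gtr0_norm.
  apply: (@le_trans _ _ (a * s)%:E); last by rewrite lee_fin.
  rewrite EFinM; apply: lee_wpmul2l; first by rewrite lee_fin ltW.
  apply: le_trans Dw; apply: L1dist_mono => //; first exact: lip_loc_measurable.
  by rewrite lef_pV2.
- have [_ g0 _] := Ug.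
  rewrite ge0_integralZl//; last 2 first.
  + exact: upper_gradient_measurable Ug.
  + by rewrite lee_fin ltW.
  apply: (@le_trans _ _ (a * (c + s))%:E); last by rewrite lee_fin mulrDr lerD2l.
  by rewrite EFinM; apply: lee_wpmul2l; [rewrite lee_fin ltW|exact: Ig].
Qed.

(** Lower semicontinuity: by dominated convergence some [u_ k] is close to u on the relevant ball,
    and an approximant of [u_ k] then serves for u. *)
Lemma approximable_lim (u_ : nat -> X -> R) u c :
  (forall k, measurable_on (u_ k)) -> measurable_on u ->
  (forall k, unit_valued (u_ k)) ->
  (forall x, u_ k x @[k --> \oo] --> u x) ->
  (forall e : R, (0 < e)%R -> \forall k \near \oo, approximable (u_ k) (c + e)) ->
  approximable u c.
Proof.
move=> mu_ mu1 u01 cu H e e0; have e20 : (0 < e / 2)%R by rewrite divr_gt0.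
have near_u : \forall k \near \oo, L1dist e^-1 (u_ k) u <= (e / 2)%:E.
  have : L1dist e^-1 (u_ k) u @[k --> \oo] --> 0 by exact: L1dist_cvg.
  move/fine_cvgP => [fu /cvgrPdist_le/(_ _ e20)].
  apply: filterS2 fu => k fk; rewrite sub0r normrN /= ger0_norm; last first.
    by rewrite fine_ge0// L1dist_ge0.
  by move=> h; rewrite -(fineK fk) lee_fin.
have [k [hk uk]] := filter_ex (filterI near_u (H _ e20)).
have [w [g [Lw w01 Ug Dw Ig]]] := approximable_ball (mu_ k) (u01 k) uk e^-1 e20.
exists w, g; split => //.
- apply: le_trans (L1dist_triangle _ _ (mu_ k) _) _ => //.
    exact: lip_loc_measurable.
  by rewrite (le_trans (leeD Dw hk))// -EFinD -splitr.
- by rewrite (le_trans Ig)// -addrA -splitr.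
Qed.

Definition signed_extremum (sigma a b : R) : R := ((a + b + sigma * `|a - b|) / 2)%R.

Lemma signed_extremum_max a b : signed_extremum 1 a b = Num.max a b.
Proof. by rewrite maxr_absE /signed_extremum mul1r. Qed.

Lemma signed_extremum_min a b : signed_extremum (-1) a b = Num.min a b.
Proof. by rewrite minr_absE /signed_extremum mulN1r. Qed.

(** The root lies between |a - b| and |a - b| + d, so smoothing costs at most d. *)
Lemma soft_extremum_close sigma d a b a' b' : (0 < d)%R -> (`|sigma| <= 1)%R ->
  (`|soft_extremum sigma d a b - signed_extremum sigma a' b'| <=
    `|a - a'| + `|b - b'| + d)%R.
Proof.
move=> d0 s1; rewrite /soft_extremum /signed_extremum.
set t := (a - b)%R; set t' := (a' - b')%R; set S := Num.sqrt _.
have S1 : (`|t| <= S)%R.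
  by rewrite /S -sqrtr_sqr ler_sqrt ?lerDl ?sqr_ge0// addr_ge0 ?sqr_ge0.
have S2 : (S <= `|t| + d)%R.
  have td : (0 <= `|t| + d)%R by rewrite addr_ge0 // ltW.
  rewrite /S -[leRHS](ger0_norm td) -[leRHS]sqrtr_sqr ler_sqrt ?sqr_ge0//.
  rewrite [leRHS]sqrrD -[in leLHS](real_normK (num_real t)) lerD2r lerDl.
  by rewrite mulrn_wge0// mulr_ge0// ltW.
have -> : ((a + b + sigma * S) / 2 - (a' + b' + sigma * `|t'|) / 2 =
   ((a - a') + (b - b') + sigma * (S - `|t'|)) / 2)%R by field.
have h1 : (`|S - `|t'| | <= `|a - a'| + `|b - b'| + d)%R.
  have h : (`| `|t| - `|t'| | <= `|a - a'| + `|b - b'|)%R.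
    rewrite (le_trans (ler_dist_dist _ _))// /t /t'.
    have -> : (a - b - (a' - b') = (a - a') - (b - b'))%R by ring.
    exact: ler_normB.
  move: h; rewrite !ler_norml => /andP[? ?]; apply/andP; split; lra.
have h2 : (`|sigma * (S - `|t'|)| <= `|a - a'| + `|b - b'| + d)%R.
  by rewrite normrM (le_trans _ h1)// ler_piMl.
rewrite normrM (ger0_norm (_ : 0 <= 2^-1)%R)//.
have h3 : (`|(a - a') + (b - b') + sigma * (S - `|t'|)| <=
  `|a - a'| + `|b - b'| + `|sigma * (S - `|t'|)|)%R.
  by rewrite (le_trans (ler_normD _ _))// lerD2r ler_normD.
have := normr_ge0 (a - a')%R; have := normr_ge0 (b - b')%R; lra.
Qed.

(** The weights of the soft maximum and the soft minimum add up to 1. This is the identity behind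
    submodularity: the two gradients add up to g + h, up to the factor 1 + 2 eps. *)
Lemma soft_weightN (sigma d a b : R) :
  soft_weight (- sigma) d a b = (1 - soft_weight sigma d a b)%R.
Proof. by rewrite /soft_weight mulNr; move: (sigma * _)%R => q; lra. Qed.

Lemma lee_sub_of_add (x y : \bar R) (K p : R) : 0 <= x -> 0 <= y ->
  x + y <= K%:E -> p%:E <= x -> y <= (K - p)%:E.
Proof.
case: x y => [x| |] [y| |]//; rewrite ?addye ?addey// -?EFinD !lee_fin => *; lra.
Qed.

(* Submodularity of the total variation: V(min u v) + V(max u v) <= V u + V v. *)
Lemma approximable_extremum sigma u v (a b p : R) : (`|sigma| <= 1)%R ->
  measurable_on u -> measurable_on v -> unit_valued u -> unit_valued v ->
  approximable u a -> approximable v b ->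
  ~ approximable (fun x => signed_extremum sigma (u x) (v x)) p ->
  approximable (fun x => signed_extremum (- sigma) (u x) (v x)) (a + b - p).
Proof.
move=> s1 mu1 mv1 u01 v01 ua vb.
(* At the tolerance e0 no approximant has energy at most p + e0. The soft extremum for sigma will be
   close enough to its limit to be bound by this, so its energy is at least p + e0 and only the rest
   is left for - sigma. *)
move=> /existsNP[e0 /not_implyP[e00 He0]] e e_gt0.
have a0 := approximable_ge0 ua; have b0 := approximable_ge0 vb.
pose r := (Num.max e0^-1 e^-1)%R; pose s := Num.min e0 e.
have s0 : (0 < s)%R by rewrite lt_min e00.
have se0 : (s <= e0)%R by rewrite ge_min lexx.
have se : (s <= e)%R by rewrite ge_min lexx orbT.
have re0 : (e0^-1 <= r)%R by rewrite le_max lexx.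
have re : (e^-1 <= r)%R by rewrite le_max lexx orbT.
have Mfin : mu (ball (point : X) r) \is a fin_num.
  by rewrite ge0_fin_numE ?outer_measure_ge0.
pose M := fine (mu (ball (point : X) r)).
have M0 : (0 <= M)%R by rewrite fine_ge0// outer_measure_ge0.
(* In the L1 estimate d is multiplied by the measure M of the whole ball, and below eps is
   multiplied by the total energy K; both are normalized accordingly. *)
pose d := (s / 2 / (M + 1))%R.
have d0 : (0 < d)%R by rewrite !divr_gt0// ltr_wpDl.
have dM : (d * M <= s / 2)%R.
  rewrite /d -mulrA ler_piMr ?divr_ge0 ?ltW//.
  by rewrite mulrC ltr_pdivrMr ?ltr_wpDl// mul1r ltrDl.
pose t := (s / 4)%R; have t0 : (0 < t)%R by rewrite divr_gt0.
pose K := (a + b + 2 * t)%R; have K0 : (0 <= K)%R by rewrite /K; lra.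
pose eps := (e / 4 / (K + 1))%R.
have eps0 : (0 < eps)%R by rewrite !divr_gt0// ltr_wpDl.
have epsK : (eps * K <= e / 4)%R.
  rewrite /eps -mulrA ler_piMr ?divr_ge0 ?ltW//.
  by rewrite mulrC ltr_pdivrMr ?ltr_wpDl// mul1r ltrDl.
have [w [g [Lw w01 Ug Dw Ig]]] := approximable_ball mu1 u01 ua r t0.
have [z [h [Lz z01 Uh Dz Ih]]] := approximable_ball mv1 v01 vb r t0.
have cw := lip_loc_continuous Lw; have cz := lip_loc_continuous Lz.
have mw := lip_loc_measurable Lw; have mz := lip_loc_measurable Lz.
have soft_lip tau : (`|tau| <= 1)%R ->
    lip_loc (fun x => soft_extremum tau d (w x) (z x)).
  by move=> t1; apply: lip_loc_le2 Lw Lz _ => x y; exact: soft_extremum_lip.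
have mext tau : measurable_on (fun x => signed_extremum tau (u x) (v x)).
  apply: measurable_funM => //; apply: measurable_funD.
    exact: measurable_funD.
  apply: measurable_funM => //; apply: measurableT_comp => //.
  exact: measurable_funB.
have soft_close tau : (`|tau| <= 1)%R ->
    L1dist r (fun x => soft_extremum tau d (w x) (z x))
      (fun x => signed_extremum tau (u x) (v x)) <= s%:E.
  move=> t1; apply: le_trans (L1dist_le _ (ltW d0) _ _ mw mu1 mz mv1 _) _.
  - exact: (lip_loc_measurable (soft_lip _ t1)).
  - exact: mext.
  - by move=> x; exact: soft_extremum_close.
  - apply: (@le_trans _ _ (t%:E + t%:E + (d * M)%:E)); last first.
      by rewrite -!EFinD lee_fin /t; lra.
    have -> : (d * M)%:E = d%:E * mu (ball (point : X) r) by rewrite EFinM fineK.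
    by rewrite leeD2r// leeD.
pose G tau x := (soft_weight tau d (w x) (z x) + eps)%:E * g x +
  (1 - soft_weight tau d (w x) (z x) + eps)%:E * h x.
have UG tau : (`|tau| <= 1)%R ->
    upper_gradient (G tau) (EFin \o (fun x => soft_extremum tau d (w x) (z x))).
  by move=> t1; exact: upper_gradient_soft.
have s1' : (`|- sigma| <= 1)%R by rewrite normrN.
have mg := upper_gradient_measurable Ug.
have mh := upper_gradient_measurable Uh.
have [_ g0 _] := Ug; have [_ h0 _] := Uh.
have sumG : \int[m]_x G sigma x + \int[m]_x G (- sigma)%R x <=
    ((1 + 2 * eps) * K)%:E.
  have [mG1 G10 _] := UG _ s1; have [mG2 G20 _] := UG _ s1'.
  rewrite -ge0_integralD//; last 2 first.
  - exact: borel_fun_cara.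
  - exact: borel_fun_cara.
  rewrite (eq_integral (fun x : Xm => (1 + 2 * eps)%:E * (g x + h x))); last first.
    move=> x _; rewrite /G soft_weightN; set q := soft_weight _ _ _ _.
    have /andP[q0 q1] : (0 <= q <= 1)%R by exact: soft_weight01.
    rewrite addeACA -!ge0_muleDl ?lee_fin; [|lra..].
    rewrite -!EFinD ge0_muleDr//; congr (_%:E * _ + _%:E * _); ring.
  rewrite ge0_integralZl//; last 3 first.
  - exact: emeasurable_funD.
  - by move=> x _; rewrite adde_ge0.
  - by rewrite lee_fin; lra.
  rewrite EFinM; apply: lee_wpmul2l; first by rewrite lee_fin; lra.
  rewrite ge0_integralD// /K; apply: le_trans (leeD Ig Ih) _.
  by rewrite -EFinD lee_fin; lra.
have lowG : (p + e0)%:E <= \int[m]_x G sigma x.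
  rewrite leNgt; apply/negP => hG; apply: He0.
  exists (fun x => soft_extremum sigma d (w x) (z x)), (G sigma); split.
  - exact: soft_lip.
  - exact: UG.
  - apply: le_trans (L1dist_mono _ _ re0) _; last first.
    + by rewrite (le_trans (soft_close _ s1))// lee_fin.
    + exact: mext.
    + exact: (lip_loc_measurable (soft_lip _ s1)).
  - exact: ltW.
exists (fun x => soft_extremum (- sigma)%R d (w x) (z x)), (G (- sigma)%R); split.
- exact: soft_lip.
- exact: UG.
- apply: le_trans (L1dist_mono _ _ re) _; last first.
  + by rewrite (le_trans (soft_close _ s1'))// lee_fin.
  + exact: mext.
  + exact: (lip_loc_measurable (soft_lip _ s1')).
- have [_ G10 _] := UG _ s1; have [_ G20 _] := UG _ s1'.
  apply: le_trans (lee_sub_of_add _ _ sumG lowG) _.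
  + by apply: integral_ge0.
  + by apply: integral_ge0.
  + by rewrite lee_fin; rewrite /K /t in epsK *; lra.
Qed.

End Approximation.

(** * A minimizing set *)

Section Minimizer.
Context (R : realType) (X : completeMetricType R).
Context (mu : {outer_measure set X -> \bar R}).
Hypothesis mu_borel : forall A : set X, borel_set A -> mu.-cara.-measurable A.
Variable Cd : R.
Hypothesis Cd1 : (1 <= Cd)%R.
Hypothesis mu_dbl : forall (x : X) (r : R), (0 < r)%R ->
  [/\ 0 < mu (ball x (2 * r)%R),
      mu (ball x (2 * r)%R) <= Cd%:E * mu (ball x r) &
      mu (ball x r) < +oo].
Local Notation m := (cara_measure mu).
Local Notation Xm := (caratheodory_type mu).
Local Notation measurable_on u := (measurable_fun [set: Xm] (u : Xm -> R)).
Implicit Types (u v w f : X -> R) (g h : X -> \bar R).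

Lemma limn_einf_lt (a : nat -> \bar R) (c : \bar R) : limn_einf a < c ->
  forall N, exists2 n, (N <= n)%N & a n < c.
Proof.
rewrite limn_einf_lim (cvg_lim _ (@cvg_einfs_sup _ a))// => h N.
apply: contrapT => H; move: h; rewrite ltNge => /negP; apply.
apply: (@le_trans _ _ (einfs a N)); last by apply: ereal_sup_ubound; exists N.
apply: le_ereal_inf_tmp => _ [n /= Nn <-]; rewrite leNgt; apply/negP => h.
by apply: H; exists n.
Qed.

Lemma limn_einf_le (a : nat -> \bar R) (c : R) :
  (forall n, a n <= (c + n.+1%:R^-1)%:E) -> limn_einf a <= c%:E.
Proof.
move=> H; rewrite limn_einf_lim (cvg_lim _ (@cvg_einfs_sup _ a))//.
apply: ge_ereal_sup => _ [N _ <-]; apply/lee_addgt0Pr => e e0.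
pose k := maxn N (Num.bound e^-1).
apply: (@le_trans _ _ (a k)).
  by apply: ereal_inf_lbound; exists k => //=; exact: leq_maxl.
rewrite (le_trans (H k))// -EFinD lee_fin lerD2l.
rewrite -[leRHS]invrK lef_pV2 ?posrE ?invr_gt0//.
rewrite (le_trans (ltW (archi_boundP _)))//; first by rewrite invr_ge0 ltW.
by rewrite ler_nat /k leqW// leq_maxr.
Qed.

(** Functions admissible for the capacity may be unbounded or infinite. Here v stands for the
    truncation of u, which enters only through a contraction estimate. *)
Lemma approximable_of_variation (u : X -> \bar R) v (c : R) :
  measurable_fun [set: Xm] (u : Xm -> \bar R) -> measurable_on v ->
  (forall x t, (`|clamp t - v x|)%:E <= `|t%:E - u x|) ->
  variation_norm mu u <= c%:E -> approximable mu v c.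
Proof.
move=> mu1 mv H Vc e e0.
have : variation_norm mu u < (c + e)%:E.
  by rewrite (le_lt_trans Vc)// lte_fin ltrDl.
move=> /ereal_inf_lt[_ [u_ [g_ [Lu cu Ug ->]]]] /limn_einf_lt lim_lt.
have mu_ i : measurable_on (u_ i) by exact: lip_loc_measurable.
have : \int[m]_(y in ball (point : X) e^-1) `|(u_ i y)%:E - u y| @[i --> \oo] --> 0.
  apply: (cvg_integral_ball mu_borel Cd1 mu_dbl) => //.
  move=> i; apply: measurableT_comp => //; apply: emeasurable_funB => //.
  exact/measurable_EFinP.
move=> /fine_cvgP[fu /cvgrPdist_le/(_ _ e0)] hu.
have [N _ HN] : \forall k \near \oo,
    \int[m]_(y in ball (point : X) e^-1) `|(u_ k y)%:E - u y| <= e%:E.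
  apply: filterS2 fu hu => k fk; rewrite sub0r normrN /= ger0_norm; last first.
    by rewrite fine_ge0// integral_ge0.
  by move=> h; rewrite -(fineK fk) lee_fin.
have [n Nn hn] := lim_lt N.
exists (@clamp R \o u_ n), (g_ n); split.
- apply: (lip_loc_scale ler01 (Lu n)) => x y.
  by rewrite mul1r; exact: clamp_contraction.
- by apply: upper_gradient_contraction (Ug n) => x y; exact: clamp_contraction.
- apply: le_trans (HN n Nn); apply: ge0_le_integral => //.
  + exact: measurable_ball_cara.
  + apply: measurable_funTS; apply/measurable_EFinP.
    apply: measurableT_comp => //; apply: measurable_funB => //.
    apply: lip_loc_measurable => //; apply: (lip_loc_scale ler01 (Lu n)) => x y.
    by rewrite mul1r; exact: clamp_contraction.
  + apply: measurable_funTS; apply: measurableT_comp => //.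
    by apply: emeasurable_funB => //; exact/measurable_EFinP.
  + by move=> x _; exact: H.
- exact: ltW.
Qed.

(** Approximants with tolerance 1 / (n + 1) converge on every unit ball, since it eventually lies in
    the ball of radius n + 1 about the distinguished point. *)
Lemma variation_norm_le u c : measurable_on u -> approximable mu u c ->
  variation_norm mu (EFin \o u) <= c%:E.
Proof.
move=> mu1 uc.
have H n : exists p : (X -> R) * (X -> \bar R), [/\ lip_loc p.1,
    upper_gradient p.2 (EFin \o p.1),
    L1dist mu n.+1%:R p.1 u <= (n.+1%:R^-1)%:E &
    \int[m]_x p.2 x <= (c + n.+1%:R^-1)%:E].
  have n0 : (0 < n.+1%:R^-1 :> R)%R by rewrite invr_gt0.
  by have [w [g]] := uc _ n0; rewrite invrK => ?; exists (w, g).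
have [p pP] := choice H.
apply: (@le_trans _ _ (limn_einf (fun n => \int[m]_x (p n).2 x))).
  apply: ereal_inf_lbound; exists (fun n => (p n).1), (fun n => (p n).2).
  split => //; try by move=> i; have [] := pP i.
  move=> x; exists 1%R => //.
  apply: (@squeeze_cvge _ _ _ _ (cst 0) _ (fun i => (i.+1%:R^-1)%:E)).
  - near=> n; rewrite integral_ge0//=.
    have [Lp _ Dp _] := pP n; apply: le_trans Dp.
    apply: ge0_subset_integral => //.
    + exact: measurable_ball_cara.
    + exact: measurable_ball_cara.
    + apply: measurable_funTS; apply/measurable_EFinP.
      apply: measurableT_comp => //; apply: measurable_funB => //.
      exact: lip_loc_measurable.
    + apply: ball_subset_ball; near: n.
      exists (Num.bound (mdist point x + 1)%R) => // n /= hn.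
      rewrite (le_trans (ltW (archi_boundP _)))//.
        by rewrite addr_ge0// mdist_ge0.
      by rewrite ler_nat leqW.
  - exact: cvg_cst.
  - apply: cvg_EFin; first exact: nearW.
    exact: cvg_harmonic.
by apply: limn_einf_le => n; have [] := pP n.
Unshelve. all: by end_near. Qed.

Variables K U : set X.

Definition competitor u : Prop := [/\ measurable_on u, unit_valued u,
  (forall x, K x -> u x = 1%R) & (forall x, ~ U x -> u x = 0%R)].

Variable alpha : R.
Hypothesis alpha_le : forall u c, competitor u -> approximable mu u c ->
  (alpha <= c)%R.

Lemma competitor_cvg (u_ : nat -> X -> R) u :
  (forall n, competitor (u_ n)) -> (forall x, u_ n x @[n --> \oo] --> u x) ->
  competitor u.
Proof.
move=> cu cv; split.
- apply: (@measurable_fun_cvg _ Xm R setT u_) => //.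
  by move=> n; have [] := cu n.
- move=> x; have ux01 n : (0 <= u_ n x <= 1)%R by have [_ + _ _] := cu n; apply.
  have cux : cvgn (u_ ^~ x) by apply/cvg_ex; exists (u x).
  rewrite -(cvg_lim _ (cv x))//; apply/andP; split.
    by apply: limr_ge => //; apply: nearW => n; case/andP: (ux01 n).
  by apply: limr_le => //; apply: nearW => n; case/andP: (ux01 n).
- move=> x Kx; apply: (cvg_unique _ (cv x)) => //.
  rewrite (_ : u_ ^~ x = cst 1%R); first exact: cvg_cst.
  by apply/funext => n /=; have [_ _ ->] := cu n.
- move=> x Ux; apply: (cvg_unique _ (cv x)) => //.
  rewrite (_ : u_ ^~ x = cst 0%R); first exact: cvg_cst.
  by apply/funext => n /=; have [_ _ _ ->] := cu n.
Qed.

Lemma competitor_min u v : competitor u -> competitor v ->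
  competitor (fun x => Num.min (u x) (v x)).
Proof.
move=> [mu1 u01 uK uU] [mv v01 vK vU]; split.
- exact: measurable_minr.
- move=> x; have /andP[h1 h2] := u01 x; have /andP[h3 h4] := v01 x.
  by rewrite le_min h1 h3 ge_min h2.
- by move=> x Kx; rewrite uK// vK// minxx.
- by move=> x Ux; rewrite uU// vU// minxx.
Qed.

Lemma competitor_max u v : competitor u -> competitor v ->
  competitor (fun x => Num.max (u x) (v x)).
Proof.
move=> [mu1 u01 uK uU] [mv v01 vK vU]; split.
- exact: measurable_maxr.
- move=> x; have /andP[h1 h2] := u01 x; have /andP[h3 h4] := v01 x.
  by rewrite le_max h1 ge_max h2 h4.
- by move=> x Kx; rewrite uK// vK// maxxx.
- by move=> x Ux; rewrite uU// vU// maxxx.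
Qed.

(** The minimum is a competitor too, so its variation is at least alpha, and submodularity leaves at
    most a + b - alpha for the maximum. The auxiliary e makes the lower bound strict, as a negated
    [approximable] has to be. *)
Lemma approximable_competitor_max u v a b : competitor u -> competitor v ->
  approximable mu u a -> approximable mu v b ->
  approximable mu (fun x => Num.max (u x) (v x)) (a + b - alpha).
Proof.
move=> cu cv ua vb; have [mu1 u01 _ _] := cu; have [mv v01 _ _] := cv.
apply: (approximable_closed mu_borel) => //; first exact: measurable_maxr.
move=> e e0.
have -> : (fun x => Num.max (u x) (v x)) = (fun x => signed_extremum (- -1)%R (u x) (v x)).
  by apply/funext => x; rewrite opprK signed_extremum_max.
rewrite (_ : a + b - alpha + e = a + b - (alpha - e))%R; last by ring.
apply: (approximable_extremum mu_borel mu_dbl) => //; first by rewrite normrN normr1.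
rewrite (_ : (fun x => _) = (fun x => Num.min (u x) (v x))); last first.
  by apply/funext => x; rewrite signed_extremum_min.
by move=> /(alpha_le (competitor_min cu cv)); lra.
Qed.

Hypothesis alpha_inf : forall e : R, (0 < e)%R ->
  exists2 u, competitor u & approximable mu u (alpha + e).

(* With u_i chosen so that V(u_i) <= alpha + 2^-i, submodularity keeps the
   energy of all the maxima below alpha + 2^(1-m), so that limsup u_i is a
   minimizer; no compactness is needed. *)
Lemma minimizer_exists : exists2 u, competitor u & approximable mu u alpha.
Proof.
pose a k : R := (2^-1 ^+ k)%R.
have a0 k : (0 < a k)%R by rewrite exprn_gt0// invr_gt0.
have aS k : (a k = 2 * a k.+1)%R by rewrite /a exprS mulrA divff// mul1r.
have H k : exists u, competitor u /\ approximable mu u (alpha + a k).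
  by have [u ? ?] := alpha_inf (a0 k); exists u.
have [u_ u_P] := choice H.
pose M := fix M k n x := if n is n'.+1 then Num.max (M k n' x) (u_ (k + n)%N x)
  else u_ k x.
have cM k n : competitor (M k n).
  elim: n => [|n IH] /=; first by have [] := u_P k.
  by apply: competitor_max => //; have [] := u_P (k + n.+1)%N.
(* The term - a (k + n) closes the induction: one more maximum costs a (k + n + 1), which equals a
   (k + n) - a (k + n + 1). *)
have vM k n : approximable mu (M k n) (alpha + 2 * a k - a (k + n)%N).
  elim: n => [|n IH] /=.
    rewrite addn0 (_ : _ - _ = alpha + a k)%R; last by ring.
    by have [] := u_P k.
  have [cu vu] := u_P (k + n.+1)%N.
  rewrite (_ : _ - _ = (alpha + 2 * a k - a (k + n)%N) +
    (alpha + a (k + n.+1)%N) - alpha)%R; last first.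
    by rewrite addnS (aS (k + n)%N); ring.
  exact: approximable_competitor_max.
have M01 k n x : (0 <= M k n x <= 1)%R by have [_ + _ _] := cM k n; apply.
have Mnd k x : nondecreasing_seq (M k ^~ x).
  by apply/nondecreasing_seqP => n /=; rewrite le_max lexx.
have Mcvg k x : cvgn (M k ^~ x).
  apply: nondecreasing_is_cvgn => //; exists 1%R => _ [n _ <-].
  by case/andP: (M01 k n x).
pose W k x := limn (M k ^~ x).
have MW k x : M k n x @[n --> \oo] --> W k x by exact: Mcvg.
have cW k : competitor (W k) by exact: competitor_cvg (cM k) (MW k).
have vW k : approximable mu (W k) (alpha + 2 * a k).
  have [mW _ _ _] := cW k.
  apply: (approximable_lim mu_borel mu_dbl (u_ := M k)) => //.
  - by move=> n; have [] := cM k n.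
  - by move=> n; have [] := cM k n.
  - move=> e e0; apply: nearW => n; apply: approximable_le (vM k n).
    by have := a0 (k + n)%N; lra.
have W01 k x : (0 <= W k x <= 1)%R by have [_ + _ _] := cW k; apply.
(* [M k.+1 n] is a maximum over fewer indices than [M k n.+1]. *)
have Wni x : nonincreasing_seq (W ^~ x).
  apply/nonincreasing_seqP => k.
  apply: limr_le; first exact: Mcvg.
  apply: nearW => n; apply: (@le_trans _ _ (M k n.+1 x)).
    elim: n => [|n IH]; first by rewrite /= addn1 le_max lexx orbT.
    rewrite -[leRHS]/(Num.max (M k n.+1 x) (u_ (k + n.+2)%N x)).
    rewrite -[leLHS]/(Num.max (M k.+1 n x) (u_ (k.+1 + n.+1)%N x)).
    by rewrite addSnnS ge_max; apply/andP; split; rewrite le_max ?IH ?lexx ?orbT.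
  exact: (nondecreasing_cvgn_le (Mnd k x) (Mcvg k x) n.+1).
have Wcvg x : cvgn (W ^~ x).
  apply: nonincreasing_is_cvgn => //; exists 0%R => _ [n _ <-].
  by case/andP: (W01 n x).
pose u x := limn (W ^~ x).
have Wu x : W k x @[k --> \oo] --> u x by exact: Wcvg.
have cu : competitor u by exact: competitor_cvg cW Wu.
exists u => //; have [mu1 _ _ _] := cu.
apply: (approximable_lim mu_borel mu_dbl (u_ := W)) => //.
- by move=> n; have [] := cW n.
- move=> e e0.
  have : \forall k \near \oo, (a k < e / 2)%R.
    have : a k @[k --> \oo] --> (0:R)%R.
      by apply: cvg_expr; rewrite ger0_norm// invf_lt1// ltr1n.
    by move/cvgr_lt; apply; rewrite divr_gt0.
  apply: filterS => k ak; apply: approximable_le (vW k); lra.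
Qed.

(** Both extrema are rescaled competitors: min(u, 1/2) gives 2 min(u, 1/2) = min(1, 2 u), and max(u,
    1/2) gives 2 max(u, 1/2) - 1. The second forces V(max(u, 1/2)) >= alpha / 2, which leaves at
    most alpha / 2 for the minimum. *)
Lemma minimizer_double u : competitor u -> approximable mu u alpha ->
  competitor (fun x => Num.min 1%R (2 * u x)%R) /\
  approximable mu (fun x => Num.min 1%R (2 * u x)%R) alpha.
Proof.
move=> [mu1 u01 uK uU] ua.
have mc : measurable_on (fun=> (2^-1)%R : R) by exact: measurable_cst.
have mmin : measurable_on (fun x => Num.min (u x) (2^-1)%R) by exact: measurable_minr.
have mmax : measurable_on (fun x => Num.max (u x) (2^-1)%R) by exact: measurable_maxr.
have E t : (Num.min 1 (2 * t) = 2 * Num.min t (2^-1)%R + 0 :> R)%R.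
  rewrite addr0 minr_pMr// divff// minC//.
have Efun : (fun x => Num.min 1 (2 * u x))%R = (fun x => 2 * Num.min (u x) (2^-1)%R + 0)%R.
  by apply/funext => x.
have i01 : (0 <= (2^-1 : R) <= 1)%R by apply/andP; split; lra.
split.
  split.
  - by rewrite Efun; apply: measurable_funD => //; apply: measurable_funM.
  - move=> x; have /andP[h1 h2] := u01 x.
    by rewrite le_min ler01 mulr_ge0//= ge_min lexx.
  - by move=> x Kx; rewrite uK// mulr1 min_l// ler1n.
  - by move=> x Ux; rewrite uU// mulr0 min_r.
rewrite Efun (_ : alpha = 2 * (alpha / 2))%R; last by field.
apply: (approximable_affine mu_borel) => //.
apply: (approximable_closed mu_borel) => // e e0.
rewrite (_ : (fun x => _) = (fun x => signed_extremum (- 1)%R (u x) (2^-1)%R)); last first.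
  by apply/funext => x; rewrite signed_extremum_min.
rewrite (_ : alpha / 2 + e = alpha + 0 - (alpha / 2 - e))%R; last by field.
apply: (approximable_extremum mu_borel mu_dbl) => //; first by rewrite normr1.
  exact: approximable_cst.
rewrite (_ : (fun x => _) = (fun x => Num.max (u x) (2^-1)%R)%R); last first.
  by apply/funext => x; rewrite signed_extremum_max.
move=> /(approximable_affine mu_borel (-1) (ltr0n R 2) mmax) h.
have : (alpha <= 2 * (alpha / 2 - e))%R; last lra.
apply: alpha_le h; split.
- by apply: measurable_funD => //; apply: measurable_funM.
- move=> x; have /andP[h1 h2] := u01 x; have /andP[h3 h4] := i01.
  have : ((2^-1)%R <= Num.max (u x) (2^-1)%R)%R by rewrite le_max lexx orbT.
  have : (Num.max (u x) (2^-1)%R <= 1)%R by rewrite ge_max h2 h4.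
  move=> *; apply/andP; split; lra.
- move=> x Kx; rewrite uK// max_l; last by case/andP: i01.
  by ring.
- by move=> x Ux; rewrite uU// max_r ?invr_ge0// divff// subrr.
Qed.

Lemma minimizer_set : exists D : set X, [/\ mu.-cara.-measurable D,
  competitor \1_D & approximable mu (\1_D : X -> R) alpha].
Proof.
have [u cu ua] := minimizer_exists.
pose w n := iter n (fun (v : X -> R) x => Num.min 1%R (2 * v x)%R) u.
have wP n : competitor (w n) /\ approximable mu (w n) alpha.
  by elim: n => [//|n [IH1 IH2]] /=; exact: minimizer_double.
have wE n x : w n x = Num.min 1%R (2 ^+ n * u x)%R.
  elim: n => [|n IH] /=.
    rewrite expr0 mul1r min_r//.
    by have [_ + _ _] := cu; move=> /(_ x) /andP[].
  rewrite -/(w n) IH minr_pMr// mulr1 mulrA -exprS.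
  by rewrite minA [(Num.min 1 2)%R]min_l// ler1n.
pose D := [set x | (0 < u x)%R].
have [mu1 u01 uK uU] := cu.
have mD : mu.-cara.-measurable D.
  have := mu1 measurableT _ (measurable_itv `]0%R, +oo[).
  rewrite setTI (_ : _ @^-1` _ = D)//.
  by apply/seteqP; split => x; rewrite /D /= in_itv/= andbT.
have cvw x : w n x @[n --> \oo] --> (\1_D x : R).
  have [ux|ux] := ltP 0%R (u x).
    rewrite indicE mem_set//; apply: cvg_near_cst.
    exists (Num.bound (u x)^-1) => // n /= hn; rewrite wE min_l//.
    rewrite -ler_pdivrMr// mul1r.
    rewrite (le_trans (ltW (archi_boundP _)))//; first by rewrite invr_ge0 ltW.
    rewrite (@le_trans _ _ n%:R)%R ?ler_nat//.
    by rewrite -natrX ler_nat ltnW// ltn_expl.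
  have ux0 : u x = 0%R.
    by apply/eqP; rewrite eq_le ux; case/andP: (u01 x).
  rewrite indicE memNset; last by rewrite /D /= ux0 ltxx.
  rewrite (_ : (fun n => w n x) = cst 0%R); first exact: cvg_cst.
  by apply/funext => n; rewrite wE ux0 mulr0 min_r.
have cD : competitor \1_D by apply: competitor_cvg cvw => n; have [] := wP n.
exists D; split => //; have [mD1 _ _ _] := cD.
apply: (approximable_lim mu_borel mu_dbl (u_ := w)) => //.
- by move=> n; have [[]] := wP n.
- by move=> n; have [[]] := wP n.
- move=> e e0; apply: nearW => n; have [_ wn] := wP n.
  by apply: approximable_le wn; lra.
Qed.

End Minimizer.

(** * Lebesgue density *)

Section Covering.
Context (R : realType) (X : completeMetricType R).

(* Vitali's covering lemma; Zorn's lemma is applied to the disjoint families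
   that contain, for every ball of [S] that they meet, a ball meeting it whose
   radius is at least half as large. *)
Lemma vitali_covering (S : set X) (rho : X -> R) (M : R) :
  (forall x, S x -> (0 < rho x <= M)%R) -> exists D : set X,
  [/\ D `<=` S,
    (forall x y z, D x -> D y -> ball x (rho x) z -> ball y (rho y) z -> x = y) &
    forall x, S x -> exists2 y, D y & ball y (3 * rho y)%R x].
Proof.
move=> HS.
pose meets x y := exists2 z, ball x (rho x) z & ball y (rho y) z.
pose P (D : set X) := [/\ D `<=` S,
  (forall x y, D x -> D y -> meets x y -> x = y) &
  forall x y, S x -> D y -> meets x y ->
    exists y', [/\ D y', meets x y' & (rho x <= 2 * rho y')%R]].
have [F FP totF|A [[AS Adisj Ameet] Amax]] := @Zorn_bigcup X P.
  split.
  - by move=> x [D FD Dx]; have [h _ _] := FP _ FD; exact: h.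
  - move=> x y [D FD Dx] [E FE Ey]; have [DE|ED] := totF _ _ FD FE.
      by have [_ h _] := FP _ FE; apply: h => //; exact: DE.
    by have [_ h _] := FP _ FD; apply: h => //; exact: ED.
  - move=> x y Sx [D FD Dy] xy; have [_ _ h] := FP _ FD.
    have [y' [Dy' ? ?]] := h x y Sx Dy xy; exists y'; split => //.
    by exists D.
have meetsxx x : S x -> meets x x.
  by move=> /HS /andP[h _]; exists x; exact: ballxx.
have meetsC x y : meets x y -> meets y x by move=> [z ? ?]; exists z.
have cov x : S x -> exists2 y, A y & meets x y.
  move=> Sx; apply: contrapT => H.
  (* The centres whose balls miss the whole family: one of them whose radius exceeds half the
     supremum could be added to it, against maximality. *)
  pose T := [set x | S x /\ ~ exists2 y, A y & meets x y].
  have Tx : T x by [].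
  have supT : has_sup (rho @` T).
    split; first by exists (rho x), x.
    by exists M => _ [y [Sy _] <-]; case/andP: (HS _ Sy).
  have s0 : (0 < sup (rho @` T))%R.
    have /andP[h _] := HS _ Sx; apply: (lt_le_trans h).
    by apply: sup_upper_bound => //; exists x.
  have s20 : (0 < sup (rho @` T) / 2)%R by rewrite divr_gt0.
  have [_ [x1 Tx1 <-] hx1] := sup_adherent s20 supT.
  have hT y : T y -> (rho y <= 2 * rho x1)%R.
    move=> Ty; have : (rho y <= sup (rho @` T))%R.
      by apply: sup_upper_bound => //; exists y.
    by move: hx1; lra.
  have [Sx1 nx1] : S x1 /\ ~ (exists2 y, A y & meets x1 y) := Tx1.
  apply: (Amax (A `|` [set x1])).
    split; first by move=> y Ay; left.
    by move=> h; apply: nx1; exists x1; [apply: h; right|exact: meetsxx].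
  split.
  - by move=> y [/AS//|->].
  - move=> y z [Ay|->] [Az|->] //; first exact: Adisj.
      by move=> yx1; exfalso; apply: nx1; exists y => //; exact: meetsC.
    by move=> yx1; exfalso; apply: nx1; exists z.
  - move=> y z Sy zA yz.
    have [[z' Az' yz']|ny] := pselect (exists2 z, A z & meets y z).
      have [y' [Ay' ? ?]] := Ameet _ _ Sy Az' yz'.
      by exists y'; split => //; left.
    case: zA => [Az|zx1]; first by exfalso; apply: ny; exists z.
    by exists x1; split; [right|rewrite -zx1|exact: hT].
exists A; split => //.
- by move=> x y z Ax Ay h1 h2; apply: Adisj => //; exists z.
- move=> x Sx; have [y Ay xy] := cov x Sx.
  have [y' [Ay' [z xz y'z] xy']] := Ameet _ _ Sx Ay xy.
  exists y' => //; move: xz y'z; rewrite !ballEmdist/= => xz y'z.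
  rewrite (le_lt_trans (metric_triangle _ z _))// (metric_sym z).
  have : (mdist y' z + mdist x z < rho y' + rho x)%R by rewrite ltrD.
  lra.
Qed.

Lemma bound_finite_set (T : choiceType) (A : set T) (n : nat) :
  (forall s : seq T, uniq s -> (forall x, x \in s -> A x) -> (size s <= n)%N) ->
  finite_set A.
Proof.
move=> H; apply: contrapT => /(infinite_set_fset n.+1)[B BA nB].
have := H (finmap.enum_fset B) (finmap.fset_uniq B) (fun x xB => BA x xB).
by rewrite leqNgt nB.
Qed.

End Covering.

(** * Approximation of Borel sets by closed and open sets *)

Section Regularity.
Context (R : realType) (X : completeMetricType R).
Context (mu : {outer_measure set X -> \bar R}).
Hypothesis mu_borel : forall A : set X, borel_set A -> mu.-cara.-measurable A.
Local Notation m := (cara_measure mu).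
Local Notation Xm := (caratheodory_type mu).

Lemma mu_cvg0 (W : set X) (F : nat -> set X) : mu W < +oo ->
  mu.-cara.-measurable W -> (forall n, mu.-cara.-measurable (F n)) ->
  (forall n, F n.+1 `<=` F n) -> F 0%N `<=` W ->
  forall e : R, mu (\bigcap_n F n) < e%:E -> exists n, mu (F n) < e%:E.
Proof.
move=> Wfin mW mF ndF F0 e he.
have mcap : mu.-cara.-measurable (\bigcap_n F n) by exact: bigcapT_measurable.
have cv : mu (F n) @[n --> \oo] --> mu (\bigcap_n F n).
  apply: (@nonincreasing_cvg_mu _ Xm R m F) => //.
    exact: le_lt_trans (le_outer_measure mu _ _ F0) Wfin.
  by apply/nonincreasing_seqP => n; apply/subsetPset; exact: ndF.
apply: contrapT => H.
have : e%:E <= mu (\bigcap_n F n).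
  rewrite -(cvg_lim _ cv)//; apply: lime_ge; first by apply/cvg_ex; eexists; exact: cv.
  by apply: nearW => n; rewrite leNgt; apply/negP => h; apply: H; exists n.
by rewrite leNgt he.
Qed.

Variable W : set X.
Hypothesis mW : mu.-cara.-measurable W.
Hypothesis Wfin : mu W < +oo.

(** These sets form a sigma-algebra that contains the open sets, hence all Borel sets. The set W of
    finite measure makes continuity from above available. *)
Definition regular_set (A : set X) : Prop := forall e : R, (0 < e)%R ->
  exists F Q : set X, [/\ closed F, open Q, F `<=` A, A `<=` Q &
    mu (W `&` (Q `\` F)) < e%:E].

Let open_borel (Q : set X) : open Q -> mu.-cara.-measurable Q.
Proof. by move=> oO; apply: mu_borel; exact: sub_sigma_algebra. Qed.

Let closed_borel (F : set X) : closed F -> mu.-cara.-measurable F.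
Proof.
move=> cF; rewrite -[F]setCK; apply: measurableC; apply: open_borel.
exact: closed_openC.
Qed.

(** The closed sets of points at distance at least 1 / (n + 1) from the complement exhaust A. *)
Lemma open_regular (A : set X) : open A -> regular_set A.
Proof.
move=> oA e e0.
pose F n := [set y : X | ball y (n.+1%:R^-1 : R) `<=` A].
have cF n : closed (F n).
  rewrite -[F n]setCK; apply: open_closedC; rewrite openE => y /= /existsNP[z].
  move=> /not_implyP[yz nAz]; rewrite /interior -nbhs_ballE.
  move: yz; rewrite ballEmdist/= => yz.
  exists (n.+1%:R^-1 - mdist y z)%R; first by rewrite /= subr_gt0.
  move=> y' /=; rewrite ballEmdist/= => yy' h; apply: nAz; apply: h.
  rewrite ballEmdist/= (le_lt_trans (metric_triangle _ y _))// (metric_sym y').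
  by rewrite -ltrBrDr.
have FA n : F n `<=` A.
  by move=> y; apply; apply: ballxx; rewrite invr_gt0.
have [| | | |n hn] := @mu_cvg0 W (fun n => W `&` (A `\` F n)) Wfin mW _ _ _ e.
- move=> n; apply: measurableI => //; apply: measurableD; first exact: open_borel.
  exact: closed_borel.
- move=> n y [Wy [Ay nF]]; split => //; split => // h; apply: nF => z yz.
  apply: h; move: yz; apply: le_ball; by rewrite lef_pV2 ?posrE// ler_nat.
- exact: subIsetl.
- rewrite (_ : \bigcap_n _ = set0) ?outer_measure0//.
  apply/seteqP; split => // y h; have [_ [Ay _]] := h 0%N I.
  have := oA; rewrite openE => /(_ _ Ay); rewrite /interior -nbhs_ballE => -[r /= r0 hr].
  have [_ [_]] := h (Num.bound r^-1) I; apply => z yz; apply: hr.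
  move: yz; apply: le_ball.
  rewrite -[leRHS]invrK lef_pV2 ?posrE ?invr_gt0//.
  rewrite (le_trans (ltW (archi_boundP _)))//; first by rewrite invr_ge0 ltW.
  by rewrite ler_nat.
- by exists (F n), A; split.
Qed.

Lemma regular_setC (A : set X) : regular_set A -> regular_set (~` A).
Proof.
move=> rA e e0; have [F [Q [cF oO FA AO h]]] := rA e e0.
exists (~` Q), (~` F); split.
- exact: open_closedC.
- exact: closed_openC.
- exact: subsetC.
- exact: subsetC.
- by rewrite (_ : ~` F `\` ~` Q = Q `\` F)// !setDE setCK setIC.
Qed.

(** An infinite union of closed sets need not be closed, so only finitely many inner sets are kept
    and continuity from above on W controls the rest. The errors e / 2 / 2^(n+1) sum to at most e /
    2. *)
Lemma regular_bigcup (A : nat -> set X) : (forall n, regular_set (A n)) ->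
  regular_set (\bigcup_n A n).
Proof.
move=> rA e e0.
have e2' : (0 < e / 2)%R by rewrite divr_gt0.
have e2 n : (0 < e / 2 / (2 ^ n.+1)%:R :> R)%R.
  by rewrite divr_gt0 ?divr_gt0// ltr0n expn_gt0.
have H n : exists p : set X * set X, [/\ closed p.1, open p.2, p.1 `<=` A n,
    A n `<=` p.2 & mu (W `&` (p.2 `\` p.1)) < (e / 2 / (2 ^ n.+1)%:R)%:E].
  by have [F [Q hFO]] := rA n _ (e2 n); exists (F, Q).
have [p pP] := choice H.
pose Q := \bigcup_n (p n).2.
have oO : open Q by apply: bigcup_open => n _; have [] := pP n.
pose G n := \big[setU/set0]_(i < n) (p i).1.
have cG n : closed (G n).
  rewrite /G; elim: n => [|n IH]; first by rewrite big_ord0; exact: closed0.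
  by rewrite big_ord_recr; apply: closedU => //; have [] := pP n.
have mW' n : mu.-cara.-measurable (W `&` (Q `\` G n)).
  by apply: measurableI => //; apply: measurableD; [exact: open_borel|exact: closed_borel].
have [| | | |n hn] := @mu_cvg0 W (fun n => W `&` (Q `\` G n)) Wfin mW _ _ _ e.
- exact: mW'.
- move=> n y [Wy [Oy nG]]; split => //; split => // h; apply: nG.
  by rewrite /G big_ord_recr; left.
- exact: subIsetl.
- have sub : \bigcap_n (W `&` (Q `\` G n)) `<=`
      \bigcup_n (W `&` ((p n).2 `\` (p n).1)).
    move=> y h; have [Wy [[k _ Ok] _]] := h 0%N I; exists k => //; split => //.
    split => // pk; have [_ [_]] := h k.+1 I; apply.
    by rewrite /G big_ord_recr; right.
  apply: (le_lt_trans (le_outer_measure mu _ _ sub)).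
  apply: (le_lt_trans (outer_measure_sigma_subadditive mu _)).
  apply: (@le_lt_trans _ _ (e / 2)%:E); last by rewrite lte_fin; lra.
  apply: (le_trans _ (epsilon_trick0 xpredT (ltW e2'))).
  by apply: lee_nneseries => [k _ _|k _];
    [exact: outer_measure_ge0|have [_ _ _ _ /ltW] := pP k].
- exists (G n), Q; split => //.
  + move=> y; rewrite /G; rewrite -(bigcup_mkord n (fun i => (p i).1)) => -[k _ pk].
    by exists k => //; have [_ _ h _ _] := pP k; exact: h.
  + by move=> y [k _ Ak]; exists k => //; have [_ _ _ h _] := pP k; exact: h.
Qed.

End Regularity.

(** * The density theorem for doubling measures *)

Section Density.
Context (R : realType) (X : completeMetricType R).
Context (mu : {outer_measure set X -> \bar R}).
Hypothesis mu_reg : borel_regular mu.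
Variable Cd : R.
Hypothesis Cd1 : (1 <= Cd)%R.
Hypothesis mu_dbl : forall (x : X) (r : R), (0 < r)%R ->
  [/\ 0 < mu (ball x (2 * r)%R),
      mu (ball x (2 * r)%R) <= Cd%:E * mu (ball x r) &
      mu (ball x r) < +oo].
Local Notation m := (cara_measure mu).
Local Notation Xm := (caratheodory_type mu).
Let mu_borel := mu_reg.1.
Let mB := measurable_ball_cara mu_borel.

Lemma borel_regular_set (W A : set X) : mu.-cara.-measurable W ->
  mu W < +oo -> borel_set A -> regular_set mu W A.
Proof.
move=> mW Wfin; apply: smallest_sub; last first.
  by move=> Q oQ; exact: open_regular.
split.
- by apply: open_regular => //; exact: open0.
- by move=> B rB; rewrite setTD; exact: regular_setC.
- by move=> F rF; apply: regular_bigcup.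
Qed.

(** A Borel hull of A exceeds A by a null set only, because A is measurable of finite measure;
    regularity of the hull then yields an open set, which is cut down to W. *)
Lemma open_approx (W A : set X) (e : R) : open W -> mu W < +oo ->
  mu.-cara.-measurable A -> A `<=` W -> (0 < e)%R ->
  exists Q : set X, [/\ open Q, A `<=` Q, Q `<=` W & mu (Q `\` A) < e%:E].
Proof.
move=> oW Wfin mA AW e0.
have mW : mu.-cara.-measurable W by apply: mu_borel; exact: sub_sigma_algebra.
have [B [bB AB eAB]] := mu_reg.2 A.
have Afin : mu A \is a fin_num.
  rewrite ge0_fin_numE ?outer_measure_ge0//.
  exact: le_lt_trans (le_outer_measure mu _ _ AW) Wfin.
have BA0 : mu (B `\` A) = 0.
  have h := mA B; rewrite (setIidr AB) -setDE -eAB in h.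
  by rewrite -[LHS](addeK _ Afin) [mu (B `\` A) + _]addeC -h subee.
have [F [Q [cF oQ FB BQ h]]] := borel_regular_set mW Wfin bB e0.
exists (Q `&` W); split.
- exact: openI.
- by move=> x Ax; split; [apply/BQ/AB|exact: AW].
- exact: subIsetr.
- apply: le_lt_trans h.
  rewrite -[leRHS]adde0 -BA0.
  apply: le_trans (outer_measureU2 mu _ _); apply: le_outer_measure.
  move=> x [[Qx Wx] nA]; have [Fx|nF] := pselect (F x); [right|left]; split => //.
  exact: FB.
Qed.

Lemma meas_interiorP (E : set X) (x : X) : meas_interior mu E x <->
  forall k : R, (0 < k)%R -> exists2 d : R, (0 < d)%R &
    forall r, (0 < r < d)%R -> mu (ball x r `\` E) <= k%:E * mu (ball x r).
Proof.
have Bfin r : mu (ball x r) \is a fin_num by exact: (mu_ball_fin mu_dbl).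
have Bgt0 r : (0 < r)%R -> (0 < fine (mu (ball x r)))%R.
  move=> r0; rewrite fine_gt0// (mu_ball_lty mu_dbl) andbT.
  exact: (mu_ball_gt0 mu_dbl).
have Dfin r : mu (ball x r `\` E) \is a fin_num.
  rewrite ge0_fin_numE ?outer_measure_ge0//.
  exact: le_lt_trans (le_outer_measure mu _ _ (@subDsetl _ _ _)) (mu_ball_lty mu_dbl _ _).
have ratioE r : (0 < r)%R -> mu (ball x r `\` E) / mu (ball x r) =
   (fine (mu (ball x r `\` E)) / fine (mu (ball x r)))%:E.
  move=> r0; rewrite -{1}(fineK (Bfin r)) -{1}(fineK (Dfin r)).
  by rewrite inver gt_eqF ?Bgt0// -EFinM.
have leE r (k : R) : (0 < r)%R -> (mu (ball x r `\` E) <= k%:E * mu (ball x r)) =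
   (fine (mu (ball x r `\` E)) / fine (mu (ball x r)) <= k)%R.
  move=> r0; rewrite -{1}(fineK (Bfin r)) -{1}(fineK (Dfin r)) -EFinM lee_fin.
  by rewrite ler_pdivrMr// Bgt0.
split.
- rewrite /meas_interior /= => /fine_cvgP[_ /cvgrPdist_le cv] k k0.
  have := cv k k0; rewrite near_withinE -nbhs_ballE => -[d /= d0 hd].
  exists d => // r /andP[r0 rd]; rewrite leE//.
  have := hd r; rewrite /ball/= sub0r normrN (gtr0_norm r0) => /(_ rd r0).
  rewrite sub0r normrN ratioE//= ger0_norm//.
  by rewrite divr_ge0// fine_ge0// outer_measure_ge0.
- move=> H; apply/fine_cvgP; split.
    near=> r; rewrite ratioE//.
  apply/cvgrPdist_le => k k0; have [d d0 hd] := H k k0.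
  near=> r.
  have r0 : (0 < r)%R by [].
  rewrite sub0r normrN /= ratioE//= ger0_norm; last first.
    by rewrite divr_ge0// fine_ge0// outer_measure_ge0.
  rewrite -leE//; apply: hd; rewrite r0/=.
  by near: r; exact: nbhs_right_lt.
Unshelve. all: by end_near. Qed.

Let low_density (M : set X) (k : R) : set X :=
  [set x | M x /\ forall d : R, (0 < d)%R -> exists r, (0 < r < d)%R /\
    k%:E * mu (ball x r) < mu (ball x r `\` M)].

(** Choose an open Q containing M with mu (Q \ M) < e. Each point of the set is the centre of a ball
    in Q more than the fraction k of which lies outside M, so a disjoint Vitali family of such balls
    has total measure at most e / k. The enlargement factor is 4 rather than 3, so that it is two
    doublings and costs Cd^2. *)
Let low_density_null (x0 : X) (r0 : R) (M : set X) (k : R) :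
  mu.-cara.-measurable M -> M `<=` ball x0 r0 -> (0 < k)%R ->
  mu (low_density M k) = 0.
Proof.
move=> mM MW k0; set S := low_density M k; set W := ball x0 r0.
have CdO : (0 < Cd)%R by rewrite (lt_le_trans _ Cd1).
suff H (e : R) : (0 < e)%R -> mu S <= (Cd ^+ 2 / k * e)%:E.
  apply/eqP; rewrite eq_le outer_measure_ge0 andbT; apply/lee_addgt0Pr => e e0.
  have q0 : (0 < Cd ^+ 2 / k)%R by rewrite divr_gt0// exprn_gt0.
  have := H (e / (Cd ^+ 2 / k))%R; rewrite add0e [(_ * (e / _))%R]mulrC divfK ?gt_eqF//.
  by apply; rewrite divr_gt0.
move=> e0.
have [Q [oQ MQ QW hQ]] := open_approx (open_ball x0 r0) (mu_ball_lty mu_dbl x0 r0) mM MW e0.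
have HS x : exists r : R, S x -> [/\ (0 < r <= 1)%R, ball x r `<=` Q &
    k%:E * mu (ball x r) < mu (ball x r `\` M)].
  have [Sx|] := pselect (S x); last by exists 0%R.
  have [Mx hx] := Sx.
  have := oQ; rewrite openE => /(_ _ (MQ _ Mx)); rewrite /interior -nbhs_ballE.
  move=> [d /= d0 hd].
  have [|r [/andP[r_0 rd] hr]] := hx (Num.min 1 d)%R; first by rewrite lt_min ltr01.
  exists r => _; move: rd; rewrite lt_min => /andP[r1 rd]; split => //.
  - by rewrite r_0 ltW.
  - by move=> y yr; apply: hd; move: yr; apply: le_ball; exact: ltW.
have [rho rhoP] := choice HS.
have [|D [DS disj cov]] := @vitali_covering R X S rho 1%R.
  by move=> x /rhoP[].
have rho0 x : D x -> (0 < rho x)%R by move=> /DS/rhoP[/andP[]].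
(* Disjoint balls of radius at least 1 / (n + 1) have separated centres in a bounded set, so for
   each n there are finitely many. *)
have cD : countable D.
  pose Dn n := D `&` [set x | (n.+1%:R^-1 <= rho x)%R].
  have DE : D = \bigcup_n Dn n.
    apply/seteqP; split => x; last by move=> [n _ []].
    move=> Dx; exists (Num.bound (rho x)^-1) => //; split => //=.
    rewrite -[leRHS]invrK lef_pV2 ?posrE ?invr_gt0 ?rho0//.
    rewrite (le_trans (ltW (archi_boundP _)))//; first by rewrite invr_ge0 ltW ?rho0.
    by rewrite ler_nat.
  rewrite DE; apply: bigcup_countable => // n _; apply: finite_set_countable.
  have R0 : (0 < `|r0| + 1)%R by rewrite ltr_wpDl.
  pose N := Num.bound ((`|r0| + 1) * n.+1%:R)%R.
  apply: (@bound_finite_set _ _ (Num.bound (Cd ^+ (N + 3)))%R) => s us sD.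
  have := @separated_size R X mu mu_borel Cd Cd1 mu_dbl N x0 (`|r0| + 1)%R s R0 us.
  move=> h; rewrite -(ler_nat R) (le_trans (h _ _))//.
  - move=> z /sD[Dz _]; have : W z.
      by apply: QW; have [_ + _] := rhoP _ (DS _ Dz); apply; exact/ballxx/rho0.
    by apply: le_ball; have := ler_norm r0; lra.
  - move=> z z' /sD[Dz hz] /sD[Dz' hz'] zz'.
    have zz'd : (n.+1%:R^-1 <= mdist z z')%R.
      rewrite leNgt; apply/negP => h'; move/eqP: zz'; apply.
      apply: (disj z z' z' Dz Dz'); last exact/ballxx/rho0.
      by rewrite ballEmdist/= (lt_le_trans h').
    apply: (@le_trans _ _ (2 ^+ N * n.+1%:R^-1)%R); last by rewrite ler_wpM2l ?exprn_ge0.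
    rewrite ler_pdivlMr// (le_trans (ltW (archi_boundP _)))//.
    by rewrite -/N -natrX ler_nat ltnW// ltn_expl.
  - by rewrite ltW// archi_boundP// exprn_ge0// ltW.
(* The injection f numbers the selected balls; [A n] and [B n] are empty if n is not the number of a
   ball. *)
have /countable_injP[f finj] := cD.
pose A n := \bigcup_(x in D `&` f @^-1` [set n]) ball x (2 ^+ 2 * rho x)%R.
pose B n := \bigcup_(x in D `&` f @^-1` [set n]) (ball x (rho x) `\` M).
have ABcases n : (A n = set0 /\ B n = set0) \/ exists x, [/\ D x,
    A n = ball x (2 ^+ 2 * rho x)%R & B n = ball x (rho x) `\` M].
  have [[x [Dx fx]]|nx] := pselect (exists x, D x /\ f x = n).
    have DE : D `&` f @^-1` [set n] = [set x].
      apply/seteqP; split => y.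
        by move=> [Dy fy]; apply: finj; rewrite ?inE// fx.
      by move=> ->.
    by right; exists x; rewrite /A /B DE !bigcup_set1.
  left; suff E : D `&` f @^-1` [set n] = set0 by rewrite /A /B E !bigcup_set0.
  by apply/seteqP; split => // y [Dy fy]; apply: nx; exists y.
have mBn n : mu.-cara.-measurable (B n).
  have [[_ ->]|[x [_ _ ->]]] := ABcases n; first exact: measurable0.
  by apply: measurableD => //; exact: mB.
have AB n : mu (A n) <= (Cd ^+ 2 / k)%:E * mu (B n).
  have [[-> ->]|[x [Dx -> ->]]] := ABcases n.
    by rewrite !outer_measure0 mule0.
  apply: (le_trans (doubling_iter Cd1 mu_dbl 2 x (rho0 _ Dx))).
  have [_ _ /ltW h] := rhoP _ (DS _ Dx).
  rewrite [(Cd ^+ 2 / k)%:E]EFinM -muleA.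
  apply: lee_wpmul2l; first by rewrite lee_fin exprn_ge0// ltW.
  by rewrite lee_pdivlMl.
have SA : S `<=` \bigcup_n A n.
  move=> x /cov[y Dy yx]; exists (f y) => //; exists y; first by [].
  by move: yx; apply: le_ball; rewrite ler_pM2r ?rho0//; lra.
apply: (le_trans (le_outer_measure mu _ _ SA)).
apply: (le_trans (outer_measure_sigma_subadditive mu _)).
apply: (@le_trans _ _ (\sum_(n <oo) ((Cd ^+ 2 / k)%:E * mu (B n)))).
  by apply: lee_nneseries => // n _ _; exact: outer_measure_ge0.
have q0 : (0 <= Cd ^+ 2 / k)%R by rewrite divr_ge0 ?exprn_ge0// ltW.
rewrite nneseriesZl; last by move=> n _; exact: outer_measure_ge0.
rewrite [(_ * e)%:E]EFinM; apply: lee_wpmul2l; first by rewrite lee_fin.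
have tB : trivIset setT B.
  apply/trivIsetP => i j _ _ ij; apply/seteqP; split => // z [].
  move=> [x [Dx fx] [xz _]] [y [Dy fy] [yz _]].
  move/eqP: ij; apply; rewrite -[i]fx -[j]fy; congr f.
  exact: disj xz yz.
have <- : m (\bigcup_n B n) = \sum_(n <oo) m (B n).
  by apply: measure_semi_bigcup => //; exact: bigcupT_measurable.
apply: le_trans (ltW hQ); apply: le_outer_measure => z [n _ [x [Dx _] [xz nM]]].
by split => //; have [_ h _] := rhoP _ (DS _ Dx); exact: h.
Qed.

Lemma doubling_lebesgue_density (x0 : X) (r0 : R) (M : set X) :
  mu.-cara.-measurable M -> M `<=` ball x0 r0 ->
  mu (M `\` meas_interior mu M) = 0.
Proof.
move=> mM MW; apply/eqP; rewrite eq_le outer_measure_ge0 andbT.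
have sub : M `\` meas_interior mu M `<=` \bigcup_n low_density M n.+1%:R^-1.
  move=> x [Mx nI]; apply: contrapT => H; apply: nI; apply/meas_interiorP => k k0.
  apply: contrapT => Hk; apply: H; exists (Num.bound k^-1) => //; split => // d d0.
  apply: contrapT => Hr; apply: Hk; exists d => // r rd.
  rewrite leNgt; apply/negP => h; apply: Hr; exists r; split => //.
  apply: le_lt_trans h; apply: lee_wpmul2r; first exact: outer_measure_ge0.
  rewrite lee_fin -[leRHS]invrK lef_pV2 ?posrE ?invr_gt0//.
  rewrite (le_trans (ltW (archi_boundP _)))//; first by rewrite invr_ge0 ltW.
  by rewrite ler_nat.
apply: (le_trans (le_outer_measure mu _ _ sub)).
apply: (le_trans (outer_measure_sigma_subadditive mu _)).
rewrite eseries0// => n _ _; apply: low_density_null mM MW _.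
by rewrite invr_gt0.
Qed.

End Density.

(** * Density of the complement of the minimizer *)

Section DensityEstimate.
Context (R : realType) (X : completeMetricType R).
Context (mu : {outer_measure set X -> \bar R}).
Hypothesis mu_reg : borel_regular mu.
Variable Cd : R.
Hypothesis Cd1 : (1 <= Cd)%R.
Hypothesis mu_dbl : forall (x : X) (r : R), (0 < r)%R ->
  [/\ 0 < mu (ball x (2 * r)%R),
      mu (ball x (2 * r)%R) <= Cd%:E * mu (ball x r) &
      mu (ball x r) < +oo].
Local Notation m := (cara_measure mu).
Local Notation Xm := (caratheodory_type mu).
Local Notation measurable_on u := (measurable_fun [set: Xm] (u : Xm -> R)).
Let mu_borel := mu_reg.1.
Let mB := measurable_ball_cara mu_borel.
Local Notation V A := (fine (mu A)).

Lemma mu_fin_sub (x : X) (r : R) (A : set X) : A `<=` ball x r ->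
  mu A \is a fin_num.
Proof.
move=> Ax; rewrite ge0_fin_numE ?outer_measure_ge0//.
exact: le_lt_trans (le_outer_measure mu _ _ Ax) (mu_ball_lty mu_dbl _ _).
Qed.

Variables (K U D : set X) (alpha : R).
Hypothesis mD : mu.-cara.-measurable D.
Hypothesis alpha_le : forall u c, competitor mu K U u ->
  approximable mu u c -> (alpha <= c)%R.
Hypothesis cD : competitor mu K U \1_D.
Hypothesis aD : approximable mu (\1_D : X -> R) alpha.

Let mD1 : measurable_on (\1_D : X -> R).
Proof. exact: (@measurable_indic _ Xm). Qed.

Let D01 : unit_valued (\1_D : X -> R).
Proof. by have [] := cD. Qed.

Lemma competitor_blend (eta : X -> R) : continuous eta ->
  (forall x, (0 <= eta x <= 1)%R) -> (forall x, ~ U x -> eta x = 0%R) ->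
  competitor mu K U (blend eta \1_D).
Proof.
move=> ceta e01 eU; have [_ _ DK DU] := cD; split.
- have me := continuous_cara mu_borel ceta.
  by apply: measurable_funD => //; apply: measurable_funM => //; exact: measurable_funB.
- move=> x; rewrite /blend; have /andP[? ?] := e01 x; have /andP[h1 h2] := D01 x.
  have h3 : (0 <= (1 - eta x) * \1_D x)%R by rewrite mulr_ge0//; lra.
  have h4 : ((1 - eta x) * \1_D x <= 1 - eta x)%R by rewrite ler_piMr//; lra.
  by apply/andP; split; lra.
- by move=> x Kx; rewrite /blend DK//; ring.
- by move=> x Ux; rewrite /blend DU// eU//; ring.
Qed.

(* Comparing D with the competitor 1_D + eta (1 - 1_D), where eta cuts off
   between the balls of radius 3s/4 and s. *)
Lemma energy_bound (y : X) (s : R) : (0 < s)%R -> ball y s `<=` U ->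
  forall r sigma : R, (0 < sigma)%R -> exists w g,
  [/\ lip_loc w, unit_valued w, upper_gradient g (EFin \o w),
    L1dist mu r w \1_D <= sigma%:E &
    \int[m]_(x in ball y (3 / 4 * s)%R) g x <=
      (8 / s * V (ball y s `\` D) + sigma)%:E].
Proof.
move=> s0 yU r sigma sigma0.
(* The cutoff falls from 1 to 0 between the radii 3s/4 and 7s/8, hence the slope 8 / s. The room
   from 7s/8 to s is the gap in [upper_gradient_blend]. *)
pose C := (8 / s)%R; have C0 : (0 < C)%R by rewrite divr_gt0.
pose eta := cutoff y (7 / 8 * s)%R C.
have eta01 x : (0 <= eta x <= 1)%R by exact: clamp01.
have Leta x z : (`|eta x - eta z| <= C * mdist x z)%R by apply: cutoff_lip; exact: ltW.
have eta0 x : (7 / 8 * s <= mdist y x)%R -> eta x = 0%R.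
  by move=> h; apply: cutoff0 => //; exact: ltW.
have ceta : continuous eta by apply: lip_loc_continuous; apply: cutoff_lip_loc; exact: ltW.
have eta1 x : ball y (3 / 4 * s)%R x -> eta x = 1%R.
  rewrite ballEmdist/= => h; apply: cutoff1; rewrite /C mulrAC ler_pdivlMr//; lra.
have cW : competitor mu K U (blend eta \1_D).
  apply: competitor_blend => // x nU; apply: eta0; rewrite leNgt; apply/negP => h.
  by apply: nU; apply: yU; rewrite ballEmdist/=; lra.
have s40 : (0 < sigma / 4)%R by rewrite divr_gt0.
(* Minimality of alpha: at some tolerance e0 every approximant of the blend has energy above alpha -
   sigma / 4 + e0. *)
have /existsNP[e0 /not_implyP[e00 He0]] :
    ~ approximable mu (blend eta \1_D) (alpha - sigma / 4).
  by move=> /(alpha_le cW); lra.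
have a0 := approximable_ge0 aD.
have Bfin := mu_ball_fin mu_dbl y s.
pose M := V (ball y s); have M0 : (0 <= M)%R by rewrite fine_ge0// outer_measure_ge0.
have BDfin : mu (ball y s `\` D) \is a fin_num by exact: mu_fin_sub (@subDsetl _ _ _).
pose d := V (ball y s `\` D); have d0 : (0 <= d)%R by rewrite fine_ge0// outer_measure_ge0.
pose t := (Num.min e0 (Num.min 1 (sigma / 4 / (1 + C))))%R.
have t0 : (0 < t)%R by rewrite !lt_min e00 ltr01 divr_gt0//; lra.
have te0 : (t <= e0)%R by rewrite ge_min lexx.
have t1 : (t <= 1)%R by rewrite /t !ge_min lexx !orbT.
have tC : (t * (1 + C) <= sigma / 4)%R.
  by rewrite -ler_pdivlMr ?addr_gt0// /t !ge_min lexx !orbT.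
have tsigma : (t <= sigma)%R.
  have : (t * 1 <= t * (1 + C))%R by rewrite ler_pM2l//; lra.
  lra.
pose Q := (alpha + 1 + C * M + 1)%R.
have CM0 : (0 <= C * M)%R by rewrite mulr_ge0// ltW.
have Q0 : (0 < Q)%R by rewrite /Q; lra.
pose eps := (sigma / 4 / Q)%R; have eps0 : (0 < eps)%R by rewrite divr_gt0.
have epsQ : (eps * (alpha + t + C * M) <= sigma / 4)%R.
  rewrite /eps mulrAC ler_pdivrMr// ler_wpM2l ?(ltW s40)// /Q; lra.
pose r' := (Num.max r (Num.max e0^-1 (mdist (point : X) y + s)))%R.
have rr' : (r <= r')%R by rewrite le_max lexx.
have er' : (e0^-1 <= r')%R by rewrite !le_max lexx orbT.
have yr' : ball y s `<=` ball (point : X) r'.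
  by apply: ball_subset_ball; rewrite !le_max lexx !orbT.
have [w [g [Lw w01 Ug Dw Ig]]] := approximable_ball mu_borel mD1 D01 aD r' t0.
have mw := lip_loc_measurable mu_borel Lw.
have Lbw : lip_loc (blend eta w).
  by apply: blend_lip_loc => //; apply: cutoff_lip_loc; exact: ltW.
have [mg g0 _] := Ug; have mgX := borel_fun_cara mu_borel mg.
exists w, g; split => //.
  apply: le_trans (L1dist_mono mu_borel mw mD1 rr') _.
  by rewrite (le_trans Dw)// lee_fin.
pose G := fun x : X => (1 - eta x + eps)%:E * g x +
     (C * (1 - w x + eps))%:E * (\1_(ball y s) x)%:E.
have UG : upper_gradient G (EFin \o blend eta w).
  apply: (@upper_gradient_blend _ _ y (7 / 8 * s)%R) => //.
  - exact: ltW.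
  - lra.
  - exact: lip_loc_continuous.
have [mG G0 _] := UG; have mGX := borel_fun_cara mu_borel mG.
have meta : measurable_fun [set: Xm] ((fun x => (eta x)%:E * g x) : Xm -> \bar R).
  apply: emeasurable_funM => //; apply/measurable_EFinP.
  exact: (continuous_cara mu_borel ceta).
have eg0 x : 0 <= (eta x)%:E * g x.
  by rewrite mule_ge0// lee_fin; case/andP: (eta01 x).
have mind (A : set X) : mu.-cara.-measurable A ->
    measurable_fun [set: Xm] ((fun x => (\1_A x)%:E) : Xm -> \bar R).
  by move=> mA; apply/measurable_EFinP; exact: (@measurable_indic _ Xm).
have lowG : (alpha - sigma / 4)%:E <= \int[m]_x G x.
  rewrite leNgt; apply/negP => hG; apply: He0.
  exists (blend eta w), G; split => //.
  - apply: (@le_trans _ _ t%:E); last by rewrite lee_fin.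
    apply: le_trans Dw; apply: le_trans (L1dist_mono mu_borel mw mD1 er').
    apply: L1dist_contraction => //.
    + exact: lip_loc_measurable.
    + by have [] := cW.
    + move=> x; rewrite /blend opprD addrACA subrr add0r -mulrBr normrM.
      by rewrite ler_piMl// ger0_norm; have := eta01 x; lra.
  - by apply: ltW; rewrite (lt_trans hG)// lte_fin ltrDl.
(* Adding eta g to the gradient G of the blend restores (1 + eps) g, with integral about alpha, plus
   the cutoff term. Subtracting the lower bound [lowG] leaves a bound for the integral of eta g,
   hence for that of g over the ball where eta = 1. *)
have sumG : \int[m]_x G x + \int[m]_x ((eta x)%:E * g x) <=
    ((1 + eps) * (alpha + t) + C * (d + t + eps * M))%:E.
  rewrite -ge0_integralD//.
  rewrite (eq_integral (fun x : Xm => (1 + eps)%:E * g x +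
      C%:E * ((1 - w x + eps)%:E * (\1_(ball y s) x)%:E))); last first.
    move=> x _; rewrite /G addeAC -ge0_muleDl ?lee_fin; last 2 first.
    - by have := eta01 x; lra.
    - by case/andP: (eta01 x).
    rewrite -EFinD [in RHS]muleA -EFinM; congr (_%:E * _ + _); ring.
  have m1 : measurable_fun [set: Xm]
      ((fun x => (1 - w x + eps)%:E * (\1_(ball y s) x)%:E) : Xm -> \bar R).
    apply: emeasurable_funM; last exact: mind.
    apply/measurable_EFinP; apply: measurable_funD => //; exact: measurable_funB.
  have p1 x : 0 <= (1 - w x + eps)%:E * (\1_(ball y s) x)%:E.
    by rewrite mule_ge0// lee_fin; have := w01 x; lra.
  rewrite ge0_integralD//; last 4 first.
  - by move=> x _; rewrite mule_ge0// lee_fin; lra.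
  - exact: measurable_funeM.
  - by move=> x _; rewrite mule_ge0// lee_fin ltW.
  - exact: measurable_funeM.
  rewrite !ge0_integralZl//; [|by rewrite lee_fin ltW|by rewrite lee_fin; lra].
  rewrite [leRHS]EFinD; apply: leeD.
    rewrite [((1 + eps) * _)%:E]EFinM.
    by apply: lee_wpmul2l => //; rewrite lee_fin; lra.
  rewrite [(C * _)%:E]EFinM; apply: lee_wpmul2l; first by rewrite lee_fin ltW.
  have mDC := mind _ (measurableC mD).
  have mdist_ : measurable_fun [set: Xm] ((fun x => (`|w x - \1_D x|)%:E) : Xm -> \bar R).
    apply/measurable_EFinP; apply: measurableT_comp => //; exact: measurable_funB.
  have msum : measurable_fun [set: Xm]
      ((fun x => (\1_(~` D) x)%:E + (`|w x - \1_D x|)%:E) : Xm -> \bar R).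
    exact: emeasurable_funD.
  apply: (@le_trans _ _ (\int[m]_(x in ball y s)
     ((\1_(~` D) x)%:E + (`|w x - \1_D x|)%:E + eps%:E))).
    rewrite [leRHS]integral_mkcond; apply: ge0_le_integral => //.
    - apply/(measurable_restrictT _ (mB y s)).
      by apply: measurable_funTS; exact: emeasurable_funD.
    - move=> x _; rewrite /patch indicE; case: ifPn => xB; last by rewrite mule0.
      rewrite mule1 -!EFinD lee_fin !indicE in_setC.
      have /andP[? ?] := w01 x.
      have := ler_norm (w x - 1)%R; have := ler_norm (1 - w x)%R.
      by case: (x \in D) => /=; rewrite ?(distrC 1%R) ?subr0; have := normr_ge0 (w x); lra.
  have indic_ge0 x : 0 <= (\1_(~` D) x : R)%:E by rewrite lee_fin.
  have dist_ge0 x : 0 <= (`|w x - \1_D x|)%:E by rewrite lee_fin.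
  have epsE0 : 0 <= eps%:E by rewrite lee_fin ltW.
  have cm : measurable_fun (ball y s : set Xm) ((fun=> eps%:E) : Xm -> \bar R).
    exact: measurable_cst.
  have em : forall f : Xm -> \bar R, measurable_fun [set: Xm] f ->
      measurable_fun (ball y s : set Xm) f by move=> f; exact: measurable_funTS.
  rewrite (ge0_integralD m (mB y s) (fun x _ => adde_ge0 (indic_ge0 x) (dist_ge0 x))
    (em _ msum) (fun _ _ => epsE0) cm).
  rewrite (ge0_integralD m (mB y s) (fun x _ => indic_ge0 x) (em _ mDC)
    (fun x _ => dist_ge0 x) (em _ mdist_)).
  rewrite integral_indic; [|exact: mB|exact: measurableC].
  rewrite setIC -setDE integral_cst; last exact: mB.
  rewrite !EFinD [(eps * M)%:E]EFinM /d /M !fineK//; apply: leeD => //; apply: leeD => //.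
  apply: le_trans Dw; apply: ge0_subset_integral => //.
  - exact: measurable_funTS.
apply: (@le_trans _ _ (\int[m]_x ((eta x)%:E * g x))).
  rewrite integral_mkcond; apply: ge0_le_integral => //.
  - by move=> x _; rewrite /patch; case: ifPn.
  - by apply/(measurable_restrictT _ (mB y _)); exact: measurable_funTS.
  - move=> x _; rewrite /patch; case: ifPn => // /set_mem /eta1 ->.
    by rewrite mul1e.
apply: le_trans (lee_sub_of_add _ _ sumG lowG) _.
- exact: integral_ge0.
- by apply: integral_ge0.
- rewrite lee_fin -/C -/d.
  have -> : ((1 + eps) * (alpha + t) + C * (d + t + eps * M) - (alpha - sigma / 4) =
    C * d + t * (1 + C) + eps * (alpha + t + C * M) + sigma / 4)%R by ring.
  lra.
Qed.

Variables (CP lambda : R).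
Hypothesis CP1 : (1 <= CP)%R.
Hypothesis lambda1 : (1 <= lambda)%R.
Hypothesis poincare : forall (x : X) (r : R) u (g : X -> \bar R), (0 < r)%R ->
      L1_loc mu u -> upper_gradient g u ->
      mean mu (fun y => `|u y - mean mu u (ball x r)|) (ball x r) <=
        (CP * r)%:E * mean mu g (ball x (lambda * r)%R).

Lemma L1_loc_bounded (w : X -> R) : measurable_on w -> unit_valued w ->
  L1_loc mu (EFin \o w).
Proof.
move=> mw w01; split; first exact/measurable_EFinP.
move=> x; exists 1%R => //; apply/integrableP; split.
  by apply: measurable_funTS; exact/measurable_EFinP.
apply: (@le_lt_trans _ _ (\int[m]_(y in ball x 1%R) cst 1 y)).
  apply: ge0_le_integral => //.
  - by apply: measurableT_comp => //; apply: measurable_funTS; exact/measurable_EFinP.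
  - by move=> y _ /=; rewrite lee_fin ger0_norm; have := w01 y; lra.
by rewrite integral_cst//= mul1e (mu_ball_lty mu_dbl).
Qed.

(** In passing from averages to integrals, the measure of the smaller ball over that of the larger
    one appears on the right; it is at most 1 and is dropped. *)
Lemma poincare_unit (w : X -> R) (g : X -> \bar R) (z : X) (tau : R) :
  (0 < tau)%R -> lip_loc w -> unit_valued w -> upper_gradient g (EFin \o w) ->
  exists c : R, \int[m]_(x in ball z tau) (`|w x - c|)%:E <=
    (CP * tau)%:E * \int[m]_(x in ball z (lambda * tau)%R) g x.
Proof.
move=> tau0 Lw w01 Ug; have mw := lip_loc_measurable mu_borel Lw.
have Lu := L1_loc_bounded mw w01.
have [_ g0 _] := Ug.
have lt0 : (0 < lambda * tau)%R by rewrite mulr_gt0// (lt_le_trans ltr01 lambda1).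
have := poincare z tau0 Lu Ug.
have Bfin r : mu (ball z r) \is a fin_num by exact: (mu_ball_fin mu_dbl).
have Bgt0 r : (0 < r)%R -> (0 < V (ball z r))%R.
  move=> r0; rewrite fine_gt0// (mu_ball_lty mu_dbl) andbT.
  exact: (mu_ball_gt0 mu_dbl).
pose I : \bar R := \int[m]_(x in ball z tau) (w x)%:E.
have If : I \is a fin_num.
  rewrite ge0_fin_numE; last first.
    by apply: integral_ge0 => x _; rewrite lee_fin; case/andP: (w01 x).
  apply: (@le_lt_trans _ _ (\int[m]_(y in ball z tau) cst 1 y)).
    apply: ge0_le_integral => //.
    - by move=> x _; rewrite lee_fin; case/andP: (w01 x).
    - by apply: measurable_funTS; exact/measurable_EFinP.
    - by move=> y _ /=; rewrite lee_fin; case/andP: (w01 y).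
  by rewrite integral_cst//= mul1e (mu_ball_lty mu_dbl).
have mE : mean mu (EFin \o w) (ball z tau) = (fine I / V (ball z tau))%:E.
  by rewrite /mean /= -/I -{1}(fineK If) -(fineK (Bfin tau)) inver gt_eqF ?Bgt0//.
rewrite mE; set c := (fine I / _)%R => h; exists c.
move: h; rewrite /mean /=.
set J := \int[m]_(x in ball z tau) _; set G := \int[m]_(x in ball z (lambda * tau)%R) _.
have G0 : 0 <= G by apply: integral_ge0.
rewrite -(fineK (Bfin tau)) -(fineK (Bfin (lambda * tau)%R)) !inver.
rewrite !gt_eqF ?Bgt0// => h.
have t0 := Bgt0 _ tau0; have l0 := Bgt0 _ lt0.
have tl : (V (ball z tau) <= V (ball z (lambda * tau)))%R.
  apply: fine_le => //; apply: le_outer_measure; apply: le_ball.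
  by rewrite ler_peMl// ltW.
move: h; rewrite lee_pdivrMr// => h.
apply: (le_trans h); rewrite -muleA; apply: lee_wpmul2l.
  by rewrite lee_fin mulr_ge0 ?(le_trans ler01 CP1)// ltW.
rewrite -muleA -[leRHS]mule1; apply: lee_wpmul2l => //.
by rewrite -EFinM lee_fin mulrC ler_pdivrMr// mul1r.
Qed.

(** Since |1 - c| + |c| >= 1 for every c, the integral of |1_D - c| is at least the smaller of the
    measures of the ball inside and outside D; the density assumption makes this the outer one.
    Replacing 1_D by w costs sigma. *)
Lemma poincare_set (w : X -> R) (g : X -> \bar R) (z : X) (tau r sigma : R) :
  (0 < tau)%R -> lip_loc w -> unit_valued w -> upper_gradient g (EFin \o w) ->
  ball z tau `<=` ball (point : X) r -> L1dist mu r w \1_D <= sigma%:E ->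
  (V (ball z tau `\` D) <= 2^-1 * V (ball z tau))%R ->
  mu (ball z tau `\` D) <= sigma%:E +
    (CP * tau)%:E * \int[m]_(x in ball z (lambda * tau)%R) g x.
Proof.
move=> tau0 Lw w01 Ug zr Dw half; have mw := lip_loc_measurable mu_borel Lw.
have [c hc] := poincare_unit z tau0 Lw w01 Ug.
have mBD : mu.-cara.-measurable (ball z tau `\` D) by exact: measurableD.
have mBI : mu.-cara.-measurable (ball z tau `&` D) by exact: measurableI.
have mdist_ (f f' : X -> R) (A : set X) : measurable_on f -> measurable_on f' ->
    measurable_fun (A : set Xm) ((fun x => (`|f x - f' x|)%:E) : Xm -> \bar R).
  move=> mf mg'; apply: measurable_funTS; apply/measurable_EFinP.
  by apply: measurableT_comp => //; exact: measurable_funB.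
have mc : measurable_on (fun=> c) by exact: measurable_cst.
have Bfin := mu_ball_fin mu_dbl z tau.
have Dfin : mu (ball z tau `\` D) \is a fin_num by exact: mu_fin_sub (@subDsetl _ _ _).
have Ifin : mu (ball z tau `&` D) \is a fin_num by exact: mu_fin_sub (@subIsetl _ _ _).
have Vsum : (V (ball z tau) = V (ball z tau `&` D) + V (ball z tau `\` D))%R.
  by rewrite -fineD//; congr fine; rewrite setDE; exact: mD.
have D0 : (0 <= V (ball z tau `\` D))%R by rewrite fine_ge0// outer_measure_ge0.
apply: (@le_trans _ _ (\int[m]_(x in ball z tau) (`|\1_D x - c|)%:E)).
  have -> : ball z tau = (ball z tau `&` D) `|` (ball z tau `\` D).
    by rewrite setUIDK.
  rewrite (_ : ((_ `&` _) `|` _) `\` D = ball z tau `\` D); last by rewrite setUIDK.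
  rewrite ge0_integral_setU//; last 2 first.
  - exact: mdist_.
  - by apply/disj_set2P/seteqP; split => // x [[_ ?] []].
  rewrite (eq_integral (cst (`|1 - c|)%:E)); last first.
    by move=> x /set_mem[_ Dx]; rewrite indicE mem_set.
  rewrite [X in _ + X](eq_integral (cst (`|c|)%:E)); last first.
    by move=> x /set_mem[_ Dx]; rewrite indicE memNset// sub0r normrN.
  rewrite !integral_cst//= -(fineK Dfin) -(fineK Ifin) -!EFinM -EFinD lee_fin.
  have h1 : (1 <= `|1 - c| + `|c|)%R.
    have := ler_normD (1 - c)%R c; rewrite subrK normr1; exact.
  have h2 : (V (ball z tau `\` D) <= V (ball z tau `&` D))%R by lra.
  apply: (@le_trans _ _ ((`|1 - c| + `|c|) * V (ball z tau `\` D))%R).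
    by rewrite ler_peMl.
  by rewrite mulrDl lerD2r ler_wpM2l.
apply: (@le_trans _ _ (\int[m]_(x in ball z tau) ((`|w x - \1_D x|)%:E + (`|w x - c|)%:E))).
  apply: ge0_le_integral => //.
  - exact: mdist_.
  - by apply: emeasurable_funD; exact: mdist_.
  - move=> x _; rewrite -EFinD lee_fin (distrC (w x)).
    by rewrite (le_trans _ (ler_normD _ _))// addrA subrK.
rewrite ge0_integralD//; last 2 first.
- exact: mdist_.
- exact: mdist_.
apply: leeD => //; apply: le_trans Dw; apply: ge0_subset_integral => //.
exact: mdist_.
Qed.

End DensityEstimate.

(** * Persistence of small density under halving of the radius *)

Section DensityImprovement.
Context (R : realType) (X : completeMetricType R).
Context (mu : {outer_measure set X -> \bar R}).
Hypothesis mu_reg : borel_regular mu.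
Variable Cd : R.
Hypothesis Cd1 : (1 <= Cd)%R.
Hypothesis mu_dbl : forall (x : X) (r : R), (0 < r)%R ->
  [/\ 0 < mu (ball x (2 * r)%R),
      mu (ball x (2 * r)%R) <= Cd%:E * mu (ball x r) &
      mu (ball x r) < +oo].
Local Notation m := (cara_measure mu).
Local Notation Xm := (caratheodory_type mu).
Local Notation measurable_on u := (measurable_fun [set: Xm] (u : Xm -> R)).
Let mu_borel := mu_reg.1.
Let mB := measurable_ball_cara mu_borel.
Local Notation V A := (fine (mu A)).

Variables (K U D : set X) (alpha : R).
Hypothesis mD : mu.-cara.-measurable D.
Hypothesis alpha_le : forall u c, competitor mu K U u ->
  approximable mu u c -> (alpha <= c)%R.
Hypothesis cD : competitor mu K U \1_D.
Hypothesis aD : approximable mu (\1_D : X -> R) alpha.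

Variables (CP lambda : R).
Hypothesis CP1 : (1 <= CP)%R.
Hypothesis lambda1 : (1 <= lambda)%R.
Hypothesis poincare : forall (x : X) (r : R) u (g : X -> \bar R), (0 < r)%R ->
      L1_loc mu u -> upper_gradient g u ->
      mean mu (fun y => `|u y - mean mu u (ball x r)|) (ball x r) <=
        (CP * r)%:E * mean mu g (ball x (lambda * r)%R).

Lemma outer_measure_seq_le (s : seq X) (B : X -> set X) (A : set X) :
  A `<=` [set y | exists2 z, z \in s & B z y] ->
  mu A <= \sum_(z <- s) mu (B z).
Proof.
elim: s A => [|z s IH] A HA.
  rewrite big_nil (_ : A = set0) ?outer_measure0//.
  by apply/seteqP; split => // y /HA[].
rewrite big_cons; apply: (@le_trans _ _ (mu (B z) + mu (A `\` B z))).
  apply: le_trans (outer_measureU2 mu _ _); apply: le_outer_measure => y Ay.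
  by have [zy|nzy] := pselect (B z y); [left|right].
apply: leeD => //; apply: IH => y [/HA[z' + z'y] nzy].
by rewrite inE => /orP[/eqP zz'|z's]; [exfalso; apply: nzy; rewrite -zz'|exists z'].
Qed.

Lemma V_le (x : X) (r : R) (A B : set X) : A `<=` B -> B `<=` ball x r ->
  (V A <= V B)%R.
Proof.
move=> AB Bx; apply: fine_le; [apply: (mu_fin_sub mu_dbl (subset_trans AB Bx))| |].
  exact: (mu_fin_sub mu_dbl Bx).
exact: le_outer_measure.
Qed.

Lemma V_ge0 (A : set X) : (0 <= V A)%R.
Proof. by rewrite fine_ge0// outer_measure_ge0. Qed.

Lemma V_doubling k (x : X) (r : R) : (0 < r)%R ->
  (V (ball x (2 ^+ k * r)%R) <= Cd ^+ k * V (ball x r))%R.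
Proof.
move=> r0; have := doubling_iter Cd1 mu_dbl k x r0.
rewrite -(fineK (mu_ball_fin mu_dbl x r)) -(fineK (mu_ball_fin mu_dbl x (2 ^+ k * r)%R)).
by rewrite -EFinM lee_fin.
Qed.

Lemma exists_expr_ge (a : R) : exists k, (a <= 2 ^+ k)%R.
Proof.
exists (Num.bound `|a|); rewrite (le_trans (ler_norm _))//.
rewrite (le_trans (ltW (archi_boundP _)))// -natrX ler_nat ltnW// ltn_expl//.
Qed.

(* Covering the half ball by balls of radius s / 2 ^ j with j large gains the
   factor 1 / Cd needed to keep the density of the complement at most [gamma]. *)
Lemma density_step : exists gamma : R, [/\ (0 < gamma)%R, (gamma <= 2^-1)%R &
  forall (y : X) (s : R), (0 < s)%R -> ball y s `<=` U ->
    (V (ball y s `\` D) <= gamma * V (ball y s))%R ->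
    (V (ball y (s / 2) `\` D) <= gamma * V (ball y (s / 2)))%R].
Proof.
have Cd0 : (0 < Cd)%R by rewrite (lt_le_trans _ Cd1).
have CP0 : (0 < CP)%R by rewrite (lt_le_trans _ CP1).
have l0 : (0 < lambda)%R by rewrite (lt_le_trans _ lambda1).
have [k hk] := exists_expr_ge lambda.
(* The packing bound for tau-separated centres within 2^k tau >= lambda tau of a point: it limits
   the overlap of the balls of radius lambda tau. *)
pose N := (Cd ^+ (k + 3))%R; have N0 : (0 < N)%R by rewrite exprn_gt0.
(* Two demands on j: the balls of radius lambda tau must stay in the ball of radius 3s/4, and 2^j
   must absorb the energy constant 8, the Poincare constant, the overlap and one doubling. *)
have [j hj] := exists_expr_ge (4 * lambda + 8 * CP * N * Cd)%R.
have J0 : (0 < 2 ^+ j :> R)%R by rewrite exprn_gt0.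
have CNC : (0 < 8 * CP * N * Cd)%R by rewrite !mulr_gt0.
have j1 : (4 * lambda <= 2 ^+ j)%R by lra.
have j2 : (8 * CP * N * Cd <= 2 ^+ j)%R by lra.
(* Each small ball has at least the fraction 1 / Cd^(j+1) of the measure of the ball of radius s, so
   with this gamma the complement of D fills at most half of every small ball. *)
pose gamma := (2^-1 * (Cd ^+ j.+1)^-1)%R.
have C1 : (1 <= Cd ^+ j.+1)%R by rewrite exprn_ege1.
have gamma0 : (0 < gamma)%R by rewrite mulr_gt0 ?invr_gt0 ?exprn_gt0.
exists gamma; split => //.
  by rewrite /gamma ler_piMr// invf_le1 ?exprn_gt0.
move=> y s s0 yU hs.
pose tau := (s / 2 ^+ j)%R; have tau0 : (0 < tau)%R by rewrite divr_gt0.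
have ltau : (lambda * tau <= s / 4)%R.
  rewrite /tau mulrA ler_pdivrMr//.
  have : (s * (4 * lambda) <= s * 2 ^+ j)%R by rewrite ler_pM2l.
  lra.
have tau4 : (tau <= s / 4)%R by rewrite (le_trans _ ltau)// ler_peMl// ltW.
have s20 : (0 < s / 2)%R by rewrite divr_gt0.
have [zs [uzs zsy sep cov]] :=
  finite_net mu_borel Cd1 mu_dbl s20 tau0 (@subset_refl _ (ball y (s / 2)%R)).
have zy z : z \in zs -> (mdist y z < s / 2)%R by move=> /zsy; rewrite ballEmdist.
have zys z : z \in zs -> ball z tau `<=` ball y s.
  by move=> /zy h; apply: ball_subset_ball; lra.
have half z : z \in zs -> (V (ball z tau `\` D) <= 2^-1 * V (ball z tau))%R.
  move=> zin; apply: (@le_trans _ _ (V (ball y s `\` D))).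
    apply: (@V_le y s); last exact: subDsetl.
    by move=> x [h nD]; split => //; exact: zys h.
  apply: (le_trans hs).
  have h1 : (V (ball y s) <= V (ball z (2 ^+ j.+1 * tau)))%R.
    apply: (@V_le z (2 ^+ j.+1 * tau)%R) => //; apply: ball_subset_ball.
    have -> : (2 ^+ j.+1 * tau = 2 * s)%R.
      by rewrite exprS /tau; field; rewrite gt_eqF.
    by have := zy _ zin; rewrite metric_sym; lra.
  have h2 := V_doubling j.+1 z tau0.
  rewrite /gamma -mulrA ler_pM2l// mulrC ler_pdivrMr ?exprn_gt0// mulrC.
  exact: le_trans h1 h2.
have ov x : (\sum_(z <- zs) \1_(ball z (lambda * tau)) x <=
    N * \1_(ball y (3 / 4 * s)) x :> R)%R.
  rewrite sum_indic_size; set f := [seq _ <- _ | _].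
  have fP z : z \in f -> z \in zs /\ ball z (lambda * tau)%R x.
    by rewrite mem_filter => /andP[/set_mem].
  have uf : uniq f by exact: filter_uniq.
  have [f0|[z zf]] : f = [::] \/ exists z, z \in f.
    by case: (f) => [|z f']; [left|right; exists z; rewrite mem_head].
    by rewrite f0 mulr_ge0// ltW.
  have [zin zx] := fP _ zf.
  rewrite indicE mem_set ?mulr1; last first.
    have : ball z (lambda * tau)%R `<=` ball y (3 / 4 * s)%R; last exact.
    by apply: ball_subset_ball; have := zy _ zin; lra.
  have kt0 : (0 < 2 ^+ k * tau)%R by rewrite mulr_gt0// exprn_gt0.
  apply: (separated_size mu_borel Cd1 mu_dbl (x := x) kt0 uf).
  - move=> z' /fP[_]; rewrite !ballEmdist/= metric_sym => h.
    by rewrite (lt_le_trans h)// ler_pM2r.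
  - move=> z1 z2 /fP[z1s _] /fP[z2s _] z12.
    by rewrite ler_wpM2l ?exprn_ge0// sep.
pose r := (mdist (point : X) y + s)%R.
have yr : ball y s `<=` ball (point : X) r by exact: ball_subset_ball.
pose d := V (ball y s `\` D).
(* The net is fixed before sigma, so the error vanishes with sigma although it is multiplied by the
   number of balls. *)
have main sigma : (0 < sigma)%R -> (V (ball y (s / 2) `\` D) <=
    (size zs)%:R * sigma + CP * tau * (N * (8 / s * d + sigma)))%R.
  move=> sigma0.
  have [w [g [Lw w01 Ug Dw Eg]]] :=
    energy_bound mu_reg mu_dbl mD alpha_le cD aD s0 yU r sigma0.
  have [mg g0 _] := Ug; have mgX := borel_fun_cara mu_borel mg.
  rewrite -lee_fin fineK; last exact: (mu_fin_sub mu_dbl (@subDsetl _ _ _)).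
  apply: (le_trans (@outer_measure_seq_le zs (fun z => ball z tau `\` D) _ _)).
    by move=> x [/cov[z zin zx] nD]; exists z.
  apply: (@le_trans _ _ (\sum_(z <- zs) (sigma%:E +
      (CP * tau)%:E * \int[m]_(x in ball z (lambda * tau)%R) g x))).
    rewrite big_seq [leRHS]big_seq; apply: lee_sum => z zin.
    apply: (poincare_set mu_reg mu_dbl mD CP1 lambda1 poincare
      (r := r) tau0 Lw w01 Ug _ Dw (half _ zin)).
    exact: subset_trans (zys _ zin) yr.
  rewrite big_split/= EFinD; apply: leeD.
    rewrite sumEFin lee_fin big_const_seq count_predT iter_addr_0 mulr_natl.
    by [].
  rewrite -ge0_sume_distrr; last by move=> z _; apply: integral_ge0.
  rewrite [(CP * tau * _)%:E]EFinM; apply: lee_wpmul2l.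
    by rewrite lee_fin mulr_ge0 ?ltW.
  apply: (@le_trans _ _ (N%:E * \int[m]_(x in ball y (3 / 4 * s)%R) g x)).
    apply: (sum_integral_overlap (B := fun z => ball z (lambda * tau)%R)) => //.
    exact: ltW.
  rewrite EFinM; apply: lee_wpmul2l => //; by rewrite lee_fin ltW.
have d0 : (0 <= d)%R by exact: V_ge0.
have lim : (V (ball y (s / 2) `\` D) <= CP * tau * (N * (8 / s * d)))%R.
  apply/ler_addgt0Pr => e e0.
  pose q := ((size zs)%:R + CP * tau * N + 1)%R.
  have q1 : (0 <= (size zs)%:R + CP * tau * N)%R.
    by rewrite addr_ge0// !mulr_ge0// ltW.
  have q0 : (0 < q)%R by rewrite /q; lra.
  have sig0 : (0 < e / q)%R by rewrite divr_gt0.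
  apply: (le_trans (main _ sig0)).
  have -> : ((size zs)%:R * (e / q) + CP * tau * (N * (8 / s * d + e / q)) =
    CP * tau * (N * (8 / s * d)) + (e / q) * ((size zs)%:R + CP * tau * N))%R by ring.
  rewrite lerD2l mulrAC ler_pdivrMr// ler_pM2l// /q; lra.
apply: (le_trans lim).
have E : (CP * tau * (N * (8 / s * d)) = (8 * CP * N) * d / 2 ^+ j)%R.
  by rewrite /tau; field; rewrite !gt_eqF.
have hV : (V (ball y s) <= Cd * V (ball y (s / 2)))%R.
  by have := V_doubling 1 y s20; rewrite !expr1 mulrC divfK.
rewrite E ler_pdivrMr//.
apply: (@le_trans _ _ (8 * CP * N * (gamma * (Cd * V (ball y (s / 2)))))%R).
  rewrite ler_pM2l ?mulr_gt0//; apply: (le_trans hs).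
  by rewrite ler_pM2l.
have -> : (8 * CP * N * (gamma * (Cd * V (ball y (s / 2)))) =
  gamma * V (ball y (s / 2)) * (8 * CP * N * Cd))%R by ring.
by apply: ler_wpM2l => //; rewrite mulr_ge0 ?V_ge0// ltW.
Qed.

(** Otherwise [ball x s] minus D has a density point y. There the density of the complement of D
    tends to 1, while [density_step] keeps it at most 1/2 at all radii s / 2^n. The division by Cd^2
    pays for passing from the ball of radius 2s about x to that of radius s about y, by way of
    radius 4s. *)
Lemma density_null : exists gamma : R, (0 < gamma)%R /\
  forall (x : X) (s : R), (0 < s)%R -> ball x (2 * s) `<=` U ->
    (V (ball x (2 * s) `\` D) <= gamma * V (ball x (2 * s)))%R ->
    mu (ball x s `\` D) = 0.
Proof.
have Cd0 : (0 < Cd)%R by rewrite (lt_le_trans _ Cd1).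
have [gamma [gamma0 gamma2 step]] := density_step.
exists (gamma / Cd ^+ 2)%R; split; first by rewrite divr_gt0// exprn_gt0.
move=> x s s0 xU hx.
pose A := ball x s `\` D.
have mA : mu.-cara.-measurable A by apply: measurableD => //; exact: mB.
have [A0|[y [Ay IAy]]] : A `<=` A `\` meas_interior mu A \/
    exists y, A y /\ meas_interior mu A y.
  have [h|h] := pselect (exists y, A y /\ meas_interior mu A y); first by right.
  by left => y Ay; split => // Iy; apply: h; exists y.
  apply/eqP; rewrite eq_le outer_measure_ge0 andbT.
  rewrite -(doubling_lebesgue_density mu_reg Cd1 mu_dbl mA (@subDsetl _ _ _)).
  exact: le_outer_measure.
exfalso; have [xy nDy] := Ay; move: xy; rewrite ballEmdist/= => xy.
have ys : ball y s `<=` ball x (2 * s)%R by apply: ball_subset_ball; lra.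
have base : (V (ball y s `\` D) <= gamma * V (ball y s))%R.
  apply: (@le_trans _ _ (V (ball x (2 * s) `\` D))).
    apply: (@V_le x (2 * s)%R); last exact: subDsetl.
    by move=> z [yz nD]; split => //; exact: ys.
  apply: (le_trans hx); rewrite -mulrA ler_pM2l//.
  rewrite mulrC ler_pdivrMr ?exprn_gt0// [leRHS]mulrC.
  apply: le_trans (V_doubling 2 y s0); apply: (@V_le y (2 ^+ 2 * s)%R) => //.
  by apply: ball_subset_ball; rewrite metric_sym expr2; lra.
have scales n : (V (ball y (s / 2 ^+ n) `\` D) <= gamma * V (ball y (s / 2 ^+ n)))%R.
  elim: n => [|n IH]; first by rewrite expr0 divr1.
  have sn0 : (0 < s / 2 ^+ n)%R by rewrite divr_gt0// exprn_gt0.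
  have -> : (s / 2 ^+ n.+1 = s / 2 ^+ n / 2)%R.
    by rewrite exprS; field; rewrite gt_eqF// exprn_gt0.
  apply: step => //; apply: subset_trans xU; apply: subset_trans ys; apply: le_ball.
  by rewrite ler_pdivrMr ?exprn_gt0// ler_peMr ?(ltW s0)// exprn_ege1// ler1n.
(* At most a quarter outside A and at most a half outside D cannot make up a whole ball. *)
have q0 : (0 < 4^-1 :> R)%R by rewrite invr_gt0.
have [d d0 hd] := (meas_interiorP mu_dbl A y).1 IAy _ q0.
have e0 : (0 < Num.min d (s - mdist x y))%R by rewrite lt_min d0 subr_gt0.
have [n hn] := exists_expr_ge (s / (Num.min d (s - mdist x y)) + 1)%R.
pose r := (s / 2 ^+ n)%R; have r0 : (0 < r)%R by rewrite divr_gt0// exprn_gt0.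
have rd : (r < Num.min d (s - mdist x y))%R.
  rewrite /r ltr_pdivrMr ?exprn_gt0// mulrC -ltr_pdivrMr//; lra.
move: rd; rewrite lt_min => /andP[rd rxy].
have yx : ball y r `<=` ball x s by apply: ball_subset_ball; lra.
have Vr0 : (0 < V (ball y r))%R.
  rewrite fine_gt0// (mu_ball_lty mu_dbl) andbT.
  exact: (mu_ball_gt0 mu_dbl).
have h1 : (V (ball y r `\` A) <= 4^-1 * V (ball y r))%R.
  have := hd r; rewrite r0 rd => /(_ isT).
  rewrite -(fineK (mu_ball_fin mu_dbl y r)) -{1}(@fineK _ (mu (ball y r `\` A))).
    by rewrite -EFinM lee_fin.
  exact: (mu_fin_sub mu_dbl (@subDsetl _ _ _)).
have h2 := scales n; rewrite -/r in h2.
have h3 : (V (ball y r) <= V (ball y r `\` A) + V (ball y r `\` D))%R.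
  have f1 : mu (ball y r `\` A) \is a fin_num.
    exact: (mu_fin_sub mu_dbl (@subDsetl _ _ _)).
  have f2 : mu (ball y r `\` D) \is a fin_num.
    exact: (mu_fin_sub mu_dbl (@subDsetl _ _ _)).
  rewrite -fineD//; apply: fine_le; [exact: (mu_ball_fin mu_dbl)|by rewrite fin_numD f1|].
  apply: le_trans (outer_measureU2 mu _ _); apply: le_outer_measure => z yz.
  have [Dz|nD] := pselect (D z); [left|right]; split => //.
  by move=> [_].
have : (gamma * V (ball y r) <= 2^-1 * V (ball y r))%R by rewrite ler_pM2r.
lra.
Qed.

End DensityImprovement.

(** * The potential *)

Section Potential.
Context (R : realType) (X : completeMetricType R).
Context (mu : {outer_measure set X -> \bar R}).
Hypothesis mu_reg : borel_regular mu.
Variable Cd : R.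
Hypothesis Cd1 : (1 <= Cd)%R.
Hypothesis mu_dbl : forall (x : X) (r : R), (0 < r)%R ->
  [/\ 0 < mu (ball x (2 * r)%R),
      mu (ball x (2 * r)%R) <= Cd%:E * mu (ball x r) &
      mu (ball x r) < +oo].
Local Notation m := (cara_measure mu).
Local Notation Xm := (caratheodory_type mu).
Local Notation measurable_on u := (measurable_fun [set: Xm] (u : Xm -> R)).
Let mu_borel := mu_reg.1.
Let mB := measurable_ball_cara mu_borel.

Lemma meas_interiorS (E F : set X) : E `<=` F ->
  meas_interior mu E `<=` meas_interior mu F.
Proof.
move=> EF x /(meas_interiorP mu_dbl) hx; apply/(meas_interiorP mu_dbl) => k k0.
have [d d0 hd] := hx k k0; exists d => // r rd.
apply: le_trans (hd r rd); apply: le_outer_measure => y [yr nF]; split => //.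
by move=> /EF.
Qed.

(* H need not be measurable: off a Borel hull of the complement of H in the
   ball, almost every point is a density point of H. *)
Lemma meas_interior_full (H D : set X) (x : X) (r : R) :
  mu.-cara.-measurable D -> meas_interior mu H `<=` D ->
  mu (ball x r `\` D) <= mu (ball x r `\` H).
Proof.
move=> mD HD; have [C [bC HC ->]] := mu_reg.2 (ball x r `\` H).
pose M := ball x r `\` C.
have mM : mu.-cara.-measurable M by apply: measurableD; [exact: mB|exact: mu_borel].
have MH : M `<=` H.
  by move=> y [yx nC]; apply: contrapT => nH; apply: nC; apply: HC.
have M0 : mu (M `\` D) = 0.
  apply/eqP; rewrite eq_le outer_measure_ge0 andbT.
  rewrite -(doubling_lebesgue_density mu_reg Cd1 mu_dbl mM (@subDsetl _ _ _)).
  apply: le_outer_measure => y [My nD]; split => // Iy; apply: nD; apply: HD.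
  exact: meas_interiorS MH _ Iy.
rewrite -[leRHS]adde0 -M0; apply: le_trans (outer_measureU2 mu _ _).
apply: le_outer_measure => y [yx nD].
by have [Cy|nC] := pselect (C y); [left|right].
Qed.

Lemma indic_unit (D : set X) : unit_valued (\1_D : X -> R).
Proof. by move=> x; rewrite indicE; case: (_ \in _); rewrite ?lexx ?ler01. Qed.

Lemma measurable_on_indic (D : set X) : mu.-cara.-measurable D ->
  measurable_on (\1_D : X -> R).
Proof. by move=> mD; exact: (@measurable_indic _ Xm). Qed.

Lemma approximable_indic_ae (D E : set X) (c : R) :
  mu.-cara.-measurable D -> mu.-cara.-measurable E -> D `<=` E ->
  (forall r : R, mu ((E `\` D) `&` ball (point : X) r) = 0) ->
  approximable mu (\1_D : X -> R) c -> approximable mu (\1_E : X -> R) c.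
Proof.
move=> mD mE DE E0 aD e e0; have [w [g [Lw Ug Dw Ig]]] := aD e e0.
exists w, g; split => //; apply: le_trans Dw.
have mw := lip_loc_measurable mu_borel Lw.
have mD1 := measurable_on_indic mD; have mE1 := measurable_on_indic mE.
rewrite -[leRHS]adde0.
apply: le_trans (L1dist_triangle mu_borel _ mw mD1 mE1) _; apply: leeD => //.
have mED : mu.-cara.-measurable (E `\` D) by exact: measurableD.
rewrite -(E0 e^-1%R).
rewrite -(@integral_indic _ Xm R m (ball (point : X) e^-1%R) (mB _ _) (E `\` D) mED).
rewrite le_eqVlt; apply/orP; left; apply/eqP; apply: eq_integral => x _.
congr EFin; rewrite !indicE in_setD.
have [xD|xD] := boolP (x \in D); last by rewrite andbT sub0r normrN ger0_norm.
have xE : x \in E by move: xD; rewrite !inE; exact: DE.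
by rewrite xE subrr normr0.
Qed.

(** The density theorem replaces a countable subcover: near a density point y of N a small ball has
    at most half its measure outside N, yet its part in N is null, being contained in the null set
    of a ball around y minus D. *)
Lemma null_neighbourhood (D E : set X) (r : R) :
  mu.-cara.-measurable D -> mu.-cara.-measurable E ->
  (forall x, E x -> exists2 s : R, (0 < s)%R & mu (ball x s `\` D) = 0) ->
  mu ((E `\` D) `&` ball (point : X) r) = 0.
Proof.
move=> mD mE HE; set N := _ `&` _.
have mN : mu.-cara.-measurable N.
  by apply: measurableI; [exact: measurableD|exact: mB].
apply/eqP; rewrite eq_le outer_measure_ge0 andbT.
rewrite -(doubling_lebesgue_density mu_reg Cd1 mu_dbl mN (@subIsetr _ _ _)).
apply: le_outer_measure => y Ny; split => // /(meas_interiorP mu_dbl) Iy.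
have [[Ey nDy] _] := Ny; have [s s0 hs] := HE _ Ey.
have q0 : (0 < 2^-1 :> R)%R by rewrite invr_gt0.
have [d d0 hd] := Iy _ q0.
pose t := (Num.min s (d / 2))%R.
have t0 : (0 < t)%R by rewrite lt_min s0 divr_gt0.
have ts : (t <= s)%R by rewrite ge_min lexx.
have td : (t < d)%R.
  have : (t <= d / 2)%R by rewrite ge_min lexx orbT.
  lra.
have := hd t; rewrite t0 td => /(_ isT).
have Bf := mu_ball_fin mu_dbl y t.
have B0 : (0 < fine (mu (ball y t)))%R.
  by rewrite fine_gt0// (mu_ball_gt0 mu_dbl)//= (mu_ball_lty mu_dbl).
have h : mu (ball y t) <= mu (ball y t `\` N).
  rewrite -[leRHS]adde0 -hs; apply: le_trans (outer_measureU2 mu _ _).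
  apply: le_outer_measure => z zt; have [Nz|nN] := pselect (N z); last by left.
  right; have [[_ nDz] _] := Nz; split => //.
  by move: zt; apply: le_ball.
move=> /(le_trans h); rewrite -(fineK Bf) -EFinM lee_fin; lra.
Qed.

(** Truncation of extended values; [fine] is applied to a finite value, so its default is never
    met. *)
Definition eclamp (y : \bar R) : R := fine (maxe 0 (mine 1 y)).

Lemma eclamp_EFin (t : R) : eclamp t%:E = clamp t.
Proof. by rewrite /eclamp -EFin_min -EFin_max. Qed.

Lemma eclamp_contraction (t : R) (y : \bar R) :
  (`|clamp t - eclamp y|)%:E <= `|t%:E - y|.
Proof.
case: y => [s| |]; last 2 first.
- by rewrite leey.
- by rewrite leey.
by rewrite eclamp_EFin -EFinB lee_fin; exact: clamp_contraction.
Qed.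

Lemma eclamp01 (y : \bar R) : (0 <= eclamp y <= 1)%R.
Proof.
rewrite /eclamp; set z := maxe _ _.
have z0 : 0 <= z by rewrite le_max lexx.
have z1 : z <= 1 by rewrite ge_max lee01 ge_min lexx.
have zf : z \is a fin_num by rewrite ge0_fin_numE// (le_lt_trans z1)// ltry.
by rewrite -!lee_fin !fineK// z0.
Qed.

Lemma eclamp1 (y : \bar R) : 1 <= y -> eclamp y = 1%R.
Proof. by move=> h; rewrite /eclamp min_l// max_r// lee01. Qed.

Lemma measurable_eclamp (u : X -> \bar R) :
  measurable_fun [set: Xm] (u : Xm -> \bar R) -> measurable_on (eclamp \o u).
Proof.
move=> mu1.
have mz : measurable_fun [set: Xm] ((fun x => maxe 0 (mine 1 (u x))) : Xm -> \bar R).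
  by apply: measurable_maxe => //; exact: measurable_mine.
exact: (measurableT_comp (fine_measurable measurableT) mz).
Qed.

Lemma eclamp_competitor (K U : set X) (u : X -> \bar R) : L1_loc mu u ->
  set_nbhs K [set x | 1 <= u x] -> (forall x, ~ U x -> u x = 0) ->
  competitor mu K U (eclamp \o u).
Proof.
move=> [mu1 _] uK uU; split.
- exact: measurable_eclamp.
- by move=> x; exact: eclamp01.
- by move=> x Kx; apply: eclamp1; exact: (nbhs_singleton (uK _ Kx)).
- by move=> x nU /=; rewrite uU// eclamp_EFin clamp_id// lexx ler01.
Qed.

End Potential.

Theorem proposition5p7 (R : realType) (X : completeMetricType R)
  (two_points : exists x y : X, x <> y)
  (mu : {outer_measure set X -> \bar R})
  (mu_regular : borel_regular mu) (mu_doubling : doubling mu)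
  (mu_poincare : poincare11 mu)
  (U H : set X) (openU : open U)
  (sub_IH_U : meas_interior mu H `<=` U)
  (cap_fin : cap_BV mu (meas_interior mu H) U < +oo) :
  exists D : set X, capacitary_potential mu (meas_interior mu H) U D.
Proof.
have [Cd Cd1 mu_dbl] := mu_doubling.
have [CP [lambda [CP1 lambda1 poincare]]] := mu_poincare.
have mu_borel := mu_regular.1.
set K := meas_interior mu H in sub_IH_U cap_fin *.
have adm_approx u c : L1_loc mu u -> variation_norm mu u <= c%:E ->
    approximable mu (@eclamp R \o u) c.
  move=> [mu1 _]; apply: (approximable_of_variation mu_borel Cd1 mu_dbl) => //.
  - exact: measurable_eclamp.
  - by move=> x t; exact: eclamp_contraction.
pose S := [set c : R | exists2 v, competitor mu K U v & approximable mu v c].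
have S_ge0 : lbound S 0%R by move=> c [v _ vc]; exact: approximable_ge0 vc.
have S_ne : S !=set0.
  have [_ [u [Lu uK uU] <-] hu] := ereal_inf_lt cap_fin.
  (* The value -oo is not excluded at this point; 0 is then a bound. *)
  have [c hc] : exists c : R, variation_norm mu u <= c%:E.
    move: hu; case: (variation_norm mu u) => [r _|//|_]; first by exists r.
    by exists 0%R; rewrite leNye.
  by exists c, (@eclamp R \o u); [exact: eclamp_competitor|exact: adm_approx].
have infS : has_inf S by split => //; exists 0%R.
pose alpha := inf S.
have alpha_le u c : competitor mu K U u -> approximable mu u c -> (alpha <= c)%R.
  by move=> cu uc; apply: inf_lbound; [exists 0%R|exists u].
have alpha_inf (e : R) : (0 < e)%R ->
    exists2 u, competitor mu K U u & approximable mu u (alpha + e).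
  move=> e0; have [c [u cu uc] hc] := inf_adherent e0 infS.
  by exists u => //; apply: approximable_le uc; exact: ltW.
have [D [mD cD aD]] := minimizer_set mu_borel mu_dbl alpha_le alpha_inf.
have [_ _ DK DU] := cD.
have KD : K `<=` D.
  move=> x /DK; rewrite indicE; have [/set_mem//|_ /eqP] := boolP (x \in D).
  by rewrite eq_sym oner_eq0.
have sDU : D `<=` U.
  move=> x Dx; apply: contrapT => /DU; rewrite indicE mem_set//.
  by move/eqP; rewrite oner_eq0.
have full x r := meas_interior_full mu_regular Cd1 mu_dbl x r mD KD.
have KID : K `<=` meas_interior mu D.
  move=> x /(meas_interiorP mu_dbl) hx; apply/(meas_interiorP mu_dbl) => k k0.
  have [d d0 hd] := hx k k0; exists d => // r rd.
  exact: le_trans (full x r) (hd r rd).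
have [gamma [gamma0 null]] := density_null mu_regular Cd1 mu_dbl mD alpha_le
  cD aD CP1 lambda1 poincare.
have Knull x : K x -> exists2 s : R, (0 < s)%R & mu (ball x s `\` D) = 0.
  move=> Kx; have := openU; rewrite openE => /(_ _ (sub_IH_U _ Kx)).
  rewrite /interior -nbhs_ballE => -[t /= t0 xtU].
  have [d d0 hd] := (meas_interiorP mu_dbl D x).1 (KID _ Kx) _ gamma0.
  (* A quarter keeps the doubled radius 2s, on which the density is tested, strictly below d and
     inside U. *)
  pose s := (Num.min t d / 4)%R.
  have s0 : (0 < s)%R by rewrite divr_gt0// lt_min t0.
  have st : (4 * s <= t)%R by rewrite mulrC divfK// ge_min lexx.
  have sd : (4 * s <= d)%R by rewrite mulrC divfK// ge_min lexx orbT.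
  exists s => //; apply: null => //.
    by apply: subset_trans xtU; apply: le_ball; lra.
  have := hd (2 * s)%R; have -> : (0 < 2 * s < d)%R by apply/andP; split; lra.
  move=> /(_ isT); rewrite -(fineK (mu_ball_fin mu_dbl x (2 * s)%R)).
  rewrite -{1}(fineK (mu_fin_sub mu_dbl (@subDsetl _ (ball x (2 * s)%R) D))).
  by rewrite -EFinM lee_fin.
(* This set is open, contains K, and adds only a null set to D. *)
pose D' := [set x | U x /\ exists2 s : R, (0 < s)%R & mu (ball x s `\` D) = 0].
have oD' : open D'.
  rewrite openE => x [Ux [s s0 hs]].
  have := openU; rewrite openE => /(_ _ Ux); rewrite /interior -!nbhs_ballE.
  move=> [t /= t0 xtU]; have s20 : (0 < s / 2)%R by rewrite divr_gt0.
  exists (Num.min t (s / 2))%R; first by rewrite /= lt_min t0.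
  move=> y xy; split.
    by apply: xtU; move: xy; apply: le_ball; rewrite ge_min lexx.
  exists (s / 2)%R => //; apply/eqP; rewrite eq_le outer_measure_ge0 andbT -hs.
  apply: le_outer_measure => z [yz nD]; split => //; move: z yz {nD}.
  apply: ball_subset_ball.
  have : ball x (s / 2)%R y by move: xy; apply: le_ball; rewrite ge_min lexx orbT.
  rewrite ballEmdist/=; lra.
have mD' : mu.-cara.-measurable D' by apply: mu_borel; exact: sub_sigma_algebra.
have mE : mu.-cara.-measurable (D `|` D') by exact: measurableU.
have aE : approximable mu (\1_(D `|` D') : X -> R) alpha.
  apply: approximable_indic_ae aD => // r; rewrite setDUl setDv set0U.
  by apply: (null_neighbourhood mu_regular Cd1 mu_dbl) => // x [_].
(* The value -oo is ruled out because it would give alpha <= alpha - 1. *)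
have alpha_lower (x : \bar R) : (forall c, x <= c%:E -> (alpha <= c)%R) -> alpha%:E <= x.
  case: x => [r h|h|h]; [by rewrite lee_fin; exact: h|by rewrite leey|].
  have : (alpha <= alpha - 1)%R by apply: h; rewrite leNye.
  by rewrite lerBrDr gerDl ler10.
have VD : perimeter mu D = alpha%:E.
  apply/eqP; rewrite eq_le; apply/andP; split.
    by apply: variation_norm_le => //; exact: measurable_on_indic.
  apply: alpha_lower => c hc; apply: (alpha_le _ _ cD).
  rewrite (_ : \1_D = @eclamp R \o (EFin \o \1_D)); last first.
    by apply/funext => x; rewrite /= eclamp_EFin clamp_id//; exact: indic_unit.
  apply: adm_approx => //; apply: (L1_loc_bounded mu_regular mu_dbl).
    exact: measurable_on_indic.
  exact: indic_unit.
have capE : cap_BV mu K U = alpha%:E.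
  apply/eqP; rewrite eq_le; apply/andP; split; last first.
    apply: le_ereal_inf_tmp => _ [u [Lu uK uU] <-]; apply: alpha_lower => c hc.
    by apply: (alpha_le (@eclamp R \o u)); [exact: eclamp_competitor|exact: adm_approx].
  (* This indicator is admissible for the capacity, being 1 on the open set [D'] around K, and its
     variation is still at most alpha. *)
  apply: (@le_trans _ _ (variation_norm mu (EFin \o \1_(D `|` D')))); last first.
    by apply: variation_norm_le => //; exact: measurable_on_indic.
  apply: ereal_inf_lbound; exists (EFin \o \1_(D `|` D')) => //; split.
  - apply: (L1_loc_bounded mu_regular mu_dbl); first exact: measurable_on_indic.
    exact: indic_unit.
  - move=> x Kx; have D'x : D' x by split; [exact: sub_IH_U|exact: Knull].
    apply: filterS (open_nbhs_nbhs (conj oD' D'x)) => y D'y /=.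
    by rewrite indicE mem_set//; right.
  - move=> x nU /=; rewrite indicE memNset//.
    by move=> [/sDU|[]].
exists D; split => //; first by rewrite VD capE.
Qed.
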